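(* Let $t\in\mathbb{N}$, $p\in\mathbb{N}\cup\{0\}$ and $a,b\in\mathbb{R}$ with $ab>0$. Put $q=\frac{a}{b}$ and $$\mathbf{I}^{+}(a,b,p,t):=\int_{-\infty}^{\infty}\frac{x^{p}\,\mathrm{Li}_{t}(e^{ax})}{1+e^{bx}}\,\mathrm{d}x .$$ Then the following hold. If $p+t$ is odd, $$\frac{\operatorname{sign}(b)}{p!}\,b^{p+1}\,\mathbf{I}^{+}(a,b,p,t)=\frac{(-1)^{p}}{q^{p+1}}\,\zeta(p+t+1)+2\sum_{j=0}^{\lfloor t/2\rfloor}q^{t-2j}\binom{p+t-2j}{p}\,\eta(p+t+1-2j)\,\zeta(2j)-q^{t-1}\binom{p+t-1}{p}\,\eta(p+t)\,\pi\, i .$$ If $p+t$ is even, $$\frac{\operatorname{sign}(b)}{p!}\,b^{p+1}\,\mathbf{I}^{+}(a,b,p,t)=\frac{(-1)^{p}}{q^{p+1}}\,\zeta(p+t+1)+2\sum_{j=0}^{\lfloor t/2\rfloor}q^{t-2j}\binom{p+t-2j}{p}\,\eta(p+t+1-2j)\,\zeta(2j)$$ $$\qquad\qquad+2(-1)^{p}\sum_{n=1}^{\infty}\sum_{k=1}^{\infty}\frac{(-1)^{k}}{n^{t}(qn+k)^{p+1}}-q^{t-1}\binom{p+t-1}{p}\,\eta(p+t)\,\pi\, i .$$ Furthermore, if $p+t$ is even and $t>1$, this last identity can be written as $$\frac{\operatorname{sign}(b)}{p!}\,b^{p+1}\,\mathbf{I}^{+}(a,b,p,t)=\frac{(-1)^{p}}{q^{p+1}}\,\zeta(p+t+1)+2\sum_{j=0}^{\lfloor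 t/2\rfloor}q^{t-2j}\binom{p+t-2j}{p}\,\eta(p+t+1-2j)\,\zeta(2j)$$ $$\qquad\qquad+2(-1)^{p}\Bigl[\mathbb{S}_{p+1,t}(q)-2^{-p}\,\mathbb{S}_{p+1,t}\bigl(\tfrac{q}{2}\bigr)-\eta(p+1)\,\zeta(t)\Bigr]-q^{t-1}\binom{p+t-1}{p}\,\eta(p+t)\,\pi\, i .$$
   Context: $\mathbb{N}=\{1,2,3,\dots\}$. $\mathrm{Li}_t$ is the polylogarithm, $\mathrm{Li}_t(z)=\sum_{k\ge1}z^k/k^t$ for $|z|<1$, extended outside the unit disc by analytic continuation. For real arguments larger than $1$ the branch is the one fixed by Jonquière's relation: for $0<x<1$ and $m\in\mathbb{N}$, $$\mathrm{Li}_m(x)+(-1)^m\,\mathrm{Li}_m\bigl(\tfrac1x\bigr)=2\sum_{j=0}^{\lfloor m/2\rfloor}\frac{\log^{m-2j}(x)}{(m-2j)!}\,\zeta(2j)+i\,\pi\,\frac{\log^{m-1}(x)}{(m-1)!}.$$ Equivalently, for $y>1$, $\mathrm{Li}_m(y)$ is the limit from below the cut, with imaginary part $-\pi\log^{m-1}(y)/(m-1)!$. For example $\mathrm{Li}_1(y)=-\log(y-1)-\pi i$ for $y>1$. The integral is thus complex-valued. $\zeta$ is the Riemann zeta function (so $\zeta(0)=-\tfrac12$). $\eta$ is the Dirichlet eta function, $\eta(s)=\sum_{n\ge1}(-1)^{n+1}n^{-s}$ for $\Re(s)>0$, with $\eta(1)=\log2$. The double sum is an iterated sum: the inner sum over $k$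 is taken first. For real $\lambda>0$ and $m\in\mathbb{N}$ the extended harmonic numbers are $H^{(1)}_\lambda=\gamma+\psi(\lambda+1)$ and, for $m\ge2$, $H^{(m)}_\lambda=\zeta(m)+\frac{(-1)^{m-1}}{(m-1)!}\psi^{(m-1)}(\lambda+1)$. Here $\gamma$ is the Euler–Mascheroni constant, $\psi=\Gamma'/\Gamma$ is the digamma function, and $\psi^{(k)}$ is its $k$-th derivative. For $\lambda\in\mathbb{N}$ this gives $H^{(m)}_\lambda=\sum_{j=1}^{\lambda}j^{-m}$. For real $r>0$, $m\in\mathbb{N}$ and integer $t>1$: $\mathbb{S}_{m,t}(r)=\sum_{n=1}^{\infty}\frac{H^{(m)}_{rn}}{n^{t}}$. *)

(* Defs.v *)
From HB Require Import structures.
From mathcomp Require Import all_boot all_order all_algebra.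
From mathcomp Require Import complex.
From mathcomp Require Import all_classical all_reals all_analysis.

Set Implicit Arguments.
Unset Strict Implicit.
Unset Printing Implicit Defensive.

Import Order.TTheory GRing.Theory Num.Theory.
Import numFieldNormedType.Exports.

Local Open Scope classical_set_scope.
Local Open Scope ring_scope.
Local Open Scope complex_scope.

Section Polylogarithm.
Variable R : realType.
Implicit Types (f Li : R[i] -> R[i]) (z w : R[i]) (t : nat).

(* The suffix ^o selects the topology of R[i] given by its norm. *)
Definition csum_to (u : nat -> R[i]) (l : R[i]) : Prop :=
  (fun N => \sum_(0 <= k < N) u k : R[i]^o) @ \oo --> (l : R[i]^o).

Definition analytic_at f w : Prop :=
  exists (c : nat -> R[i]) (r : R), 0 < r /\
    forall z, `|z - w| < r%:C -> csum_to (fun k => c k * (z - w) ^+ k) (f z).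

Definition slit_plane : set R[i] := [set z | ~ (complex.Im z = 0 /\ 1 <= complex.Re z)].

(* Li is the polylogarithm of order t: the analytic continuation to
   C \ [1, +oo[ of the sum of z^k / k^t over k >= 1, extended to the cut
   ]1, +oo[ by its limits from below.  By the identity theorem these clauses
   determine Li everywhere except at 1, where no value is prescribed (Li_1 is
   singular there). *)
Definition is_polylog t Li : Prop :=
  [/\ forall z, `|z| < 1 -> csum_to (fun k => z ^+ k.+1 / k.+1%:R ^+ t) (Li z),
      forall z, slit_plane z -> analytic_at Li z
    & forall y : R, 1 < y ->
        (Li z : R[i]^o) @[z --> within [set z : R[i]^o | complex.Im z < 0]
                                       (nbhs (y%:C : R[i]^o))]
          --> (Li y%:C : R[i]^o)].

End Polylogarithm.

Section ComplexIntegral.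
Variable R : realType.
Implicit Type f : R -> R[i].

Definition cintegrable f : Prop :=
  lebesgue_measure.-integrable [set: R] (EFin \o (fun x => complex.Re (f x))) /\
  lebesgue_measure.-integrable [set: R] (EFin \o (fun x => complex.Im (f x))).

Definition cintegral f : R[i] :=
  (\int[lebesgue_measure]_x complex.Re (f x)) +i* (\int[lebesgue_measure]_x complex.Im (f x)).

End ComplexIntegral.

Section SpecialFunctions.
Variable R : realType.
Implicit Types (m s t n : nat) (x r : R).

(* The index starts at 1; the value is meaningful only under rsummable. *)
Definition rsummable (u : nat -> R) : Prop :=
  cvgn (fun N => \sum_(1 <= n < N) u n).

Definition rsum (u : nat -> R) : R := limn (fun N => \sum_(1 <= n < N) u n).

(* Riemann zeta at natural numbers: the value at 0 is that of the analytic
   continuation; the value at the pole 1 is meaningless. *)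
Definition zeta s : R :=
  if s == 0%N then - 2^-1 else rsum (fun n => (n%:R ^+ s)^-1).

Definition eta s : R := rsum (fun n => (-1) ^+ n.+1 / n%:R ^+ s).

Definition euler_gamma : R :=
  limn (fun n => (\sum_(1 <= k < n.+1) k%:R^-1) - ln n%:R : R).

Definition Gamma x : R :=
  \int[lebesgue_measure]_(u in `]0, +oo[) (u `^ (x - 1) * expR (- u)).

Definition digamma x : R := derive1 Gamma x / Gamma x.

Definition harmonic_ext m x : R :=
  if m == 1%N then euler_gamma + digamma (x + 1)
  else zeta m + (-1) ^+ m.-1 / (m.-1)`!%:R * derive1n m.-1 digamma (x + 1).

Definition euler_sum m t r : R :=
  rsum (fun n => harmonic_ext m (r * n%:R) / n%:R ^+ t).

End SpecialFunctions.

Definition Iplus_integrand (R : realType) (Li : R[i] -> R[i]) (a b : R)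
    (p : nat) (x : R) : R[i] :=
  (x ^+ p)%:C * Li (expR (a * x))%:C / (1 + expR (b * x))%:C.

Definition Iplus (R : realType) (Li : R[i] -> R[i]) (a b : R) (p : nat) : R[i] :=
  cintegral (Iplus_integrand Li a b p).

(* Main.v *)
(* Take a, b > 0.  For x < 0 the argument e^{ax} lies in the unit disc, where the
   series of Li_t can be integrated termwise.  On x > 0, Jonquière's relation replaces Li_t(e^{ax}) by
   a polynomial in x minus (-1)^t Li_t(e^{-ax}), and the latter is again a series.
   All integrals thus reduce to int_0^oo x^p e^{-cx} / (1 + e^{bx}) dx
   = p! sum_{k>=1} (-1)^{k-1} / (c + kb)^{p+1}: the polynomial part gives eta
   values, and the two series carry the factor (-1)^t + (-1)^p, which vanishes
   for odd p + t.

   Jonquière's relation itself is obtained along the rays x e^{-ie}.  There the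
   real and imaginary parts f of Li_t are analytic on all of R, and
   (x d/dx)^t f is rational.  In y = log x, the t-th derivative of
   f(e^y) + (-1)^t f(e^{-y}) (for the imaginary part f(e^y) - (-1)^t f(e^{-y}))
   is constant, so this function is a polynomial whose coefficients are the
   values of (x d/dx)^k f at 1; as e -> 0 they tend to zeta(t - k), respectively
   to 0; for k = t - 1 the real parts cancel and the imaginary part, an argument
   of 1 - e^{-ie} up to sign, tends to -pi/2.

   The Euler sums come from psi = lim of logarithmic derivatives of Gauss's
   product, which yields H^(m)_x = sum_k (k^-m - (x + k)^-m). *)

Require Import Defs.
From mathcomp Require Import all_boot all_order all_algebra.
From mathcomp Require Import complex.
From mathcomp Require Import all_classical all_reals all_analysis.
From mathcomp Require Import measurable_realfun.
From mathcomp Require Import ring lra.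
Import Order.TTheory GRing.Theory Num.Theory.
Import numFieldNormedType.Exports.
Local Open Scope classical_set_scope.
Local Open Scope ring_scope.

Set Implicit Arguments.
Unset Strict Implicit.
Unset Printing Implicit Defensive.

(** * Derivatives and real power series *)

(** About [Li] only local complex power series off the cut and a one-sided limit on it are given. A
    ray at angle -e with 0 < e < pi avoids the cut for every real x, so the problem becomes one of a
    real variable, where an identity theorem on a half-line suffices for continuation past the unit
    disc. The price is that e = 0 is reached only as a limit. At x = 1 the series of (x d/dx)^k f
    has weights n^-(t-k), summable and independent of e, except for k = t - 1; for that single order
    the imaginary part has to be computed explicitly from the differential equation.

    Conditional convergence is the second obstacle: for p = 0 the alternating series of a Fermi
    integral does not converge absolutely. It is obtained from a recurrence c -> c + b with an
    explicit remainder, and only series over n with nonnegative terms are exchanged with an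
    integral.

    Since [0^-1 = 0], the weights n^-t vanish at n = 0, so sums starting at 1 can be handled as
    series starting at 0. Negative a and b are reduced to positive ones by x -> -x. *)

Section Derivatives.
Variable R : realType.
Implicit Types (f g : R -> R) (x a b : R).

Lemma is_deriveD_fun f g x a b : is_derive x 1 f a -> is_derive x 1 g b ->
  is_derive x 1 (fun y => f y + g y) (a + b).
Proof. exact: is_deriveD. Qed.

Lemma is_deriveN_fun f x a : is_derive x 1 f a ->
  is_derive x 1 (fun y => - f y) (- a).
Proof. exact: is_deriveN. Qed.

Lemma is_deriveB_fun f g x a b : is_derive x 1 f a -> is_derive x 1 g b ->
  is_derive x 1 (fun y => f y - g y) (a - b).
Proof. exact: is_deriveB. Qed.

Lemma is_deriveM_fun f g x a b : is_derive x 1 f a -> is_derive x 1 g b ->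
  is_derive x 1 (fun y => f y * g y) (a * g x + f x * b).
Proof.
move=> fa gb; have := is_deriveM fa gb.
by rewrite addrC /GRing.scale /= [g x * a]mulrC.
Qed.

Lemma is_deriveZ_fun f x a k : is_derive x 1 f a ->
  is_derive x 1 (fun y => k * f y) (k * a).
Proof. by move=> fa; exact: (is_deriveZ k fa). Qed.

Lemma is_derive_sum_fun (F : nat -> R -> R) (d : nat -> R) m n x :
  (forall i, (m <= i < n)%N -> is_derive x 1 (F i) (d i)) ->
  is_derive x 1 (fun y => \sum_(m <= i < n) F i y) (\sum_(m <= i < n) d i).
Proof.
have [nm _|/ltnW mn] := leqP n m.
  rewrite big_geq//; under eq_fun do rewrite big_geq//.
  exact: is_derive_cst.
elim: n mn => [|n IH] mn H.
  by rewrite big_geq//; under eq_fun do rewrite big_geq//; exact: is_derive_cst.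
move: mn; rewrite leq_eqVlt => /predU1P[->|mn].
  by rewrite big_geq//; under eq_fun do rewrite big_geq//; exact: is_derive_cst.
rewrite big_nat_recr//=; under eq_fun do rewrite big_nat_recr//=.
apply: is_deriveD_fun; last by apply: H; rewrite -ltnS mn ltnSn.
by apply: IH => // i /andP[mi ni]; apply: H; rewrite mi ltnS ltnW.
Qed.

Lemma is_derive_comp f g x a b : is_derive x 1 f a -> is_derive (f x) 1 g b ->
  is_derive x 1 (fun y => g (f y)) (b * a).
Proof.
move=> fa gb; have df : derivable f x 1 by case: fa.
have dg : derivable g (f x) 1 by case: gb.
apply: DeriveDef.
  apply: (derivable1_diffP (fun y => g (f y)) x).2.
  exact: (differentiable_comp ((derivable1_diffP f x).1 df) ((derivable1_diffP g (f x)).1 dg)).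
rewrite -derive1E; have := derive1_comp df dg; rewrite /comp => ->; rewrite !derive1E.
by rewrite (@derive_val _ _ _ _ _ _ _ fa) (@derive_val _ _ _ _ _ _ _ gb).
Qed.

Lemma is_deriveX_fun f n x a : is_derive x 1 f a ->
  is_derive x 1 (fun y => f y ^+ n) (n%:R * f x ^+ n.-1 * a).
Proof.
move=> fa; have := is_deriveX n fa.
by rewrite (_ : f ^+ n = (fun y => f y ^+ n)) ?exprfctE.
Qed.

Lemma is_deriveV_fun f x a : f x != 0 -> is_derive x 1 f a ->
  is_derive x 1 (fun y => (f y)^-1) (- a / f x ^+ 2).
Proof.
move=> fx0 fa; have := is_deriveV fx0 fa.
by rewrite /GRing.scale /= mulrC mulrN mulNr.
Qed.

Lemma is_derive_continuous f x a : is_derive x 1 f a -> {for x, continuous f}.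
Proof. by move=> [fa _]; exact/differentiable_continuous/derivable1_diffP. Qed.

Lemma is_derive_congr f x a b : is_derive x 1 f a -> a = b -> is_derive x 1 f b.
Proof. by move=> ? <-. Qed.

Lemma is_derive1E f x a : is_derive x 1 f a -> derive1 f x = a.
Proof. by move=> fa; rewrite derive1E derive_val. Qed.

Lemma is_derive0_eq f (x y : R) : x <= y ->
  {within `[x, y], continuous f} ->
  (forall z, x < z < y -> is_derive z 1 f 0) -> f x = f y.
Proof.
move=> xy cf df.
have df' z : z \in `]x, y[ -> is_derive z 1 f 0.
  by rewrite in_itv /=; exact: df.
have [c _] := MVT_segment xy df' cf.
by rewrite mul0r => /eqP; rewrite subr_eq0 => /eqP.
Qed.

Lemma is_derive_eq_of_derive f g (d : R -> R) x0 :
  (forall x, is_derive x 1 f (d x)) -> (forall x, is_derive x 1 g (d x)) ->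
  f x0 = g x0 -> f =1 g.
Proof.
move=> fd gd fg0 x; apply/eqP; rewrite -subr_eq0; apply/eqP.
have D (z : R) : is_derive z 1 (fun y => f y - g y) 0.
  by rewrite -(subrr (d z)); exact: is_deriveB_fun (fd z) (gd z).
have C (A : set R) : {within A, continuous (fun y => f y - g y)}.
  by apply: continuous_subspaceT => z; exact: is_derive_continuous (D z).
have [xx0|/ltW x0x] := leP x x0.
  by rewrite (@is_derive0_eq (fun y => f y - g y) x x0)// fg0 subrr.
by rewrite -(@is_derive0_eq (fun y => f y - g y) x0 x)// fg0 subrr.
Qed.

End Derivatives.

(** * Differentiation and uniqueness of real power series *)

Section PowerSeries.
Variable R : realType.
Implicit Types (c : nat -> R) (x h r : R).

Lemma arith_geometric_sum (q : R) n :
  (1 - q) ^+ 2 * \sum_(0 <= k < n) k.+1%:R * q ^+ k =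
  1 - n.+1%:R * q ^+ n + n%:R * q ^+ n.+1.
Proof.
elim: n => [|n IH]; first by rewrite big_geq// mulr0 mul0r; ring.
by rewrite big_nat_recr//= mulrDr IH !exprS -!natr1; ring.
Qed.

Lemma is_cvg_arith_geometric (q : R) : 0 <= q < 1 ->
  cvgn (series (fun k => k.+1%:R * q ^+ k)).
Proof.
move=> /andP[q0 q1]; apply: nondecreasing_is_cvgn.
  by apply: nondecreasing_series => n _ _; rewrite mulr_ge0// exprn_ge0.
exists ((1 - q) ^- 2) => _ [n _ <-].
have d0 : 0 < (1 - q) ^+ 2 by rewrite exprn_gt0// subr_gt0.
rewrite -(ler_pM2l d0) divff ?gt_eqF// /series /= arith_geometric_sum.
have : 0 <= q ^+ n * (n.+1%:R - n%:R * q).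
  rewrite mulr_ge0 ?exprn_ge0// subr_ge0 -natr1.
  by rewrite (le_trans (ler_wpM2l _ (ltW q1)))// mulr1 lerDl.
by rewrite exprS => H; lra.
Qed.

(** Convergence at [K] bounds the terms [c n * K ^+ n], so the derived series at [x] is dominated by
    a multiple of the sum of (n+1) q^n with q = |x| / |K| < 1. *)
Lemma is_cvg_pseries_diffs c K x : cvgn (pseries c K) -> `|x| < `|K| ->
  cvgn (pseries (pseries_diffs c) x).
Proof.
move=> cK xK; have [M [_ HM]] := cvg_series_bounded cK.
have K0 : 0 < `|K| by exact: le_lt_trans xK.
set q := `|x| / `|K|.
have q1 : 0 <= q < 1 by rewrite divr_ge0//= ltr_pdivrMr// mul1r.
have HB n : `|c n| * `|K| ^+ n <= `|M| + 1.
  rewrite -normrX -normrM; apply: HM => //.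
  by rewrite (le_lt_trans (ler_norm _))// ltrDl.
apply: normed_cvg.
apply: (@series_le_cvg _ _ (fun k => (`|M| + 1) / `|K| * (k.+1%:R * q ^+ k))).
- by move=> n /=.
- by move=> n; rewrite !mulr_ge0 ?invr_ge0 ?exprn_ge0 ?divr_ge0 ?addr_ge0.
- move=> n; rewrite /pseries_diffs /= !normrM normr_nat normrX.
  rewrite /q expr_div_n -mulrA [leRHS]mulrCA ler_wpM2l//.
  rewrite [leRHS](_ : _ = (`|M| + 1) / `|K| ^+ n.+1 * `|x| ^+ n); last first.
    by rewrite exprS invfM; ring.
  by rewrite ler_wpM2r ?exprn_ge0// ler_pdivlMr ?exprn_gt0.
- by apply: is_cvg_seriesZ; exact: is_cvg_arith_geometric.
Qed.

(** [pseries_snd_diffs] asks for convergence of the series and of its first two formal derivatives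
    at one point beyond |h|. Each formal derivative costs some radius, hence the nested midpoints
    |h| < K1 < K2 < K3 < r. *)
Lemma pseries_derive c r : (forall h, `|h| < r -> cvgn (pseries c h)) ->
  forall h, `|h| < r -> cvgn (pseries (pseries_diffs c) h) /\
    is_derive h 1 (fun x => limn (pseries c x)) (limn (pseries (pseries_diffs c) h)).
Proof.
move=> cr h hr.
have mid (x y : R) : 0 <= x -> x < y -> [/\ x < (x + y) / 2, (x + y) / 2 < y &
   `|(x + y) / 2| = (x + y) / 2].
  by move=> x0 xy; split; [lra|lra|rewrite ger0_norm//; lra].
have [a1 a2 a3] := mid _ _ (normr_ge0 h) hr.
set K1 := (_ + _) / 2 in a1 a2 a3.
have [b1 b2 b3] := mid _ _ (le_trans (normr_ge0 h) (ltW a1)) a2.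
set K2 := (_ + _) / 2 in b1 b2 b3.
have [d1 d2 d3] := mid _ _ (le_trans (normr_ge0 h) (ltW (lt_trans a1 b1))) b2.
set K3 := (_ + _) / 2 in d1 d2 d3.
have c3 : cvgn (pseries c K3) by apply: cr; rewrite d3.
have c2 : cvgn (pseries (pseries_diffs c) K2).
  by apply: (is_cvg_pseries_diffs c3); rewrite b3 d3.
have c1 : cvgn (pseries (pseries_diffs (pseries_diffs c)) K1).
  by apply: (is_cvg_pseries_diffs c2); rewrite a3 b3.
split; first by apply: (is_cvg_pseries_inside c2); rewrite b3 (lt_trans a1).
apply: (@pseries_snd_diffs _ c K1) => //; last by rewrite a3.
  by apply: cr; rewrite a3.
by apply: (is_cvg_pseries_inside c2); rewrite a3 b3.
Qed.

Lemma pseriesS c h n : pseries c h n.+1 = c 0%N + h * pseries (fun k => c k.+1) h n.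
Proof.
rewrite /pseries /series /= big_nat_recl// expr0 mulr1; congr (_ + _).
by rewrite mulr_sumr; apply: eq_bigr => i _; rewrite exprS mulrCA.
Qed.

Lemma cvg_pseries_at0 c : pseries c 0 @ \oo --> c 0%N.
Proof.
by rewrite -cvg_shiftS /=; under eq_fun do rewrite pseriesS mul0r addr0; exact: cvg_cst.
Qed.

(** Vanishing is assumed only to the left of 0: in the identity theorem nothing is known yet to the
    right of the expansion point. Continuity of the sum at 0 carries the value over. *)
Lemma pseries0_coeff0 c r : 0 < r -> (forall h, `|h| < r -> cvgn (pseries c h)) ->
  (forall h, - r < h < 0 -> limn (pseries c h) = 0) -> c 0%N = 0.
Proof.
move=> r0 cr c0; have r0' : `|0 : R| < r by rewrite normr0.
have [_ /is_derive_continuous/cvg_at_left_filter] := pseries_derive cr r0'.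
move=> /(cvg_lim (@Rhausdorff R)); rewrite (cvg_lim _ (cvg_pseries_at0 (c := c)))// => <-.
apply: cvg_lim => //; apply: cvg_near_cst; near=> x; apply: c0.
by apply/andP; split; near: x;
  [apply: nbhs_left_gt; rewrite oppr_lt0|exact: nbhs_left_lt].
Unshelve. all: by end_near. Qed.

(** Once [c 0 = 0], the series divided by h is the series of the shifted coefficients and still
    vanishes on the left, so induction applies. *)
Lemma pseries0_coeff c r : 0 < r -> (forall h, `|h| < r -> cvgn (pseries c h)) ->
  (forall h, - r < h < 0 -> limn (pseries c h) = 0) -> forall k, c k = 0.
Proof.
move=> r0 cr c0 k; elim: k c cr c0 => [|k IH] c cr c0.
  exact: pseries0_coeff0 cr c0.
have c00 := pseries0_coeff0 r0 cr c0.
(* Division by h fails at 0; there the shifted partial sums are [c 1] from index 1 on. *)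
have S h : pseries (fun k => c k.+1) h = (fun n => if h == 0 then c 1%N *+ (0 < n)%N else pseries c h n.+1 / h).
  apply/funext => n; case: eqP => [->|/eqP h0]; last first.
    by rewrite pseriesS c00 add0r mulrC mulKf.
  case: n => [|n]; first by rewrite /pseries /series /= big_geq.
  by rewrite pseriesS mul0r addr0.
have C h : `|h| < r -> cvgn (pseries (fun k => c k.+1) h) /\
    (h != 0 -> limn (pseries (fun k => c k.+1) h) = limn (pseries c h) / h).
  have [->|h0] := eqVneq h 0.
    by move=> _; split => //; apply/cvg_ex; eexists; exact: cvg_pseries_at0.
  move=> /cr ch.
  have : pseries (fun k => c k.+1) h @ \oo --> limn (pseries c h) / h.
    rewrite S (negbTE h0); apply: cvgM; last exact: cvg_cst.
    by rewrite (cvg_shiftS (pseries c h)).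
  by move=> H; split; [apply/cvg_ex; eexists; exact: H|move=> _; exact: cvg_lim H].
apply: (IH (fun k => c k.+1)) => [h hr|h /andP[h1 h2]]; first by case: (C h hr).
have hr : `|h| < r by rewrite ltr_norml h1 (lt_trans h2).
by have [_ ->] := C h hr; rewrite ?lt_eqF// c0 ?h1// mul0r.
Qed.

End PowerSeries.

(** * Real-analytic functions and the identity theorem on a half-line *)

Section RealAnalytic.
Variable R : realType.
Implicit Types (f g : R -> R) (c : nat -> R).

Definition ranalytic f : Prop := forall x : R, exists c (r : R), 0 < r /\
  forall h, `|h| < r -> pseries c h @ \oo --> f (x + h).

Lemma pseries_ranalytic f c (x r : R) :
  (forall h, `|h| < r -> pseries c h @ \oo --> f (x + h)) ->
  forall h, `|h| < r ->
  pseries (pseries_diffs c) h @ \oo --> limn (pseries (pseries_diffs c) h) /\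
  is_derive (x + h) 1 f (limn (pseries (pseries_diffs c) h)).
Proof.
move=> H h hr.
have cr h' : `|h'| < r -> cvgn (pseries c h').
  by move=> /H Hh; apply/cvg_ex; eexists; exact: Hh.
have [C D] := pseries_derive cr hr; split; first exact: C.
have D1 : is_derive (x + h) 1 (fun y => y - x) (1 - 0).
  exact: is_deriveB_fun (is_derive_id _ _) (is_derive_cst _ _ _).
have Dh : is_derive ((x + h) - x) 1 (fun x => limn (pseries c x)) (limn (pseries (pseries_diffs c) h)).
  by rewrite addrAC subrr add0r.
have := is_derive_comp D1 Dh; rewrite subr0 mulr1; apply: near_eq_is_derive.
near=> y; apply: cvg_lim => //; rewrite -[in X in _ --> X](subrK x y) [X in f X]addrC.
apply: H; near: y.
have : `|(x + h) - x| < r by rewrite addrAC subrr add0r.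
have cc : {for x + h, continuous (fun y : R => `|y - x|)}.
  by apply: cvg_norm; apply: cvgB; [exact: cvg_id|exact: cvg_cst].
by move=> /(cvgr_lt _ cc).
Unshelve. all: by end_near. Qed.

Lemma ranalytic_derive f : ranalytic f -> forall x : R, is_derive x 1 f (derive1 f x).
Proof.
move=> fa x; have [c [r [r0 H]]] := fa x.
have r0' : `|0 : R| < r by rewrite normr0.
have [_] := pseries_ranalytic H r0'; rewrite addr0 => D.
by rewrite (is_derive1E D).
Qed.

Lemma ranalytic_derive1 f : ranalytic f -> ranalytic (derive1 f).
Proof.
move=> fa x; have [c [r [r0 H]]] := fa x.
exists (pseries_diffs c), r; split => // h hr.
by have [C /is_derive1E ->] := pseries_ranalytic H hr.
Qed.

Lemma ranalytic_continuous f : ranalytic f -> continuous f.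
Proof. by move=> fa x; exact: is_derive_continuous (ranalytic_derive fa x). Qed.

Lemma ranalyticD f g : ranalytic f -> ranalytic g -> ranalytic (fun x => f x + g x).
Proof.
move=> fa ga x; have [c [r [r0 H]]] := fa x; have [d [s [s0 K]]] := ga x.
exists (fun k => c k + d k), (Num.min r s); split; first by rewrite lt_min r0.
move=> h; rewrite lt_min => /andP[hr hs].
rewrite (_ : pseries _ h = (fun n => pseries c h n + pseries d h n)).
  by apply: cvgD; [exact: H|exact: K].
apply/funext => n; rewrite /pseries /series /= -big_split /=.
by apply: eq_bigr => i _; rewrite mulrDl.
Qed.

Lemma ranalytic_mulX f : ranalytic f -> ranalytic (fun x => x * f x).
Proof.
move=> fa x; have [c [r [r0 H]]] := fa x.
exists (fun k => x * c k + (if k is j.+1 then c j else 0)), r; split=> // h hr.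
have E n : pseries (fun k => x * c k + (if k is j.+1 then c j else 0)) h n.+1 =
    x * pseries c h n.+1 + h * pseries c h n.
  rewrite /pseries /series /=.
  under eq_bigr do rewrite mulrDl.
  rewrite big_split /= !mulr_sumr; congr (_ + _).
    by apply: eq_bigr => i _; rewrite mulrA.
  rewrite big_nat_recl// mul0r add0r; apply: eq_bigr => i _.
  by rewrite exprS mulrCA.
rewrite -cvg_shiftS /=; under eq_fun do rewrite E.
rewrite mulrDl; apply: cvgD; apply: cvgM; try exact: cvg_cst; last exact: H.
by rewrite (cvg_shiftS (pseries c h)); exact: H.
Qed.

Lemma ranalytic_cst (a : R) : ranalytic (fun=> a).
Proof.
move=> x; exists (fun k => if k is 0%N then a else 0), 1; split => // h _.
apply: cvg_near_cst; exists 1%N => // -[//|n] _ /=.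
rewrite pseriesS /pseries /series /= big1 ?mulr0 ?addr0// => i _.
by rewrite mul0r.
Qed.

Lemma ranalyticZ f (a : R) : ranalytic f -> ranalytic (fun x => a * f x).
Proof.
move=> fa x; have [c [r [r0 H]]] := fa x.
exists (fun k => a * c k), r; split => // h hr.
rewrite (_ : pseries _ h = (fun n => a * pseries c h n)).
  by apply: cvgM; [exact: cvg_cst|exact: H].
apply/funext => n; rewrite /pseries /series /= mulr_sumr.
by apply: eq_bigr => i _; rewrite mulrA.
Qed.

(** Let s be the supremum of the points up to which f vanishes. Since f vanishes just left of s, all
    its coefficients at s are zero, so f vanishes up to s + r/2, which contradicts the choice of
    s. *)
Lemma ranalytic_ge0_eq0 f : ranalytic f -> (forall x, -1 < x < 1 -> f x = 0) ->
  forall x, 0 <= x -> f x = 0.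
Proof.
move=> fa f0 x x0; apply: contrapT => fx0.
pose A := [set y | 0 <= y /\ forall z, 0 <= z <= y -> f z = 0].
have A0 : A 0.
  split=> // z /andP[z0 z1]; apply: f0.
  by rewrite (lt_le_trans _ z0) ?oppr_lt0//= (le_lt_trans z1).
have Ax y : A y -> y < x.
  by move=> [y0 H]; rewrite ltNge; apply/negP => xy; apply/fx0/H; rewrite x0.
have hA : has_sup A by split; [exists 0|exists x => y /Ax/ltW].
pose s := sup A.
have s0 : 0 <= s by apply: sup_upper_bound.
have bs z : -1 < z < s -> f z = 0.
  move=> /andP[z0 zs]; have [z1|z1] := leP 0 z; last first.
    by apply: f0; rewrite z0 (lt_trans z1).
  have sz : 0 < s - z by rewrite subr_gt0.
  have [y [y0 Hy]] := sup_adherent sz hA; rewrite subKr => zy.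
  by apply: Hy; rewrite z1 ltW.
have [c [r [r0 H]]] := fa s.
have cr h : `|h| < r -> cvgn (pseries c h) by move=> /H Hh; apply/cvg_ex; eexists; exact: Hh.
(* The bound s + 1 keeps s + h above -1, where f is known to vanish; this matters when s = 0. *)
pose r' := Num.min r (s + 1).
have r'0 : 0 < r' by rewrite lt_min r0 ltr_wpDl.
have c0 : forall k, c k = 0.
  apply: (@pseries0_coeff R c r') => // [h|h /andP[]].
    by rewrite lt_min => /andP[hr _]; exact: cr.
  rewrite ltrNl lt_min ![- h < _]ltrNl => /andP[h1 h2] h0.
  have hr : `|h| < r by rewrite ltr_norml h1 (lt_trans h0).
  by rewrite (cvg_lim _ (H h hr))//; apply: bs; apply/andP; split; lra.
have fs z : s <= z <= s + r / 2 -> f z = 0.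
  move=> /andP[z1 z2]; rewrite -(subrK s z) [_ - _ + _]addrC.
  have hr : `|z - s| < r by rewrite ger0_norm ?subr_ge0//; lra.
  have := H _ hr; move/(cvg_lim (@Rhausdorff R)) => <-.
  apply: cvg_lim => //; rewrite (_ : pseries _ _ = fun=> 0); first exact: cvg_cst.
  by apply/funext => n; rewrite /pseries /series /= big1// => i _; rewrite c0 mul0r.
have : A (s + r / 2).
  split=> [|z /andP[z0 z1]]; first by rewrite addr_ge0// divr_ge0// ltW.
  have [zs|zs] := ltP z s; last by apply: fs; rewrite zs.
  by apply: bs; rewrite zs (lt_le_trans _ z0)// oppr_lt0.
by move=> /(sup_upper_bound hA); rewrite -/s gerDl; lra.
Qed.

End RealAnalytic.

(** * Complex limits and Tannery's theorem *)

Section ComplexLimits.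
Variable R : realType.
Local Open Scope complex_scope.
Implicit Types (z w : R[i]).

Lemma normC_real (x : R) : `|x%:C| = `|x|%:C.
Proof. by rewrite normc_def /= expr0n addr0 sqrtr_sqr. Qed.

Lemma normr_Re_le z : `|complex.Re z|%:C <= `|z|.
Proof.
rewrite normc_def lecR -sqrtr_sqr ler_wsqrtr// lerDl; exact: sqr_ge0.
Qed.

Lemma normr_Im_le z : `|complex.Im z|%:C <= `|z|.
Proof.
rewrite normc_def lecR -sqrtr_sqr ler_wsqrtr// lerDr; exact: sqr_ge0.
Qed.

Lemma complex_cvg_part (P : R[i] -> R) (T : Type) (F : set_system T) {FF : Filter F}
    (u : T -> R[i]^o) (l : R[i]^o) :
  {morph P : x y / x - y >-> x - y} -> (forall z, `|P z|%:C <= `|z|) ->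
  u @ F --> l -> P (u x) @[x --> F] --> P l.
Proof.
move=> PB Ple /cvgrPdist_lt ul; apply/cvgrPdist_lt => e e0.
have e0' : 0 < (e%:C : R[i]) by rewrite ltcR.
have := ul _ e0'; apply: filterS => x H.
by rewrite -PB -ltcR; apply: le_lt_trans H; exact: Ple.
Qed.

Lemma cvg_Re (T : Type) (F : set_system T) {FF : Filter F} (u : T -> R[i]^o) (l : R[i]^o) :
  u @ F --> l -> complex.Re (u x) @[x --> F] --> complex.Re l.
Proof. by apply: complex_cvg_part; [by case=> ? ? [? ?]|exact: normr_Re_le]. Qed.

Lemma cvg_Im (T : Type) (F : set_system T) {FF : Filter F} (u : T -> R[i]^o) (l : R[i]^o) :
  u @ F --> l -> complex.Im (u x) @[x --> F] --> complex.Im l.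
Proof. by apply: complex_cvg_part; [by case=> ? ? [? ?]|exact: normr_Im_le]. Qed.

Lemma ReM_real z (x : R) : complex.Re (z * x%:C) = complex.Re z * x.
Proof. by case: z => a b /=; rewrite mulr0 subr0. Qed.

Lemma ImM_real z (x : R) : complex.Im (z * x%:C) = complex.Im z * x.
Proof. by case: z => a b /=; rewrite mulr0 add0r. Qed.

Definition unit_dir (e : R) : R[i] := cos e -i* sin e.

Lemma norm_unit_dir e : `|unit_dir e| = 1.
Proof. by rewrite normc_def /= sqrrN cos2Dsin2 sqrtr1. Qed.

Lemma unit_dirX e n : unit_dir e ^+ n = cos (n%:R * e) -i* sin (n%:R * e).
Proof.
elim: n => [|n IH]; first by rewrite mul0r cos0 sin0 oppr0 expr0.
rewrite exprSr IH -natr1 mulrDl mul1r cosD sinD /unit_dir.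
by apply/eqP; rewrite eq_complex /=; apply/andP; split; apply/eqP; ring.
Qed.

Lemma csum_to_Re (u : nat -> R[i]) l : csum_to u l ->
  series (fun k => complex.Re (u k)) @ \oo --> complex.Re l.
Proof.
move=> /cvg_Re; apply: cvg_trans; apply: near_eq_cvg; apply: nearW => n.
by rewrite /series /= (big_morph (@complex.Re R) (id1 := 0) (op1 := +%R))//; case=> ? ? [? ?].
Qed.

Lemma csum_to_Im (u : nat -> R[i]) l : csum_to u l ->
  series (fun k => complex.Im (u k)) @ \oo --> complex.Im l.
Proof.
move=> /cvg_Im; apply: cvg_trans; apply: near_eq_cvg; apply: nearW => n.
by rewrite /series /= (big_morph (@complex.Im R) (id1 := 0) (op1 := +%R))//; case=> ? ? [? ?].
Qed.

End ComplexLimits.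

(** * Dominated convergence for series *)

Section Tannery.
Variable R : realType.

Lemma series_tail_le (a M : nat -> R) (g : R) N :
  (forall n, `|a n| <= M n) -> cvgn (series M) -> series a @ \oo --> g ->
  `|g - series a N| <= limn (series M) - series M N.
Proof.
move=> aM cM ag.
have ndM : nondecreasing_seq (series M).
  by apply: nondecreasing_series => n _ _; exact: le_trans (normr_ge0 _) (aM n).
have H : `|series a n - series a N| @[n --> \oo] --> `|g - series a N|.
  by apply: cvg_norm; apply: cvgB => //; exact: cvg_cst.
rewrite -(cvg_lim _ H)//; apply: limr_le; first by apply/cvg_ex; eexists; exact: H.
near=> n; have Nn : (N <= n)%N by near: n; exists N.
apply: (@le_trans _ _ (series M n - series M N)).
  rewrite !sub_series_geq// (le_trans (ler_norm_sum _ _ _))//.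
  by apply: ler_sum => i _.
by rewrite lerD2r; exact: nondecreasing_cvgn_le.
Unshelve. all: by end_near. Qed.

Lemma cvg_sum_nat (T : Type) (F : set_system T) {FF : Filter F}
    (a : T -> nat -> R) (l : nat -> R) m n :
  (forall k, (m <= k < n)%N -> a e k @[e --> F] --> l k) ->
  \sum_(m <= k < n) a e k @[e --> F] --> \sum_(m <= k < n) l k.
Proof.
elim: n => [|n IH] al.
  by rewrite big_geq//; under eq_fun do rewrite big_geq//; exact: cvg_cst.
have [mn|mn] := leqP m n; last by rewrite big_geq//; under eq_fun do rewrite big_geq//; exact: cvg_cst.
rewrite big_nat_recr//=; under eq_fun do rewrite big_nat_recr//=.
apply: cvgD; last by apply: al; rewrite mn /=.
by apply: IH => k /andP[mk kn]; apply: al; rewrite mk ltnW.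
Qed.

(** The series is cut where the tail of the majorant drops below a third of the error; both tails
    and the finite part then contribute a third each. The filter is arbitrary, because the limits
    needed are e -> 0+ for the angle and x -> 1- on a ray. *)
Lemma tannery (T : Type) (F : set_system T) {FF : ProperFilter F}
    (a : T -> nat -> R) (G : T -> R) (l M : nat -> R) :
  (\forall e \near F, forall n, `|a e n| <= M n) -> cvgn (series M) ->
  (forall n, a e n @[e --> F] --> l n) ->
  (\forall e \near F, series (a e) @ \oo --> G e) ->
  G @ F --> limn (series l).
Proof.
move=> aM cM al aG.
have lM n : `|l n| <= M n.
  have H : `|a e n| @[e --> F] --> `|l n| by apply: cvg_norm; exact: al.
  rewrite -(cvg_lim _ H)//; apply: limr_le; first by apply/cvg_ex; eexists; exact: H.
  by apply: filterS aM => e; exact.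
have cl : series l @ \oo --> limn (series l).
  apply: normed_cvg; apply: (@series_le_cvg _ _ M) => [n|n|n|//] //=.
  exact: le_trans (normr_ge0 (l n)) (lM n).
apply/cvgrPdist_lt => e e0.
have e30 : 0 < e / 3 by rewrite divr_gt0.
have /cvgrPdist_lt/(_ _ e30)[N _ HN] := cM.
have {HN} tN : limn (series M) - series M N < e / 3.
  by apply: le_lt_trans (HN N (leqnn N)); exact: ler_norm.
have sal : series (a x) N @[x --> F] --> series l N.
  by apply: cvg_sum_nat => n _; exact: al.
move/cvgrPdist_lt : sal => /(_ _ e30) sal.
near=> x.
have h1 : `|limn (series l) - series l N| <= limn (series M) - series M N by exact: series_tail_le.
have h2 : `|G x - series (a x) N| <= limn (series M) - series M N.
  by apply: series_tail_le => //; near: x.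
have h3 : `|series l N - series (a x) N| < e / 3 by near: x.
rewrite (_ : _ - G x = (limn (series l) - series l N) - (G x - series (a x) N) +
  (series l N - series (a x) N)); last by ring.
rewrite (le_lt_trans (ler_normD _ _))// (le_lt_trans (lerD (ler_normB _ _) (lexx _)))//.
lra.
Unshelve. all: by end_near. Qed.

End Tannery.

(** * The operator x d/dx, generating functions and Taylor chains *)

Section EulerOperator.
Variable R : realType.
Implicit Types (f : R -> R) (a : nat -> R).

Definition xderiv f (x : R) : R := x * derive1 f x.

Lemma ranalytic_iter_xderiv f k : ranalytic f -> ranalytic (iter k xderiv f).
Proof.
move=> fa; elim: k => //= k IH.
by apply: ranalytic_mulX; exact: ranalytic_derive1.
Qed.

(** Each application of x d/dx multiplies the coefficient of x^n by n. *)
Lemma pseries_iter_xderiv f a k :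
  (forall x, `|x| < 1 -> pseries a x @ \oo --> f x) ->
  forall x, `|x| < 1 -> pseries (fun n => a n * n%:R ^+ k) x @ \oo --> iter k xderiv f x.
Proof.
move=> H; elim: k => [|k IH] x x1 /=.
  by under [X in pseries X]eq_fun do rewrite expr0 mulr1; exact: H.
set b := fun n => a n * n%:R ^+ k in IH.
have K h : `|h| < 1 -> pseries b h @ \oo --> iter k xderiv f (0 + h).
  by rewrite add0r; exact: IH.
have [C D] := pseries_ranalytic K x1; rewrite add0r in D.
rewrite /xderiv (is_derive1E D) -cvg_shiftS /=.
under eq_fun do rewrite pseriesS expr0n mulr0 add0r.
apply: cvgM; first exact: cvg_cst.
rewrite (_ : pseries _ x = pseries (pseries_diffs b) x)//.
congr (pseries _ x); apply/funext => n.
by rewrite /pseries_diffs /b exprS; ring.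
Qed.

End EulerOperator.

Section TrigSeries.
Variable R : realType.

(** The recurrence is that of cos(n e) and sin(n e) with [c] = cos e, so multiplication by its
    characteristic polynomial telescopes the series. The factor [*+ (0 < n)] drops the term n = 0,
    which is why [tau 0] appears only in front of x^2. *)
Lemma trig_generating (tau : nat -> R) (c x : R) :
  (forall n, tau n.+2 = 2 * c * tau n.+1 - tau n) ->
  (forall n, `|tau n| <= 1) -> `|x| < 1 ->
  (1 - 2 * x * c + x ^+ 2) * limn (pseries (fun n => tau n *+ (0 < n)%N) x)
    = tau 1%N * x - tau 0%N * x ^+ 2 /\ cvgn (pseries (fun n => tau n *+ (0 < n)%N) x).
Proof.
move=> rec tau1 x1.
(* The two boundary terms left by the telescoping tend to 0 for |x| < 1, [tau] being bounded. *)
have E n : (1 - 2 * x * c + x ^+ 2) * pseries (fun n => tau n *+ (0 < n)%N) x n.+2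
   = tau 1%N * x - tau 0%N * x ^+ 2 - tau n.+2 * x ^+ n.+2 + tau n.+1 * x ^+ n.+3.
  rewrite /pseries /series /=; elim: n => [|n IH].
    by rewrite !big_nat_recr//= big_geq// mulr0n mulr1n rec; ring.
  by rewrite big_nat_recr//= mulrDr IH mulr1n !rec !exprS; ring.
have cg : cvgn (series (fun n => `|x| ^+ n)).
  have := @is_cvg_geometric_series R 1 `|x|; rewrite normr_id => /(_ x1).
  by rewrite (_ : geometric 1 `|x| = (fun n => `|x| ^+ n))//; apply/funext => n /=; rewrite mul1r.
have C : cvgn (pseries (fun n => tau n *+ (0 < n)%N) x).
  apply: normed_cvg; apply: series_le_cvg cg => [n|n|n] /=; [exact: normr_ge0|exact: exprn_ge0|].
  rewrite normrM normrX ler_piMl ?exprn_ge0//.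
  by case: (0 < n)%N; rewrite ?mulr1n// mulr0n normr0.
split => //; rewrite -[RHS](_ : limn (fun n => (1 - 2 * x * c + x ^+ 2) * pseries (fun n => tau n *+ (0 < n)%N) x n) = _).
  by apply/esym/cvg_lim => //; apply: cvgM => //; exact: cvg_cst.
apply: cvg_lim => //; rewrite -cvg_shiftS -cvg_shiftS /=.
under eq_fun do rewrite E.
have z0 (s : nat -> nat) k : (forall n, `|tau (s n)| <= 1) -> tau (s n) * x ^+ (n + k) @[n --> \oo] --> 0.
  move=> _; apply/norm_cvg0P; apply: (@squeeze_cvgr _ _ _ _ (cst 0) (fun n => `|x| ^+ (n + k))).
  - apply: nearW => n; rewrite normr_ge0/= normrM normrX ler_piMl ?exprn_ge0//.
  - exact: cvg_cst.
  - by rewrite (cvg_shiftn k (fun n => `|x| ^+ n)); apply: cvg_expr; rewrite normr_id.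
suff: tau 1%N * x - tau 0%N * x ^+ 2 - tau n.+2 * x ^+ n.+2 + tau n.+1 * x ^+ n.+3 @[n --> \oo]
  --> tau 1%N * x - tau 0%N * x ^+ 2 - 0 + 0 by rewrite subr0 addr0.
apply: cvgD; first apply: cvgB; first exact: cvg_cst.
  by have := z0 (fun n => n.+2) 2%N; under eq_fun do rewrite addn2; exact.
by have := z0 (fun n => n.+1) 3%N; under eq_fun do rewrite addn3; exact.
Qed.

End TrigSeries.

Section Taylor.
Variable R : realType.

Lemma is_derive_taylor_tail (c : nat -> R) t (x : R) :
  is_derive x 1 (fun y => \sum_(0 <= k < t.+1) c k * y ^+ k / k`!%:R)
    (\sum_(0 <= k < t) c k.+1 * x ^+ k / k`!%:R).
Proof.
pose d k : R := if k is j.+1 then c j.+1 * x ^+ j / j`!%:R else 0.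
rewrite [X in is_derive _ _ _ X](_ : _ = \sum_(0 <= k < t.+1) d k); last first.
  by rewrite big_nat_recl//= add0r.
apply: is_derive_sum_fun => -[|j] _ /=.
  by under eq_fun do rewrite expr0; exact: is_derive_cst.
have := is_deriveZ_fun (c j.+1 / j.+1`!%:R) (is_deriveX_fun j.+1 (is_derive_id x (1 : R))).
rewrite /= (_ : _ * (j.+1%:R * x ^+ j * 1) = c j.+1 * x ^+ j / j`!%:R).
  by under eq_fun do rewrite mulrAC.
rewrite factS natrM invfM mulr1; have : j.+1%:R != 0 :> R by [].
have f0 : j`!%:R != 0 :> R by rewrite pnatr_eq0 -lt0n fact_gt0.
by move=> H; field; rewrite f0 /= nat1r.
Qed.

(** A Taylor formula without remainder: the chain ends in a constant, and each step back integrates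
    once, with integration constant [W k 0]. *)
Lemma poly_of_derive_chain (W : nat -> R -> R) t (w : R) :
  (forall k (x : R), (k < t)%N -> is_derive x 1 (W k) (W k.+1 x)) ->
  (forall x, W t x = w) ->
  forall x, W 0%N x = \sum_(0 <= k < t.+1) W k 0 * x ^+ k / k`!%:R.
Proof.
elim: t W => [|t IH] W dW Wt x.
  by rewrite big_nat1 expr0 fact0 divr1 mulr1 !Wt.
have IH' := IH (fun k => W k.+1) (fun k x kt => dW k.+1 x kt) Wt.
have P1 (y : R) : is_derive y 1 (fun y => \sum_(0 <= k < t.+2) W k 0 * y ^+ k / k`!%:R) (W 1%N y).
  by have := is_derive_taylor_tail (fun k => W k 0) t.+1 y; rewrite -IH'.
apply: (is_derive_eq_of_derive (fun y => dW 0%N y isT) P1 (x0 := 0)).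
rewrite big_nat_recl// expr0 fact0 divr1 mulr1 big1_seq ?addr0// => i _.
by rewrite expr0n mulr0 mul0r.
Qed.

End Taylor.

Section Reciprocal.
Variable R : realType.

(* In the variable y = log x the operator x d/dx is d/dy, and y |-> -y
   exchanges the two terms of the Jonquiere relation. *)
Lemma reciprocal_chain (f : R -> R) t (s : R) : ranalytic f ->
  forall k (x : R), is_derive x 1
    (fun y => iter k (@xderiv R) f (expR y) + s * (-1) ^+ (t + k) * iter k (@xderiv R) f (expR (- y)))
    (iter k.+1 (@xderiv R) f (expR x) + s * (-1) ^+ (t + k.+1) * iter k.+1 (@xderiv R) f (expR (- x))).
Proof.
move=> fa k x.
have D z := ranalytic_derive (ranalytic_iter_xderiv k fa) z.
have E1 := is_derive_comp (is_derive_expR x) (D (expR x)).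
have EN : is_derive x 1 (fun y => expR (- y)) (expR (- x) * -1).
  exact: is_derive_comp (is_deriveN_fun (is_derive_id x 1)) (is_derive_expR (- x)).
have E2 := is_derive_comp EN (D (expR (- x))).
apply: (is_derive_congr (is_deriveD_fun E1 (is_deriveZ_fun (s * (-1) ^+ (t + k)) E2))).
by rewrite /= /xderiv addnS exprS; ring.
Qed.

End Reciprocal.

(** * Analytic continuation along rays *)

Section ZetaSeries.
Variable R : realType.

(** Links the sums of the statement, which start at 1, with [series], which starts at 0. *)
Lemma rsum_series (u : nat -> R) : u 0%N = 0 -> rsum u = limn (series u).
Proof.
move=> u0; rewrite /rsum; congr (limn _); apply/funext => -[|n].
  by rewrite /series /= !big_geq.
by rewrite /series /= [RHS]big_ltn// u0 add0r.
Qed.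

Lemma rsummable_series (u : nat -> R) : u 0%N = 0 -> rsummable u = cvgn (series u).
Proof.
move=> u0; rewrite /rsummable (_ : (fun N => _) = series u)//; apply/funext => -[|n].
  by rewrite /series /= !big_geq.
by rewrite /series /= [RHS]big_ltn// u0 add0r.
Qed.

(** The partial sums stay below 2 - 1/n, by telescoping 1/(a+1)^2 <= 1/a - 1/(a+1). *)
Lemma is_cvg_inv_powers m : (1 < m)%N -> cvgn (series (fun n => n%:R^-1 ^+ m : R)).
Proof.
move=> m1; apply: nondecreasing_is_cvgn.
  by apply: nondecreasing_series => n _ _; rewrite exprn_ge0.
exists 2 => _ [n _ <-]; rewrite /series /=.
case: n => [|[|n]]; first by rewrite big_geq.
  by rewrite big_nat1 invr0 expr0n (gtn_eqF (ltnW m1)).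
suff H : \sum_(0 <= k < n.+2) k%:R^-1 ^+ m <= 2 - n.+1%:R^-1 :> R.
  by apply: le_trans H _; rewrite gerBl invr_ge0.
elim: n => [|n IH].
  rewrite !big_nat_recr// big_geq//= invr0 expr0n (gtn_eqF (ltnW m1)).
  by rewrite invr1 expr1n mulr0n; lra.
rewrite big_nat_recr//=; apply: le_trans (lerD IH (lexx _)) _.
have n10 : 0 < n.+2%:R :> R by [].
have : n.+2%:R^-1 ^+ m <= n.+2%:R^-1 ^+ 2 :> R.
  by rewrite ler_wiXn2l ?invr_ge0// invf_le1// ler1n.
move=> H; apply: le_trans (lerD (lexx _) H) _.
have n0 : 0 < n.+1%:R :> R by [].
rewrite -[n.+2%:R]natr1 in n10 *; set a := n.+1%:R in n0 n10 *.
suff : (a + 1)^-1 ^+ 2 <= a^-1 - (a + 1)^-1.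
  by move: ((a + 1)^-1) (a^-1) => u v ?; lra.
rewrite [leRHS](_ : _ = (a * (a + 1))^-1); last by field; rewrite !gt_eqF.
rewrite exprVn lef_pV2 ?posrE ?mulr_gt0 ?exprn_gt0// expr2 ler_pM2r//.
by rewrite lerDl.
Qed.

Lemma zetaE m : (1 < m)%N -> zeta R m = limn (series (fun n => n%:R^-1 ^+ m : R)).
Proof.
move=> m1; rewrite /zeta (gtn_eqF (ltnW m1)) -rsum_series.
  by congr rsum; apply/funext => n; rewrite exprVn.
by rewrite invr0 expr0n (gtn_eqF (ltnW m1)).
Qed.

(** The real restriction of [Li] to the interval ]-1, 1[, as [polylog_disc] shows. *)
Definition rpolylog t (x : R) : R := limn (pseries (fun n => n%:R^-1 ^+ t) x).

Lemma is_cvg_geom (x : R) : `|x| < 1 -> cvgn (series (fun n => `|x| ^+ n)).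
Proof.
move=> x1; have := @is_cvg_geometric_series R 1 `|x|; rewrite normr_id => /(_ x1).
by rewrite (_ : geometric 1 `|x| = (fun n => `|x| ^+ n))//; apply/funext => n /=; rewrite mul1r.
Qed.

Lemma inv_power_le1 n t : n%:R^-1 ^+ t <= 1 :> R.
Proof.
rewrite exprn_ile1 ?invr_ge0//; case: n => [|n]; first by rewrite invr0.
by rewrite invf_le1// ler1n.
Qed.

Lemma cvg_rpolylog t (x : R) : `|x| < 1 ->
  pseries (fun n => n%:R^-1 ^+ t) x @ \oo --> rpolylog t x.
Proof.
move=> x1; apply: normed_cvg.
apply: series_le_cvg (is_cvg_geom x1) => [n|n|n] /=; rewrite ?exprn_ge0//.
by rewrite normrM [`|x ^+ n|]normrX ler_piMl ?exprn_ge0// ger0_norm ?exprn_ge0// inv_power_le1.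
Qed.

End ZetaSeries.

(** * Continuation along one ray, for real and imaginary parts at once *)

Section Rays.
Variables (R : realType) (t : nat) (f : R -> R) (tau : nat -> R) (c : R).
Hypothesis t_gt0 : (0 < t)%N.
Hypothesis f_an : ranalytic f.
Hypothesis tau_rec : forall n, tau n.+2 = 2 * c * tau n.+1 - tau n.
Hypothesis tau_le1 : forall n, `|tau n| <= 1.
Hypothesis f_series : forall x, `|x| < 1 ->
  pseries (fun n => tau n * n%:R^-1 ^+ t) x @ \oo --> f x.

(** In this section [tau n] stands for cos(n e) or - sin(n e) and [c] for cos e. The condition k < t
    keeps the exponent t - k positive, so that the term n = 0 vanishes on both sides. *)
Lemma ray_series k x : (k < t)%N -> `|x| < 1 ->
  pseries (fun n => tau n * n%:R^-1 ^+ (t - k)) x @ \oo --> iter k (@xderiv R) f x.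
Proof.
move=> kt x1; have := @pseries_iter_xderiv _ f _ k f_series _ x1.
rewrite (_ : (fun n => _ * _ ^+ k) = (fun n => tau n * n%:R^-1 ^+ (t - k)))//.
apply/funext => -[|n].
  by rewrite invr0 !expr0n subn_eq0 leqNgt kt (gtn_eqF t_gt0) !mulr0 mul0r.
by rewrite -{1}(subnK (ltnW kt)) exprD -2!mulrA -exprMn mulVf// expr1n mulr1.
Qed.

(* Applying x d/dx to the series t times cancels the weights n^-t and leaves a
   rational function; analyticity carries the identity past the unit disc. *)
Lemma ray_ode x : 0 <= x ->
  (1 - 2 * x * c + x ^+ 2) * iter t (@xderiv R) f x = tau 1%N * x - tau 0%N * x ^+ 2.
Proof.
set F := iter t (@xderiv R) f; move=> x0.
(* The difference of the two sides in nested form, built only from sums, scalar multiples and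
   multiplications by the variable, for which analyticity is already known. *)
pose E y := F y + ((- (2 * c)) * (y * F y) + (y * (y * F y) + (y * (- tau 1%N + tau 0%N * (y * 1))))).
have Fa : ranalytic F by exact: ranalytic_iter_xderiv.
have Ea : ranalytic E.
  apply: ranalyticD => //; apply: ranalyticD; first exact/ranalyticZ/ranalytic_mulX.
  apply: ranalyticD; first exact/ranalytic_mulX/ranalytic_mulX.
  apply: ranalytic_mulX; apply: ranalyticD; first exact: ranalytic_cst.
  by apply/ranalyticZ/ranalytic_mulX; exact: ranalytic_cst.
suff : E x = 0.
  by rewrite /E => H; apply/eqP; rewrite -subr_eq0; apply/eqP; rewrite -[RHS]H; ring.
apply: ranalytic_ge0_eq0 Ea _ _ x0 => y; rewrite -ltr_norml => y1.
have := @pseries_iter_xderiv _ f _ t f_series _ y1.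
rewrite (_ : (fun n => _ * _ ^+ t) = (fun n => tau n *+ (0 < n)%N)); last first.
  apply/funext => -[|n]; first by rewrite invr0 !expr0n (gtn_eqF t_gt0) !mulr0.
  by rewrite -mulrA -exprMn mulVf// expr1n mulr1 mulr1n.
move=> /(cvg_lim (@Rhausdorff R)) => FE.
have [G _] := trig_generating tau_rec tau_le1 y1.
rewrite FE -/F in G.
by transitivity ((1 - 2 * y * c + y ^+ 2) * F y - (tau 1%N * y - tau 0%N * y ^+ 2));
  [rewrite /E; ring|rewrite G subrr].
Qed.

(** An Abel-type limit x -> 1-: the function is continuous at 1 by analyticity, and the series is
    dominated by n^-(t-k) with exponent at least 2. *)
Lemma ray_value1 k : (k.+1 < t)%N ->
  series (fun n => tau n * n%:R^-1 ^+ (t - k)) @ \oo --> iter k (@xderiv R) f 1.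
Proof.
move=> kt; have m1 : (1 < t - k)%N by rewrite ltn_subRL addn1.
have cM := @is_cvg_inv_powers R _ m1.
have bnd n : `|tau n * n%:R^-1 ^+ (t - k)| <= n%:R^-1 ^+ (t - k).
  by rewrite normrM [X in _ * X]ger0_norm ?exprn_ge0// ler_piMl// exprn_ge0.
suff <- : limn (series (fun n => tau n * n%:R^-1 ^+ (t - k))) = iter k (@xderiv R) f 1.
  by apply: normed_cvg; apply: series_le_cvg cM => [n|n|n] //=; rewrite ?exprn_ge0.
have := @tannery R R (1^'-) _ (fun x n => tau n * n%:R^-1 ^+ (t - k) * x ^+ n)
  (iter k (@xderiv R) f) (fun n => tau n * n%:R^-1 ^+ (t - k))
  (fun n => n%:R^-1 ^+ (t - k)).
have fc := @ranalytic_continuous _ _ (ranalytic_iter_xderiv k f_an) 1.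
have H : iter k (@xderiv R) f x @[x --> 1^'-] --> iter k (@xderiv R) f 1.
  exact: cvg_at_left_filter fc.
move=> T; apply/esym; rewrite -(cvg_lim (@Rhausdorff R) H); apply: cvg_lim => //.
apply: T => //.
- near=> x => n; rewrite normrM (le_trans _ (bnd n))// ler_piMr// normrX.
  have x0 : 0 < x by near: x; apply: nbhs_left_gt.
  have x1 : x < 1 by near: x; exact: nbhs_left_lt.
  by rewrite (ger0_norm (ltW x0)) exprn_ile1// ltW.
- move=> n; rewrite -[X in _ --> X]mulr1; apply: cvgM; first exact: cvg_cst.
  apply: cvg_at_left_filter; rewrite -[X in _ --> X](expr1n _ n).
  exact: (@exprn_continuous R n 1).
- near=> x; apply: ray_series; first exact: ltnW.
  have x0 : 0 < x by near: x; apply: nbhs_left_gt.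
  by rewrite (ger0_norm (ltW x0)); near: x; exact: nbhs_left_lt.
Unshelve. all: by end_near. Qed.

End Rays.

(** * Jonquière's relation *)

Section Jonquiere.
Variables (R : realType) (t : nat) (Li : R[i] -> R[i]).
Hypothesis t_gt0 : (0 < t)%N.
Hypothesis Li_polylog : is_polylog t Li.
Local Open Scope complex_scope.

(* [unit_dir e] is exp(-i e), so the rays lie below the cut and approach it as
   e tends to 0 from the right. *)
Definition ray_Re (e x : R) : R := complex.Re (Li (x%:C * unit_dir e)).
Definition ray_Im (e x : R) : R := complex.Im (Li (x%:C * unit_dir e)).

Let tRe (e : R) (n : nat) : R := cos (n%:R * e).
Let tIm (e : R) (n : nat) : R := - sin (n%:R * e).

Lemma ray_term (e x : R) n :
  (x%:C * unit_dir e) ^+ n / n%:R ^+ t =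
  unit_dir e ^+ n * (n%:R^-1 ^+ t * x ^+ n)%:C.
Proof.
rewrite exprMn rmorphM /= !rmorphXn /= fmorphV rmorph_nat exprVn.
by rewrite [x%:C ^+ n * _]mulrC -mulrA [x%:C ^+ n * _]mulrC.
Qed.

Lemma ray_Re_series (e x : R) : `|x| < 1 ->
  pseries (fun n => tRe e n * n%:R^-1 ^+ t) x @ \oo --> ray_Re e x.
Proof.
move=> x1; have zlt1 : `|x%:C * unit_dir e| < 1.
  by rewrite normrM norm_unit_dir mulr1 normC_real (_ : 1 = 1%:C)// ltcR.
have [H _ _] := Li_polylog.
have /csum_to_Re := H _ zlt1.
under [X in series X]eq_fun do rewrite ray_term ReM_real unit_dirX /=.
rewrite -/(ray_Re e x) => S.
suff : pseries (fun n => tRe e n * n%:R^-1 ^+ t) x n.+1 @[n --> \oo] --> ray_Re e x.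
  by rewrite (cvg_shiftS (pseries _ x)).
apply: cvg_trans S.
apply: near_eq_cvg; apply: nearW => n /=; rewrite /pseries /series /= [RHS]big_nat_recl//.
rewrite invr0 expr0n (gtn_eqF t_gt0) mulr0 mul0r add0r.
by apply: eq_bigr => i _; rewrite mulrA.
Qed.

Lemma ray_Im_series (e x : R) : `|x| < 1 ->
  pseries (fun n => tIm e n * n%:R^-1 ^+ t) x @ \oo --> ray_Im e x.
Proof.
move=> x1; have zlt1 : `|x%:C * unit_dir e| < 1.
  by rewrite normrM norm_unit_dir mulr1 normC_real (_ : 1 = 1%:C)// ltcR.
have [H _ _] := Li_polylog.
have /csum_to_Im := H _ zlt1.
under [X in series X]eq_fun do rewrite ray_term ImM_real unit_dirX /=.
rewrite -/(ray_Im e x) => S.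
suff : pseries (fun n => tIm e n * n%:R^-1 ^+ t) x n.+1 @[n --> \oo] --> ray_Im e x.
  by rewrite (cvg_shiftS (pseries _ x)).
apply: cvg_trans S.
apply: near_eq_cvg; apply: nearW => n /=; rewrite /pseries /series /= [RHS]big_nat_recl//.
rewrite invr0 expr0n (gtn_eqF t_gt0) mulr0 mul0r add0r.
by apply: eq_bigr => i _; rewrite mulrA.
Qed.

Lemma polylog_disc (x : R) : `|x| < 1 -> Li x%:C = (rpolylog t x)%:C.
Proof.
move=> x1; have u0 : unit_dir 0 = 1 :> R[i] by rewrite /unit_dir cos0 sin0 oppr0.
apply/eqP; rewrite eq_complex /=; apply/andP; split; apply/eqP.
  have := @ray_Re_series 0 x x1; rewrite /ray_Re u0 mulr1.
  move=> /(cvg_lim (@Rhausdorff R)) <-; rewrite /rpolylog; congr (limn (pseries _ x)).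
  by apply/funext => n; rewrite /tRe mulr0 cos0 mul1r.
have := @ray_Im_series 0 x x1; rewrite /ray_Im u0 mulr1.
move=> /(cvg_lim (@Rhausdorff R)) <-; apply: cvg_lim => //.
rewrite (_ : pseries _ x = fun=> 0); first exact: cvg_cst.
apply/funext => n; rewrite /pseries /series /= big1// => i _.
by rewrite /tIm mulr0 sin0 oppr0 !mul0r.
Qed.

(** The whole line in this direction, negative x included, meets the real axis only at 0, which is
    off the cut. *)
Lemma ray_slit (e x : R) : 0 < e < pi -> slit_plane (x%:C * unit_dir e).
Proof.
move=> epi; rewrite /slit_plane /= !mul0r subr0 addr0 mulrN.
move=> [/eqP]; rewrite oppr_eq0 mulf_eq0 (gt_eqF (sin_gt0_pi epi)) orbF.
by move=> /eqP ->; rewrite mul0r ler10.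
Qed.

Lemma ray_expansion (e x : R) : 0 < e < pi -> exists (c : nat -> R[i]) (r : R), 0 < r /\
  forall h, `|h| < r -> csum_to (fun k => c k * unit_dir e ^+ k * (h ^+ k)%:C)
     (Li ((x + h)%:C * unit_dir e)).
Proof.
move=> epi; have [_ /(_ _ (@ray_slit e x epi))[c [r [r0 H]]] _] := Li_polylog.
exists c, r; split=> // h hr.
have zw : (x + h)%:C * unit_dir e - x%:C * unit_dir e = h%:C * unit_dir e.
  by rewrite -mulrBl -rmorphB /= addrAC subrr add0r.
have := H ((x + h)%:C * unit_dir e); rewrite zw normrM norm_unit_dir mulr1 normC_real ltcR.
move=> /(_ hr); under [X in csum_to X]eq_fun do rewrite exprMn mulrCA mulrC -rmorphXn.
exact.
Qed.

Lemma ray_Re_ranalytic (e : R) : 0 < e < pi -> ranalytic (ray_Re e).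
Proof.
move=> epi x; have [c [r [r0 H]]] := @ray_expansion e x epi.
exists (fun k => complex.Re (c k * unit_dir e ^+ k)), r; split => // h /H /csum_to_Re.
by under [X in series X]eq_fun do rewrite ReM_real; exact.
Qed.

Lemma ray_Im_ranalytic (e : R) : 0 < e < pi -> ranalytic (ray_Im e).
Proof.
move=> epi x; have [c [r [r0 H]]] := @ray_expansion e x epi.
exists (fun k => complex.Im (c k * unit_dir e ^+ k)), r; split => // h /H /csum_to_Im.
by under [X in series X]eq_fun do rewrite ImM_real; exact.
Qed.

Lemma tRe_rec (e : R) n : tRe e n.+2 = 2 * cos e * tRe e n.+1 - tRe e n.
Proof.
rewrite /tRe -(natr1 n.+1) mulrDl mul1r cosD.
rewrite [in X in _ = _ - X](_ : n%:R * e = n.+1%:R * e - e); last by rewrite -natr1; ring.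
by rewrite cosB; ring.
Qed.

Lemma tIm_rec (e : R) n : tIm e n.+2 = 2 * cos e * tIm e n.+1 - tIm e n.
Proof.
rewrite /tIm -(natr1 n.+1) mulrDl mul1r sinD.
rewrite [in X in _ = _ - X](_ : n%:R * e = n.+1%:R * e - e); last by rewrite -natr1; ring.
by rewrite sinB; ring.
Qed.

Lemma tRe_le1 (e : R) n : `|tRe e n| <= 1. Proof. exact: cos_max. Qed.
Lemma tIm_le1 (e : R) n : `|tIm e n| <= 1. Proof. by rewrite normrN; exact: sin_max. Qed.

Lemma cvg_tRe n : tRe e n @[e --> 0^'+] --> (1 : R).
Proof.
apply: cvg_at_right_filter; rewrite -(@cos0 R) -{2}(mulr0 n%:R).
apply: continuous_comp; last exact: continuous_cos.
by apply: cvgM; [exact: cvg_cst|exact: cvg_id].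
Qed.

Lemma cvg_tIm n : tIm e n @[e --> 0^'+] --> (0 : R).
Proof.
suff H : sin (n%:R * e) @[e --> 0^'+] --> sin (n%:R * 0 : R).
  by rewrite mulr0 sin0 in H; have := cvgN H; rewrite oppr0; exact.
apply: cvg_at_right_filter.
apply: continuous_comp; last exact: continuous_sin.
by apply: cvgM; [exact: cvg_cst|exact: cvg_id].
Qed.

Lemma near0_pi : \forall e \near 0^'+, 0 < e < (pi : R).
Proof.
near=> e; apply/andP; split; near: e; first exact: nbhs_right_gt.
by apply: nbhs_right_lt; exact: pi_gt0.
Unshelve. all: by end_near. Qed.

Lemma cvg_ray_Re1 k : (k.+1 < t)%N ->
  iter k (@xderiv R) (ray_Re e) 1 @[e --> 0^'+] --> zeta R (t - k).
Proof.
move=> kt; have m1 : (1 < t - k)%N by rewrite ltn_subRL addn1.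
rewrite zetaE//.
rewrite (_ : (fun n => n%:R^-1 ^+ (t - k)) = (fun n => 1 * n%:R^-1 ^+ (t - k))); last first.
  by apply/funext => n; rewrite mul1r.
apply: (@tannery R R _ _ (fun e n => tRe e n * n%:R^-1 ^+ (t - k)) _ _ (fun n => n%:R^-1 ^+ (t - k))).
- apply: nearW => e n; rewrite normrM [X in _ * X]ger0_norm ?exprn_ge0//.
  by rewrite ler_piMl ?tRe_le1// exprn_ge0.
- exact: is_cvg_inv_powers.
- by move=> n; apply: cvgM; [exact: cvg_tRe|exact: cvg_cst].
- apply: filterS near0_pi => e epi.
  apply: (ray_value1 (tau := tRe e)) => //.
  + exact: ray_Re_ranalytic.
  + exact: tRe_le1.
  + by move=> x; exact: ray_Re_series.
Qed.

Lemma cvg_ray_Im1 k : (k.+1 < t)%N ->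
  iter k (@xderiv R) (ray_Im e) 1 @[e --> 0^'+] --> (0 : R).
Proof.
move=> kt; have m1 : (1 < t - k)%N by rewrite ltn_subRL addn1.
rewrite [X in _ --> X](_ : _ = limn (series (fun n => 0 * n%:R^-1 ^+ (t - k) : R))); last first.
  apply/esym/cvg_lim => //; rewrite (_ : series _ = fun=> 0); first exact: cvg_cst.
  by apply/funext => n; rewrite /series /= big1// => i _; rewrite mul0r.
apply: (@tannery R R _ _ (fun e n => tIm e n * n%:R^-1 ^+ (t - k)) _ _ (fun n => n%:R^-1 ^+ (t - k))).
- apply: nearW => e n; rewrite normrM [X in _ * X]ger0_norm ?exprn_ge0//.
  by rewrite ler_piMl ?tIm_le1// exprn_ge0.
- exact: is_cvg_inv_powers.
- by move=> n; apply: cvgM; [exact: cvg_tIm|exact: cvg_cst].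
- apply: filterS near0_pi => e epi.
  apply: (ray_value1 (tau := tIm e)) => //.
  + exact: ray_Im_ranalytic.
  + exact: tIm_le1.
  + by move=> x; exact: ray_Im_series.
Qed.

Lemma cvg_ray_disc_Re (x : R) : `|x| < 1 -> ray_Re e x @[e --> 0^'+] --> rpolylog t x.
Proof.
move=> x1.
have := @tannery R R (0^'+) _ (fun e n => tRe e n * n%:R^-1 ^+ t * x ^+ n) (fun e => ray_Re e x)
  (fun n => n%:R^-1 ^+ t * x ^+ n) (fun n => `|x| ^+ n).
apply.
- apply: nearW => e n; rewrite 2!normrM [`|x ^+ n|]normrX ler_piMl ?exprn_ge0//.
  by rewrite mulr_ile1 ?tRe_le1// ger0_norm ?exprn_ge0// inv_power_le1.
- exact: is_cvg_geom.
- move=> n; apply: cvgM; last exact: cvg_cst.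
  rewrite -[X in _ --> X]mul1r; apply: cvgM; [exact: cvg_tRe|exact: cvg_cst].
- by apply: nearW => e; exact: ray_Re_series.
Qed.

Lemma cvg_ray_disc_Im (x : R) : `|x| < 1 -> ray_Im e x @[e --> 0^'+] --> (0 : R).
Proof.
move=> x1.
rewrite [X in _ --> X](_ : _ = limn (series (fun n => 0 : R))); last first.
  apply/esym/cvg_lim => //; rewrite (_ : series _ = fun=> 0); first exact: cvg_cst.
  by apply/funext => n; rewrite /series /= big1.
have := @tannery R R (0^'+) _ (fun e n => tIm e n * n%:R^-1 ^+ t * x ^+ n) (fun e => ray_Im e x)
  (fun n => 0) (fun n => `|x| ^+ n).
apply.
- apply: nearW => e n; rewrite 2!normrM [`|x ^+ n|]normrX ler_piMl ?exprn_ge0//.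
  by rewrite mulr_ile1 ?tIm_le1// ger0_norm ?exprn_ge0// inv_power_le1.
- exact: is_cvg_geom.
- move=> n; have H : tIm e n * n%:R^-1 ^+ t * x ^+ n @[e --> 0^'+] --> 0 * n%:R^-1 ^+ t * x ^+ n.
    apply: cvgM; last exact: cvg_cst.
    by apply: cvgM; [exact: cvg_tIm|exact: cvg_cst].
  by rewrite !mul0r in H.
- by apply: nearW => e; exact: ray_Im_series.
Qed.

Lemma normC_le (z : R[i]) : `|z| <= (`|complex.Re z| + `|complex.Im z|)%:C.
Proof.
rewrite {1}(complexE z) rmorphD /= (le_trans (ler_normD _ _))// lerD ?normC_real//.
by rewrite normrM normC_real [`|'i|]normc_def /= expr0n add0r expr1n sqrtr1 mul1r.
Qed.

Lemma cvg_complex (T : Type) (F : set_system T) {FF : Filter F} (u : T -> R[i]^o) (l : R[i]^o) :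
  complex.Re (u x) @[x --> F] --> complex.Re l ->
  complex.Im (u x) @[x --> F] --> complex.Im l -> u @ F --> l.
Proof.
move=> /cvgrPdist_lt ur /cvgrPdist_lt ui; apply/cvgrPdist_lt => -[e e'].
(* Positivity in R[i] forces the radius to be real. *)
rewrite ltcE /= => /andP[/eqP-> e0].
have e2 : 0 < e / 2 by rewrite divr_gt0.
have {}ur := ur _ e2; have {}ui := ui _ e2.
near=> x; apply: le_lt_trans (normC_le _) _; rewrite [ltRHS](_ : _ = e%:C)// ltcR.
have [-> ->] : complex.Re (l - u x) = complex.Re l - complex.Re (u x) /\
    complex.Im (l - u x) = complex.Im l - complex.Im (u x).
  by move: (l : R[i]) (u x : R[i]) => [? ?] [? ?].
by rewrite [ltRHS]splitr ltrD//; near: x.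
Unshelve. all: by end_near. Qed.

(** Makes the clause of [is_polylog] about the cut applicable: the points approach x through the
    lower half-plane, since sin e > 0. *)
Lemma cvg_ray (x : R) : 1 < x ->
  (x%:C * unit_dir e : R[i]^o) @[e --> 0^'+] -->
    within [set z : R[i]^o | complex.Im z < 0] (nbhs (x%:C : R[i]^o)).
Proof.
move=> x1 P; rewrite /within /= => HP.
have C : (x%:C * unit_dir e : R[i]^o) @[e --> 0^'+] --> (x%:C : R[i]^o).
  apply: cvg_complex => /=.
    have H : x * cos e @[e --> 0^'+] --> x * cos (0 : R).
      apply: cvgM; first exact: cvg_cst.
      by apply: cvg_at_right_filter; exact: continuous_cos.
    rewrite cos0 mulr1 in H; apply: cvg_trans H.
    by apply: near_eq_cvg; apply: nearW => e; rewrite mul0r subr0.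
  have H : x * - sin e @[e --> 0^'+] --> x * - sin (0 : R).
    apply: cvgM; first exact: cvg_cst.
    by apply: cvgN; apply: cvg_at_right_filter; exact: continuous_sin.
  rewrite sin0 oppr0 mulr0 in H; apply: cvg_trans H.
  by apply: near_eq_cvg; apply: nearW => e; rewrite mul0r addr0.
have := C _ HP; rewrite !nbhs_simpl /= => CP.
near=> e; have : (fun z : R[i]^o => complex.Im z < 0 -> P z) (x%:C * unit_dir e) by near: e.
apply => /=; rewrite mul0r addr0 mulrN oppr_lt0 mulr_gt0// ?(lt_trans ltr01 x1)//.
by apply: sin_gt0_pi; near: e; exact: near0_pi.
Unshelve. all: by end_near. Qed.

Lemma ray_den_gt0 (e x : R) : 0 < e < pi -> 0 < 1 - 2 * x * cos e + x ^+ 2.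
Proof.
move=> epi; rewrite (_ : _ + _ = (x - cos e) ^+ 2 + sin e ^+ 2); last first.
  by rewrite sin2cos2; ring.
by rewrite ltr_wpDl ?sqr_ge0// exprn_gt0// sin_gt0_pi.
Qed.

Lemma ray_Re_ode (e x : R) : 0 < e < pi -> 0 <= x ->
  iter t (@xderiv R) (ray_Re e) x = (cos e * x - x ^+ 2) / (1 - 2 * x * cos e + x ^+ 2).
Proof.
move=> epi x0; apply: (canRL (mulfK (lt0r_neq0 (ray_den_gt0 x epi)))).
have := ray_ode (tau := tRe e) (c := cos e) t_gt0 (ray_Re_ranalytic epi) (tRe_rec e) (tRe_le1 e)
  (@ray_Re_series e) x0.
by rewrite /tRe mul0r mul1r cos0 mul1r mulrC.
Qed.

Lemma ray_Im_ode (e x : R) : 0 < e < pi -> 0 <= x ->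
  iter t (@xderiv R) (ray_Im e) x = (- sin e * x) / (1 - 2 * x * cos e + x ^+ 2).
Proof.
move=> epi x0; apply: (canRL (mulfK (lt0r_neq0 (ray_den_gt0 x epi)))).
have := ray_ode (tau := tIm e) (c := cos e) t_gt0 (ray_Im_ranalytic epi) (tIm_rec e) (tIm_le1 e)
  (@ray_Im_series e) x0.
by rewrite /tIm mul0r mul1r sin0 oppr0 mul0r subr0 mulrC.
Qed.

(** Dividing the differential equation by x gives A' = - sin e / (1 - 2x cos e + x^2) for A = (x
    d/dx)^(t-1) of the imaginary part. An antiderivative is - atan((x - cos e) / sin e), and
    integration runs from 0, where A vanishes, to 1. *)
Lemma ray_Im_log (e : R) : 0 < e < pi ->
  iter t.-1 (@xderiv R) (ray_Im e) 1 = - atan ((1 - cos e) / sin e) - atan (cos e / sin e).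
Proof.
move=> epi; set A := iter t.-1 _ _.
have s0 : 0 < sin e by exact: sin_gt0_pi.
have Aa : ranalytic A by apply: ranalytic_iter_xderiv; exact: ray_Im_ranalytic.
have A0 : A 0 = 0.
  have x0 : `|0 : R| < 1 by rewrite normr0.
  have tt : (t.-1 < t)%N by rewrite prednK.
  have := ray_series t_gt0 (@ray_Im_series e) tt x0; rewrite -/A => H.
  have := cvg_pseries_at0 (c := fun n => tIm e n * n%:R^-1 ^+ (t - t.-1)).
  move=> /(cvg_lim (@Rhausdorff R)); rewrite (cvg_lim _ H)// => ->.
  by rewrite /tIm mul0r sin0 oppr0 mul0r.
pose B x := A x + atan ((x - cos e) / sin e).
have dA (x : R) : 0 < x -> derive1 A x = - sin e / (1 - 2 * x * cos e + x ^+ 2).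
  move=> x0; have := ray_Im_ode epi (ltW x0).
  rewrite -{1}(prednK t_gt0) iterS -/A /xderiv mulrAC mulrC => /mulIf; apply.
  by rewrite gt_eqF.
have dB (x : R) : is_derive x 1 B (derive1 A x + (1 + ((x - cos e) / sin e) ^+ 2)^-1 * (sin e)^-1).
  apply: is_deriveD_fun; first exact: ranalytic_derive.
  have D1 : is_derive x 1 (fun y => (y - cos e) / sin e) (sin e)^-1.
    have := is_deriveM_fun (is_deriveB_fun (is_derive_id x (1 : R)) (is_derive_cst (cos e) x (1 : R)))
      (is_derive_cst (sin e)^-1 x (1 : R)).
    by rewrite subr0 mulr0 addr0 mul1r.
  exact: is_derive_comp D1 (is_derive1_atan _).
have /(@is_derive0_eq _ B 0 1 ler01) H : {within `[0, 1], continuous B}.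
  by apply: continuous_subspaceT => x; exact: is_derive_continuous (dB x).
have : B 0 = B 1.
  apply: H => x /andP[x0 _]; apply: (is_derive_congr (dB x)); rewrite dA//.
  have D := ray_den_gt0 x epi.
  have D' : 1 - 2 * x * cos e + x ^+ 2 = sin e ^+ 2 + (x - cos e) ^+ 2 by rewrite sin2cos2; ring.
  rewrite D' in D *; field.
  by rewrite !gt_eqF.
rewrite /B A0 sub0r mulNr atanN add0r => E.
by rewrite -[A 1](addrK (atan ((1 - cos e) / sin e))) -E addrC.
Qed.

(** The two arctangents are those of tan(e/2) and tan(pi/2 - e), so the value is exactly e/2 -
    pi/2. *)
Lemma cvg_ray_Im_log :
  iter t.-1 (@xderiv R) (ray_Im e) 1 @[e --> 0^'+] --> - (pi / 2 : R).
Proof.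
have H : e / 2 - pi / 2 @[e --> 0^'+] --> 0 / 2 - (pi / 2 : R).
  apply: cvgB; last exact: cvg_cst.
  by apply: cvg_at_right_filter; apply: cvgM; [exact: cvg_id|exact: cvg_cst].
rewrite mul0r sub0r in H; apply: cvg_trans H; apply: near_eq_cvg.
near=> e; have epi : 0 < e < pi by near: e; exact: near0_pi.
have [e0 e1] := andP epi; have s0 := sin_gt0_pi epi.
have e2 : e = (e / 2) *+ 2 by rewrite mulr2n -splitr.
have c0 : 0 < cos (e / 2) by apply: cos_gt0_pihalf; apply/andP; split; lra.
have s20 : 0 < sin (e / 2) by apply: sin_gt0_pihalf; apply/andP; split; lra.
rewrite ray_Im_log//.
have -> : (1 - cos e) / sin e = tan (e / 2).
  move: (e / 2) e2 c0 s20 => y -> c0 s20.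
  rewrite cos_mulr2n sin_mulr2n /tan.
  have -> : 1 - (cos y ^+ 2 *+ 2 - 1) = sin y ^+ 2 *+ 2 by rewrite sin2cos2; ring.
  by field; rewrite !gt_eqF.
have -> : cos e / sin e = tan (pi / 2 - e).
  by rewrite /tan cosB sinB cos_pihalf sin_pihalf; congr (_ / _); ring.
by rewrite !tanK ?in_itv /=; [lra|apply/andP; split; lra|apply/andP; split; lra].
Unshelve. all: by end_near. Qed.

(** The top coefficient is -1: the rational functions at E and 1/E have the common denominator D = 1
    - 2E cos e + E^2, and their numerators add up to -D. *)
Lemma ray_Re_reciprocal (e x : R) : 0 < e < pi ->
  ray_Re e (expR x) + (-1) ^+ t * ray_Re e (expR (- x)) =
  \sum_(0 <= k < t.+1) (if k == t then -1 else (1 + (-1) ^+ (t + k)) * iter k (@xderiv R) (ray_Re e) 1)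
    * x ^+ k / k`!%:R.
Proof.
move=> epi.
pose W k y := iter k (@xderiv R) (ray_Re e) (expR y) + 1 * (-1) ^+ (t + k) * iter k (@xderiv R) (ray_Re e) (expR (- y)).
have dW k (y : R) : (k < t)%N -> is_derive y 1 (W k) (W k.+1 y).
  by move=> _; exact: reciprocal_chain (ray_Re_ranalytic epi) _ _.
have Wt y : W t y = -1.
  rewrite /W addnn -signr_odd odd_double expr0 !mul1r !ray_Re_ode ?expR_ge0//.
  have D1 := ray_den_gt0 (expR y) epi; have := ray_den_gt0 (expR (- y)) epi.
  rewrite expRN; have E0 := expR_gt0 y; set E := expR y in D1 E0 * => D2.
  have -> : 1 - 2 * E^-1 * cos e + E^-1 ^+ 2 = (1 - 2 * E * cos e + E ^+ 2) / E ^+ 2.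
    by field; rewrite gt_eqF.
  (* Eliminates cos e in favour of D, after which the identity is one of rational functions in D and
     E. *)
  have cE : cos e = (1 + E ^+ 2 - (1 - 2 * E * cos e + E ^+ 2)) / (2 * E) by field; rewrite gt_eqF.
  move: D1 cE; set D := 1 - 2 * E * cos e + E ^+ 2; clearbody D => D1 ->.
  by field; rewrite !gt_eqF.
have := poly_of_derive_chain dW Wt x.
rewrite {1}/W addn0 mul1r /= => ->; apply: eq_bigr => k _; congr (_ * _ / _).
case: eqP => [->|_]; first exact: Wt.
by rewrite /W oppr0 expR0 mul1r mulrDl mul1r.
Qed.

(** Here x / (1 - 2x cos e + x^2) is invariant under x -> 1/x, so the difference has top coefficient
    0. *)
Lemma ray_Im_reciprocal (e x : R) : 0 < e < pi ->
  ray_Im e (expR x) - (-1) ^+ t * ray_Im e (expR (- x)) =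
  \sum_(0 <= k < t.+1) (if k == t then 0 else (1 - (-1) ^+ (t + k)) * iter k (@xderiv R) (ray_Im e) 1)
    * x ^+ k / k`!%:R.
Proof.
move=> epi.
pose W k y := iter k (@xderiv R) (ray_Im e) (expR y) + -1 * (-1) ^+ (t + k) * iter k (@xderiv R) (ray_Im e) (expR (- y)).
have dW k (y : R) : (k < t)%N -> is_derive y 1 (W k) (W k.+1 y).
  by move=> _; exact: reciprocal_chain (ray_Im_ranalytic epi) _ _.
have Wt y : W t y = 0.
  rewrite /W addnn -signr_odd odd_double expr0 mulr1 !ray_Im_ode ?expR_ge0//.
  have D1 := ray_den_gt0 (expR y) epi; have := ray_den_gt0 (expR (- y)) epi.
  rewrite expRN; have E0 := expR_gt0 y; set E := expR y in D1 E0 * => D2.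
  have -> : 1 - 2 * E^-1 * cos e + E^-1 ^+ 2 = (1 - 2 * E * cos e + E ^+ 2) / E ^+ 2.
    by field; rewrite gt_eqF.
  move: D1; set D := 1 - 2 * E * cos e + E ^+ 2; clearbody D => D1.
  by field; rewrite !gt_eqF.
have := poly_of_derive_chain dW Wt x.
rewrite {1}/W addn0 mulN1r mulNr /= => ->; apply: eq_bigr => k _; congr (_ * _ / _).
case: eqP => [->|_]; first exact: Wt.
by rewrite /W oppr0 expR0 mulN1r mulrBl mul1r mulNr.
Qed.

(** The real part of Jonquière's relation, as the limit e -> 0+ of [ray_Re_reciprocal], coefficient
    by coefficient. *)
Lemma polylog_cut_Re (x : R) : 0 < x ->
  complex.Re (Li (expR x)%:C) + (-1) ^+ t * rpolylog t (expR (- x)) =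
  \sum_(0 <= k < t.+1) (1 + (-1) ^+ (t + k)) * zeta R (t - k) * x ^+ k / k`!%:R.
Proof.
move=> x0; have ex1 : 1 < expR x by rewrite expR_gt1.
have emx1 : `|expR (- x)| < 1 by rewrite ger0_norm ?expR_ge0// expR_lt1 oppr_lt0.
have [_ _ /(_ _ ex1) lim] := Li_polylog.
have H1 : ray_Re e (expR x) + (-1) ^+ t * ray_Re e (expR (- x)) @[e --> 0^'+] -->
    complex.Re (Li (expR x)%:C) + (-1) ^+ t * rpolylog t (expR (- x)).
  apply: cvgD; first by have := cvg_Re (cvg_comp _ _ (cvg_ray ex1) lim); exact.
  by apply: cvgM; [exact: cvg_cst|exact: cvg_ray_disc_Re].
have H2 : \sum_(0 <= k < t.+1) (if k == t then -1 else (1 + (-1) ^+ (t + k)) * iter k (@xderiv R) (ray_Re e) 1)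
    * x ^+ k / k`!%:R @[e --> 0^'+] -->
  \sum_(0 <= k < t.+1) (1 + (-1) ^+ (t + k)) * zeta R (t - k) * x ^+ k / k`!%:R.
  apply: cvg_sum_nat => k /andP[_]; rewrite ltnS => kt.
  apply: cvgM; last exact: cvg_cst; apply: cvgM; last exact: cvg_cst.
  have [->|kt'] := eqVneq k t.
    (* For k = t the coefficient -1 is 2 zeta(0), which is where the value zeta(0) = -1/2 enters. *)
    rewrite addnn -signr_odd odd_double expr0 subnn /zeta eqxx.
    by rewrite (_ : _ * _ = -1); [exact: cvg_cst|lra].
  have {}kt : (k < t)%N by rewrite ltn_neqAle kt'.
  have [k1|] := ltnP k.+1 t; first by apply: cvgM; [exact: cvg_cst|exact: cvg_ray_Re1].
  (* For k = t - 1 the sign factor is 0, so the meaningless [zeta 1] is multiplied by 0. *)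
  move=> tk; have -> : t = k.+1 by apply/eqP; rewrite eqn_leq tk kt.
  rewrite -signr_odd addSn /= addnn odd_double expr1 subrr !mul0r.
  by under eq_fun do rewrite mul0r; exact: cvg_cst.
apply: (cvg_unique _ H1) => //; apply: cvg_trans H2; apply: near_eq_cvg.
by near=> e; rewrite ray_Re_reciprocal//; near: e; exact: near0_pi.
Unshelve. all: by end_near. Qed.

(** Inside the disc the imaginary part tends to 0, and of the polynomial only the order t - 1
    survives, with coefficient 2 times - pi/2. *)
Lemma polylog_cut_Im (x : R) : 0 < x ->
  complex.Im (Li (expR x)%:C) = - pi * x ^+ t.-1 / (t.-1)`!%:R.
Proof.
move=> x0; have ex1 : 1 < expR x by rewrite expR_gt1.
have emx1 : `|expR (- x)| < 1 by rewrite ger0_norm ?expR_ge0// expR_lt1 oppr_lt0.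
have [_ _ /(_ _ ex1) lim] := Li_polylog.
have H1 : ray_Im e (expR x) - (-1) ^+ t * ray_Im e (expR (- x)) @[e --> 0^'+] -->
    complex.Im (Li (expR x)%:C) - (-1) ^+ t * 0.
  apply: cvgB; first by have := cvg_Im (cvg_comp _ _ (cvg_ray ex1) lim); exact.
  by apply: cvgM; [exact: cvg_cst|exact: cvg_ray_disc_Im].
rewrite mulr0 subr0 in H1.
have H2 : \sum_(0 <= k < t.+1) (if k == t then 0 else (1 - (-1) ^+ (t + k)) * iter k (@xderiv R) (ray_Im e) 1)
    * x ^+ k / k`!%:R @[e --> 0^'+] -->
  \sum_(0 <= k < t.+1) (if k == t.-1 then - pi else 0) * x ^+ k / k`!%:R.
  apply: cvg_sum_nat => k /andP[_]; rewrite ltnS => kt.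
  apply: cvgM; last exact: cvg_cst; apply: cvgM; last exact: cvg_cst.
  have [->|kt'] := eqVneq k t.
    by rewrite gtn_eqF ?prednK//; exact: cvg_cst.
  have {}kt : (k < t)%N by rewrite ltn_neqAle kt'.
  have [k1|] := ltnP k.+1 t.
    have kt1 : (k < t.-1)%N by rewrite -ltnS prednK.
    rewrite (ltn_eqF kt1).
    have H : (1 - (-1) ^+ (t + k)) * iter k (@xderiv R) (ray_Im e) 1 @[e --> 0^'+] --> (1 - (-1) ^+ (t + k)) * (0 : R).
      by apply: cvgM; [exact: cvg_cst|exact: cvg_ray_Im1].
    by rewrite mulr0 in H.
  move=> tk; have kE : k = t.-1 by apply/eqP; rewrite -eqSS prednK// eqn_leq kt tk.
  rewrite kE eqxx -signr_odd -{1}(prednK t_gt0) addSn /= addnn odd_double expr1 opprK.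
  rewrite (_ : - pi = (1 + 1) * - (pi / 2)); last by field.
  by apply: cvgM; [exact: cvg_cst|exact: cvg_ray_Im_log].
have -> : - pi * x ^+ t.-1 / (t.-1)`!%:R =
    \sum_(0 <= k < t.+1) (if k == t.-1 then - pi else 0) * x ^+ k / k`!%:R.
  rewrite big_mkord (bigD1 (inord t.-1)) //= inordK ?eqxx; last by rewrite prednK.
  rewrite big1 ?addr0// => i; rewrite -val_eqE /= inordK; last by rewrite prednK.
  by move=> /negbTE ->; rewrite !mul0r.
apply: (cvg_unique _ H1) => //; apply: cvg_trans H2; apply: near_eq_cvg.
by near=> e; rewrite ray_Im_reciprocal//; near: e; exact: near0_pi.
Unshelve. all: by end_near. Qed.

End Jonquiere.

(** * Integrals with a prescribed value *)

Section HasIntegral.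
Variable R : realType.
Notation mu := (@lebesgue_measure R).
Implicit Types (D : set (measurableTypeR R)) (f g : R -> R) (l m : R).

(** Integrability is bundled with the value: additivity of the integral needs it, and the final
    statement claims both. *)
Definition has_integral D f l : Prop :=
  mu.-integrable D (EFin \o f) /\ \int[mu]_(x in D) f x = l.

Lemma has_integralE D f l : measurable D -> mu.-integrable D (EFin \o f) ->
  (\int[mu]_(x in D) (f x)%:E)%E = l%:E -> has_integral D f l.
Proof. by move=> mD fi fl; split => //; rewrite /Rintegral fl. Qed.

Lemma has_integral_EFin D f l : measurable D -> has_integral D f l ->
  (\int[mu]_(x in D) (f x)%:E)%E = l%:E.
Proof. by move=> mD [fi <-]; rewrite /Rintegral fineK//; exact: integrable_fin_num. Qed.

Lemma has_integral_eq D f g l : measurable D -> (forall x, D x -> f x = g x) ->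
  has_integral D f l -> has_integral D g l.
Proof.
move=> mD fg [fi fl]; split.
  by apply: eq_integrable fi => // x; rewrite inE => Dx /=; rewrite fg.
by rewrite -fl; apply: eq_Rintegral => x; rewrite inE => Dx; rewrite fg.
Qed.

Lemma has_integralD D f g l m : measurable D ->
  has_integral D f l -> has_integral D g m -> has_integral D (fun x => f x + g x) (l + m).
Proof.
move=> mD [fi fl] [gi gm]; split; last by rewrite RintegralD// fl gm.
by have := integrableD mD fi gi; apply: eq_integrable.
Qed.

Lemma has_integralZ D f l (k : R) : measurable D ->
  has_integral D f l -> has_integral D (fun x => k * f x) (k * l).
Proof.
move=> mD [fi fl]; split; last by rewrite RintegralZl// fl.
by have := integrableZl mD k fi; apply: eq_integrable.
Qed.

Lemma has_integralB D f g l m : measurable D ->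
  has_integral D f l -> has_integral D g m -> has_integral D (fun x => f x - g x) (l - m).
Proof.
move=> mD fl gm; rewrite -(mulN1r m).
apply: has_integral_eq mD _ (has_integralD mD fl (has_integralZ (-1) mD gm)).
by move=> x _; rewrite mulN1r.
Qed.

Lemma has_integral0 D : measurable D -> has_integral D (fun=> 0) 0.
Proof.
move=> mD; split; first by have := @integrable0 _ _ _ mu D.
by rewrite /Rintegral integral0.
Qed.

Lemma has_integral_sum D (f : nat -> R -> R) (l : nat -> R) (m n : nat) : measurable D ->
  (forall k, (m <= k < n)%N -> has_integral D (f k) (l k)) ->
  has_integral D (fun x => \sum_(m <= k < n) f k x) (\sum_(m <= k < n) l k).
Proof.
move=> mD; elim: n => [|n IH] H.
  by rewrite big_geq//; apply: has_integral_eq mD _ (has_integral0 mD) => x _; rewrite big_geq.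
have [mn|mn] := leqP m n; last first.
  by rewrite big_geq//; apply: has_integral_eq mD _ (has_integral0 mD) => x _; rewrite big_geq.
rewrite big_nat_recr//=.
have H1 := IH (fun k (kn : (m <= k < n)%N) => H k (introT andP (conj (proj1 (andP kn)) (leqW (proj2 (andP kn)))))).
have H2 := H n (introT andP (conj mn (ltnSn n))).
by apply: has_integral_eq mD _ (has_integralD mD H1 H2) => x _; rewrite big_nat_recr.
Qed.

Lemma has_integral_ge0 D f l : has_integral D f l -> (forall x, D x -> 0 <= f x) -> 0 <= l.
Proof. by move=> [_ <-] f0; exact: Rintegral_ge0. Qed.

Lemma has_integral_dominated D f g l : measurable D -> measurable_fun D f ->
  has_integral D g l -> (forall x, D x -> `|f x| <= g x) ->
  has_integral D f (\int[mu]_(x in D) f x).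
Proof.
move=> mD mf [gi _] fg; split => //.
apply: le_integrable gi => //; first exact/measurable_EFinP.
by move=> x Dx /=; rewrite lee_fin (le_trans (fg _ Dx))// ler_norm.
Qed.

(** Monotone convergence for nonnegative terms; integrability of the sum comes from the convergence
    of the series of integrals. *)
Lemma has_integral_series D (f : nat -> R -> R) (l : nat -> R) (g : R -> R) : measurable D ->
  (forall n, has_integral D (f n) (l n)) -> (forall n x, D x -> 0 <= f n x) ->
  (forall x, D x -> series (fun n => f n x) @ \oo --> g x) ->
  cvgn (series l) -> has_integral D g (limn (series l)).
Proof.
move=> mD fl f0 fg cl.
have fS n : has_integral D (fun x => series (fun n => f n x) n) (series l n).
  by apply: has_integral_sum.
have mS n : measurable_fun D (fun x : measurableTypeR R => (series (fun n => f n x) n)%:E).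
  by have [/measurable_int] := fS n.
have EF x : D x -> (series (fun n => f n x) n)%:E @[n --> \oo] --> (g x)%:E.
  by move=> Dx; apply: cvg_EFin; [exact: nearW|exact: fg].
have E : (\int[mu]_(x in D) (g x)%:E)%E = (limn (series l))%:E.
  transitivity (limn (fun n => \int[mu]_(x in D) (series (fun n => f n x) n)%:E)%E).
    rewrite -monotone_convergence//.
    - by apply: eq_integral => x; rewrite inE => Dx; apply/esym/cvg_lim => //; exact: EF.
    - move=> n x Dx; rewrite lee_fin; apply: sumr_ge0 => i _; exact: f0.
    - move=> x Dx n m nm; rewrite lee_fin.
      by apply: nondecreasing_series nm => i _ _; exact: f0.
  apply: cvg_lim => //; under eq_fun do rewrite (has_integral_EFin mD (fS _)).
  by apply: cvg_EFin; [exact: nearW|exact: cl].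
apply: has_integralE => //; apply/integrableP; split.
  exact: emeasurable_fun_cvg mS EF.
rewrite (eq_integral (fun x : measurableTypeR R => (g x)%:E)); first by rewrite E ltry.
move=> x; rewrite inE => Dx /=; rewrite ger0_norm//.
rewrite -(cvg_lim _ (fg _ Dx))//; apply: limr_ge.
  by apply/cvg_ex; eexists; exact: fg.
by apply: nearW => n; apply: sumr_ge0 => i _; exact: f0.
Qed.

(** By uniqueness it is enough to compare on half-open intervals, where reflection only moves the
    closed end. *)
Lemma lebesgue_measureN (A : set (measurableTypeR R)) : measurable A ->
  mu A = pushforward mu (-%R : measurableTypeR R -> measurableTypeR R) A.
Proof.
apply: lebesgue_measure_unique => X [[a b] /= _ <-].
rewrite /pushforward (_ : _ @^-1` _ = `[- b, - a[%classic); last first.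
  by apply/seteqP; split => x; rewrite /= !in_itv/= => /andP[]; rewrite ltrNr lerNl => -> ->.
rewrite lebesgue_measure_itv /= lebesgue_measure_itv /= !lte_fin ltrN2.
by case: ifP => // ab; rewrite -!EFinB opprK addrC.
Qed.

(** Change of variable x -> -x through the pushforward measure, applied to the integrand extended by
    0. *)
Lemma has_integral_reflect f l : has_integral `]0, +oo[%classic (fun x => f (- x)) l ->
  has_integral `]-oo, 0[%classic f l.
Proof.
move=> H; have mI : measurable (`]0, +oo[%classic : set (measurableTypeR R)) by [].
have mJ : measurable (`]-oo, 0[%classic : set (measurableTypeR R)) by [].
have El := has_integral_EFin mI H; case: H => fi _.
pose h : measurableTypeR R -> \bar R := (EFin \o f) \_ `]-oo, 0[%classic.
have hN : h \o -%R = (EFin \o (fun x => f (- x))) \_ `]0, +oo[%classic.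
  apply/funext => x; rewrite /h /= !patchE.
  have -> : (- x \in `]-oo, 0[%classic) = (x \in `]0, +oo[%classic) => //.
  by apply/idP/idP; rewrite !inE /= !in_itv /= ?andbT oppr_lt0.
have mh : measurable_fun setT h.
  have -> : h = (h \o -%R) \o -%R by apply/funext => x /=; rewrite opprK.
  apply: measurableT_comp; last exact: oppr_measurable.
  by rewrite hN; apply/(measurable_restrictT _ mI); exact: measurable_int fi.
have ih : mu.-integrable setT (h \o -%R) by rewrite hN; exact: (integrable_mkcond _ mI).1.
have Eh (k : R -> \bar R) : (\int[mu]_x k x = \int[pushforward mu (-%R : measurableTypeR R -> measurableTypeR R)]_x k x)%E.
  by apply: eq_measure_integral => A mA _; exact: lebesgue_measureN.
have mN : measurable_fun setT (-%R : measurableTypeR R -> measurableTypeR R) by exact: oppr_measurable.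
have ip := integrable_pushforward mN mh ih measurableT.
apply: has_integralE => //.
  apply/(integrable_mkcond _ mJ); apply/integrableP; split => //.
  by rewrite (Eh (fun x => `|h x|%E)); case/integrableP : ip.
by rewrite integral_mkcond -/h Eh integral_pushforward// hN -integral_mkcond.
Qed.

(** Nothing is asked at the null set {0}: there the integrand involves [Li 1], whose value
    [is_polylog] leaves free. *)
Lemma has_integral_line f l m : has_integral `]0, +oo[%classic f l ->
  has_integral `]0, +oo[%classic (fun x => f (- x)) m ->
  has_integral setT f (l + m).
Proof.
move=> H1 /has_integral_reflect H2.
have m1 : measurable (`]0, +oo[%classic : set (measurableTypeR R)) by [].
have m2 : measurable (`]-oo, 0[%classic : set (measurableTypeR R)) by [].
have m3 : measurable ([set 0] : set (measurableTypeR R)) by [].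
have m12 : measurable (`]-oo, 0[%classic `|` `]0, +oo[%classic : set R) by exact: measurableU.
have ST : [set: R] = [set 0] `|` (`]-oo, 0[%classic `|` `]0, +oo[%classic).
  apply/seteqP; split => // x _ /=; rewrite !in_itv/= andbT.
  by case: (ltrgtP x 0); [right;left|right;right|left].
have mf12 : measurable_fun (`]-oo, 0[%classic `|` `]0, +oo[%classic : set (measurableTypeR R)) f.
  apply/measurable_funU => //; split; apply/measurable_EFinP.
    by case: H2 => /measurable_int.
  by case: H1 => /measurable_int.
have mf : measurable_fun [set: measurableTypeR R] f.
  by rewrite ST; apply/measurable_funU => //; split => //; exact: measurable_fun_set1.
pose g x := (f \_ `]0, +oo[%classic) x + (f \_ `]-oo, 0[%classic) x.
have R1 : has_integral setT (f \_ `]0, +oo[%classic) l.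
  split; last by rewrite -Rintegral_mkcond; case: H1.
  by case: H1 => /(integrable_mkcond _ m1); rewrite restrict_EFin.
have R2 : has_integral setT (f \_ `]-oo, 0[%classic) m.
  split; last by rewrite -Rintegral_mkcond; case: H2.
  by case: H2 => /(integrable_mkcond _ m2); rewrite restrict_EFin.
have mT : measurable ([set: R] : set (measurableTypeR R)) by exact: measurableT.
have Hg : has_integral setT g (l + m) by exact: has_integralD.
have ae : ae_eq mu setT (EFin \o f) (EFin \o g).
  exists [set 0]; split => //; first exact: lebesgue_measure_set1.
  move=> x /= H; apply: contrapT => x0; apply: H => _; congr EFin; rewrite /g !patchE.
  have [xn|xp|/x0//] := ltrgtP x 0.
    by rewrite ifN ?ifT ?add0r// ?inE ?notin_setE /= in_itv /= ?andbT// ltNge (ltW xn).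
  by rewrite ifT ?ifN ?addr0// ?inE ?notin_setE /= in_itv /= ?andbT// ltNge (ltW xp).
have mg := measurable_int _ Hg.1.
apply: has_integralE => //; last first.
  by rewrite -(has_integral_EFin mT Hg); apply: ae_eq_integral => //; exact/measurable_EFinP.
apply/integrableP; split; first exact/measurable_EFinP.
have /integrableP[_] := Hg.1; apply: le_lt_trans; rewrite le_eqVlt; apply/orP; left; apply/eqP.
apply: ae_eq_integral => //; [exact/measurableT_comp/measurable_EFinP|exact: measurableT_comp|].
exact: (ae_eq_abse ae).
Qed.

End HasIntegral.

(** * Fermi integrals *)

Section GammaIntegrals.
Variable R : realType.
Notation mu := (@lebesgue_measure R).
Let I : set (measurableTypeR R) := `]0, +oo[%classic.
Let mI : measurable I. Proof. exact: measurable_itv. Qed.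
Implicit Types (c b x : R) (p : nat).

(** The exponential dominates its Taylor term of order p + 1, which bounds the product by a constant
    over x. *)
Lemma cvg_monomial_expR p c : 0 < c -> x ^+ p * expR (- (c * x)) @[x --> +oo] --> (0 : R).
Proof.
move=> c0.
have H : (p.+1`!%:R / c ^+ p.+1) * x^-1 @[x --> +oo] --> (p.+1`!%:R / c ^+ p.+1) * (0 : R).
  apply: cvgM; first exact: cvg_cst.
  by apply/(@gtr0_cvgV0 _ _ _ _ (@id R)); [exact: nbhs_pinfty_gt|exact: cvg_id].
rewrite mulr0 in H; apply: (@squeeze_cvgr _ _ _ _ (fun=> 0) _ _ _ _ _ H); last exact: cvg_cst.
near=> x; have x0 : 0 < x by [].
have x0' := ltW x0; apply/andP; split; first by rewrite mulr_ge0 ?exprn_ge0 ?expR_ge0.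
rewrite expRN.
rewrite ler_pdivrMr ?expR_gt0//.
have cx : 0 <= c * x by rewrite mulr_ge0// ltW.
have := expR_ge1Dxn p cx; rewrite -lerBrDl => /le_trans.
move=> /(_ (expR (c * x))); rewrite gerBl ler01 => /(_ isT) E.
rewrite -[leLHS](_ : p.+1`!%:R / c ^+ p.+1 / x * ((c * x) ^+ p.+1 / p.+1`!%:R) = _).
  by rewrite ler_wpM2l// !mulr_ge0 ?invr_ge0 ?exprn_ge0// ltW.
rewrite exprMn [x ^+ p.+1]exprS; field.
by rewrite !gt_eqF ?exprn_gt0// ltr0n fact_gt0.
Unshelve. all: by end_near. Qed.

(* Repeated integration by parts of x^p exp(-c x). *)
Fixpoint exp_primitive c p x : R :=
  if p is p'.+1 then - (x ^+ p * expR (- (c * x)) / c) + p%:R / c * exp_primitive c p' x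
  else - (expR (- (c * x)) / c).

Lemma is_derive_expRNc c x : is_derive x 1 (fun y => expR (- (c * y))) (- c * expR (- (c * x))).
Proof.
have D : is_derive x 1 (fun y => - (c * y)) (- (c * 1)) by exact: is_deriveN_fun (is_deriveZ_fun c (is_derive_id x (1 : R))).
by apply: (is_derive_congr (is_derive_comp D (is_derive_expR _))); rewrite mulr1 mulrC.
Qed.

Lemma is_derive_exp_primitive c p x : 0 < c ->
  is_derive x 1 (exp_primitive c p) (x ^+ p * expR (- (c * x))).
Proof.
move=> c0; elim: p => [|p IH] /=.
  have := is_deriveN_fun (is_deriveZ_fun c^-1 (is_derive_expRNc c x)).
  rewrite mulNr mulrN opprK mulKf ?gt_eqF// expr0 mul1r.
  by under eq_fun do rewrite mulrC.
have D1 := is_deriveM_fun (is_deriveX_fun p.+1 (is_derive_id x (1 : R))) (is_derive_expRNc c x).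
have D2 := is_deriveN_fun (is_deriveZ_fun c^-1 D1).
have := is_deriveD_fun D2 (is_deriveZ_fun (p.+1%:R / c) IH).
under eq_fun do rewrite [c^-1 * _]mulrC.
move=> H; apply: (is_derive_congr H) => /=; rewrite mulr1 exprS; field.
by rewrite gt_eqF.
Qed.

Lemma exp_primitive0 c p : 0 < c -> exp_primitive c p 0 = - (p`!%:R / c ^+ p.+1).
Proof.
move=> c0; elim: p => [|p IH] /=.
  by rewrite mulr0 oppr0 expR0 fact0 expr1.
rewrite IH expr0n !mul0r oppr0 add0r factS natrM !exprS; field.
by rewrite ?gt_eqF// exprn_gt0.
Qed.

Lemma cvg_exp_primitive c p : 0 < c -> exp_primitive c p x @[x --> +oo] --> (0 : R).
Proof.
move=> c0; elim: p => [|p IH] /=.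
  have H : - (x ^+ 0 * expR (- (c * x)) / c) @[x --> +oo] --> - ((0 : R) / c).
    by apply: cvgN; apply: cvgM; [exact: cvg_monomial_expR|exact: cvg_cst].
  rewrite mul0r oppr0 in H; apply: cvg_trans H; apply: near_eq_cvg; apply: nearW => x.
  by rewrite expr0 mul1r.
have H : - (x ^+ p.+1 * expR (- (c * x)) / c) + p.+1%:R / c * exp_primitive c p x @[x --> +oo] -->
   - ((0 : R) / c) + p.+1%:R / c * 0.
  apply: cvgD; first by apply: cvgN; apply: cvgM; [exact: cvg_monomial_expR|exact: cvg_cst].
  by apply: cvgM => //; exact: cvg_cst.
by rewrite mul0r oppr0 mulr0 addr0 in H.
Qed.

Lemma has_integral_monomial_expR p c : 0 < c ->
  has_integral I (fun x => x ^+ p * expR (- (c * x))) (p`!%:R / c ^+ p.+1).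
Proof.
move=> c0; pose f x := x ^+ p * expR (- (c * x)).
have cf : continuous f.
  move=> x; apply: cvgM; first exact: exprn_continuous.
  exact: (is_derive_continuous (is_derive_expRNc c x)).
have f0 x : 0 <= x -> 0 <= f x by move=> x0; rewrite mulr_ge0 ?exprn_ge0 ?expR_ge0.
have D x := is_derive_exp_primitive p x c0.
have mf : measurable_fun I f by apply: measurable_funTS; exact: continuous_measurable_fun.
have E : (\int[mu]_(x in I) (f x)%:E = (p`!%:R / c ^+ p.+1)%:E)%E.
  rewrite /I integral_itv_obnd_cbnd; last exact/measurable_EFinP.
  rewrite (@ge0_continuous_FTC2y _ f (exp_primitive c p) 0 0)//.
  - by rewrite exp_primitive0// sub0e -EFinN opprK.
  - exact: continuous_subspaceT.
  - exact: cvg_exp_primitive.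
  - by apply: cvg_at_right_filter; exact: (is_derive_continuous (D 0)).
  - by move=> x _; exact: is_derive1E (D x).
apply: has_integralE => //; apply/integrableP; split; first exact/measurable_EFinP.
rewrite (eq_integral (fun x : measurableTypeR R => (f x)%:E)); first by rewrite E ltry.
move=> x; rewrite inE /I /= in_itv /= andbT => x0.
by rewrite ger0_norm// f0// ltW.
Qed.

Definition fermi p c b : R :=
  \int[mu]_(x in I) (x ^+ p * expR (- (c * x)) / (1 + expR (b * x))).

Lemma fermi_den_gt0 b x : 0 < 1 + expR (b * x).
Proof. by rewrite addr_gt0// expR_gt0. Qed.

Lemma has_integral_fermi p c b : 0 <= c -> 0 < b ->
  has_integral I (fun x => x ^+ p * expR (- (c * x)) / (1 + expR (b * x))) (fermi p c b).
Proof.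
move=> c0 b0; apply: (has_integral_dominated mI _ (has_integral_monomial_expR p b0)).
  apply: measurable_funTS; apply: continuous_measurable_fun => x.
  apply: cvgM; first apply: cvgM; first exact: exprn_continuous.
    exact: (is_derive_continuous (is_derive_expRNc c x)).
  apply: cvgV; first by rewrite gt_eqF// fermi_den_gt0.
  apply: cvgD; first exact: cvg_cst.
  exact: (is_derive_continuous (is_derive_comp (is_deriveZ_fun b (is_derive_id x (1 : R))) (is_derive_expR _))).
move=> x; rewrite /I /= in_itv /= andbT => x0.
have xp : 0 <= x ^+ p by rewrite exprn_ge0// ltW.
rewrite ger0_norm; last by rewrite !mulr_ge0 ?invr_ge0 ?expR_ge0// ltW// fermi_den_gt0.
rewrite -mulrA ler_wpM2l// -[leRHS]mul1r.
apply: ler_pM; rewrite ?invr_ge0 ?expR_ge0 ?(ltW (fermi_den_gt0 _ _))//.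
  by rewrite expR_le1 oppr_le0 mulr_ge0// ltW.
by rewrite expRN lef_pV2 ?posrE ?fermi_den_gt0 ?expR_gt0// lerDr.
Qed.

Lemma fermi_ge0 p c b : 0 <= c -> 0 < b -> 0 <= fermi p c b.
Proof.
move=> c0 b0; apply: (has_integral_ge0 (has_integral_fermi p c0 b0)) => x.
rewrite /I /= in_itv /= andbT => x0.
by rewrite !mulr_ge0 ?invr_ge0 ?expR_ge0 ?exprn_ge0// ltW// fermi_den_gt0.
Qed.

(** The integrands for c and c + b add up to x^p e^{-(c+b)x}, because e^{-cx} + e^{-(c+b)x} =
    e^{-(c+b)x} (1 + e^{bx}). *)
Lemma fermi_shift p c b : 0 <= c -> 0 < b ->
  fermi p c b = p`!%:R / (c + b) ^+ p.+1 - fermi p (c + b) b.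
Proof.
move=> c0 b0; have cb0 : 0 < c + b by rewrite ltr_wpDl.
have H := has_integralB mI (has_integral_monomial_expR p cb0) (has_integral_fermi p (ltW cb0) b0).
rewrite -(proj2 H); apply: eq_Rintegral => x _.
have := fermi_den_gt0 b x; rewrite mulrDl opprD expRD [expR (- (b * x))]expRN => D.
by field; rewrite !gt_eqF ?expR_gt0.
Qed.

Lemma fermi_le p c b : 0 <= c -> 0 < b -> fermi p c b <= p`!%:R / (c + b) ^+ p.+1.
Proof. by move=> c0 b0; rewrite fermi_shift// gerBl fermi_ge0// ltW// ltr_wpDl. Qed.

Lemma fermi_partial_sum p c b N : 0 <= c -> 0 < b ->
  fermi p c b = \sum_(1 <= k < N.+1) (-1) ^+ k.+1 * (p`!%:R / (c + k%:R * b) ^+ p.+1)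
    + (-1) ^+ N * fermi p (c + N%:R * b) b.
Proof.
move=> c0 b0; elim: N => [|N IH]; first by rewrite big_geq// mul0r addr0 mul1r add0r.
rewrite big_nat_recr//= {}IH fermi_shift//; last by rewrite addr_ge0// mulr_ge0// ltW.
by rewrite -(natr1 N) mulrDl mul1r addrA !exprS; ring.
Qed.

(** The remainder after N shifts is at most p! / (c + (N+1) b)^(p+1), hence at most a constant over
    N + 1, even for c = 0 and p = 0. *)
Lemma cvg_fermi p c b : 0 <= c -> 0 < b ->
  \sum_(1 <= k < N) (-1) ^+ k.+1 * (p`!%:R / (c + k%:R * b) ^+ p.+1) @[N --> \oo] --> fermi p c b.
Proof.
move=> c0 b0; set s := fun N => _.
suff : [sequence s N.+1]_N @ \oo --> fermi p c b by rewrite cvg_shiftS.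
have H : p`!%:R / b ^+ p.+1 * harmonic N @[N --> \oo] --> p`!%:R / b ^+ p.+1 * (0 : R).
  by apply: cvgM; [exact: cvg_cst|exact: cvg_harmonic].
rewrite mulr0 in H.
apply/cvgrPdist_lt => e e0; move/cvgrPdist_lt : H => /(_ _ e0); apply: filterS => N /=.
rewrite sub0r normrN; apply: le_lt_trans.
rewrite (fermi_partial_sum p N c0 b0) addrAC subrr add0r normrM normrX normrN1 expr1n mul1r.
have cN : 0 <= c + N%:R * b by rewrite addr_ge0// mulr_ge0// ltW.
rewrite ger0_norm ?fermi_ge0// (le_trans (fermi_le p cN b0))// (le_trans _ (ler_norm _))//.
rewrite -mulrA ler_wpM2l// -invfM lef_pV2 ?posrE ?mulr_gt0 ?exprn_gt0// ?ltr_wpDl//.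
apply: (@le_trans _ _ ((N.+1%:R * b) ^+ p.+1)).
  rewrite exprMn [leRHS]mulrC ler_wpM2l ?exprn_ge0 ?(ltW b0)//.
  by rewrite exprS ler_peMr// exprn_ege1// ler1n.
have bb := ltW b0; apply: lerXn2r; rewrite ?nnegrE ?mulr_ge0 ?addr_ge0 ?mulr_ge0//.
by rewrite -natr1 mulrDl mul1r -addrA lerDr.
Qed.

Lemma eta_fermi p b : 0 < b -> fermi p 0 b = p`!%:R / b ^+ p.+1 * eta R p.+1.
Proof.
move=> b0; have := @cvg_fermi p 0 b (lexx 0) b0; set K := p`!%:R / b ^+ p.+1.
have nz : K != 0 by rewrite mulf_neq0// ?invr_neq0 ?expf_neq0 ?gt_eqF// ltr0n fact_gt0.
rewrite (_ : (fun N => _) = fun N => K * \sum_(1 <= k < N) (-1) ^+ k.+1 / k%:R ^+ p.+1); last first.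
  apply/funext => N; rewrite mulr_sumr; apply: eq_bigr => k _.
  by rewrite add0r exprMn invfM /K; ring.
move=> H; have H2 : K^-1 * (K * \sum_(1 <= k < N) (-1) ^+ k.+1 / k%:R ^+ p.+1) @[N --> \oo] --> K^-1 * fermi p 0 b.
  by apply: cvgM => //; exact: cvg_cst.
suff -> : eta R p.+1 = K^-1 * fermi p 0 b by rewrite mulVKf.
rewrite /eta /rsum; apply: cvg_lim => //; apply: cvg_trans H2; apply: near_eq_cvg.
by apply: nearW => N; rewrite mulKf.
Qed.

End GammaIntegrals.

(** * Termwise integration of the polylogarithm series *)

Section PolylogIntegrals.
Variable R : realType.
Let I : set (measurableTypeR R) := `]0, +oo[%classic.
Let mI : measurable I. Proof. exact: measurable_itv. Qed.
Variables (p t : nat) (a : R).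
Hypotheses (t_gt0 : (0 < t)%N) (a_gt0 : 0 < a).

Let zt n : R := n%:R^-1 ^+ t.
Let z0 : zt 0 = 0. Proof. by rewrite /zt invr0 expr0n gtn_eqF. Qed.

Lemma rpolylog_expR_series (x : R) : 0 < x ->
  series (fun n => zt n * expR (- (n%:R * a * x))) @ \oo --> rpolylog t (expR (- (a * x))).
Proof.
move=> x0; have e1 : `|expR (- (a * x))| < 1.
  by rewrite ger0_norm ?expR_ge0// expR_lt1 oppr_lt0 mulr_gt0.
have := @cvg_rpolylog R t _ e1; rewrite /pseries.
rewrite (_ : (fun i => _ * _ ^+ i) = (fun n => zt n * expR (- (n%:R * a * x))))//.
by apply/funext => n; rewrite -expRM_natl -mulrA mulrN.
Qed.

Let wz n : R := p`!%:R / a ^+ p.+1 * n%:R^-1 ^+ (p + t + 1).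

Lemma cvg_wz : series wz @ \oo --> p`!%:R / a ^+ p.+1 * zeta R (p + t + 1).
Proof.
have pt : (1 < p + t + 1)%N by rewrite addn1 ltnS addn_gt0 t_gt0 orbT.
rewrite zetaE// (_ : series wz = (fun n => p`!%:R / a ^+ p.+1 * series (fun n => n%:R^-1 ^+ (p + t + 1) : R) n)).
  by apply: cvgM; [exact: cvg_cst|exact: is_cvg_inv_powers].
by apply/funext => n; rewrite /series /= mulr_sumr.
Qed.

Lemma wzE n : wz n = zt n * (p`!%:R / (n%:R * a) ^+ p.+1).
Proof.
rewrite /wz /zt; case: n => [|n].
  by rewrite invr0 !expr0n addn1 (gtn_eqF t_gt0) mulr0 mul0r.
have : n.+1%:R != 0 :> R by [].
move: (n.+1%:R : R) => N N0; rewrite exprMn !exprD expr1 !exprVn !exprS.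
have a0 : a != 0 by rewrite gt_eqF.
by field; rewrite ?expf_neq0 ?N0 ?a0.
Qed.

Lemma has_integral_rpolylog :
  has_integral I (fun x => x ^+ p * rpolylog t (expR (- (a * x)))) (p`!%:R / a ^+ p.+1 * zeta R (p + t + 1)).
Proof.
rewrite -(cvg_lim (@Rhausdorff R) cvg_wz).
apply: (has_integral_series (f := fun n x => zt n * (x ^+ p * expR (- (n%:R * a * x))))) => //.
(* For n = 0 the exponential is 1 and x^p alone is not integrable; the weight [zt 0 = 0] saves the
   term. *)
- case=> [|n].
    have -> : wz 0 = 0 by rewrite wzE z0 mul0r.
    by apply: has_integral_eq mI _ (has_integral0 mI) => x _; rewrite z0 mul0r.
  by rewrite wzE; apply: has_integralZ => //; apply: has_integral_monomial_expR; rewrite mulr_gt0.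
- move=> n x; rewrite /I /= in_itv /= andbT => x0.
  by rewrite !mulr_ge0 ?exprn_ge0 ?expR_ge0// ltW.
- move=> x; rewrite /I /= in_itv /= andbT => x0.
  rewrite (_ : series _ = (fun n => x ^+ p * series (fun n => zt n * expR (- (n%:R * a * x))) n)).
    by apply: cvgM; [exact: cvg_cst|exact: rpolylog_expR_series].
  by apply/funext => n; rewrite /series /= mulr_sumr; apply: eq_bigr => i _; rewrite mulrCA.
- by apply/cvg_ex; eexists; exact: cvg_wz.
Qed.

(** The bound [fermi_le] gives p! / (na + b)^(p+1) <= p! / (na)^(p+1), so the terms lie below those
    of the series for zeta(p+t+1), which converges also for t = 1 and p = 0. *)
Lemma is_cvg_fermi_series (b : R) : 0 < b ->
  cvgn (series (fun n => zt n * fermi p (n%:R * a) b)).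
Proof.
move=> b0; have c : cvgn (series wz) by apply/cvg_ex; eexists; exact: cvg_wz.
have na n : 0 <= n%:R * a by rewrite mulr_ge0// ltW.
apply: series_le_cvg c => n.
- by rewrite mulr_ge0 ?exprn_ge0// fermi_ge0.
- by rewrite mulr_ge0 ?exprn_ge0// mulr_ge0// invr_ge0 exprn_ge0// ltW.
rewrite wzE; case: n => [|n]; first by rewrite z0 !mul0r.
rewrite ler_wpM2l ?exprn_ge0// (le_trans (fermi_le p (na _) b0))// ler_wpM2l//.
have n0 : 0 < n.+1%:R * a by rewrite mulr_gt0.
by rewrite lef_pV2 ?posrE ?exprn_gt0// ?addr_gt0// lerXn2r ?nnegrE ?ltW ?addr_gt0// ltrDl.
Qed.

Lemma has_integral_rpolylog_fermi (b : R) : 0 < b ->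
  has_integral I (fun x => x ^+ p * rpolylog t (expR (- (a * x))) / (1 + expR (b * x)))
    (limn (series (fun n => zt n * fermi p (n%:R * a) b))).
Proof.
move=> b0; apply: (has_integral_series (f := fun n x => zt n * (x ^+ p * expR (- (n%:R * a * x)) / (1 + expR (b * x))))) => //.
- by move=> n; apply: has_integralZ => //; apply: has_integral_fermi => //; rewrite mulr_ge0// ltW.
- move=> n x; rewrite /I /= in_itv /= andbT => x0.
  by rewrite !mulr_ge0 ?invr_ge0 ?exprn_ge0 ?expR_ge0// ltW// fermi_den_gt0.
- move=> x; rewrite /I /= in_itv /= andbT => x0.
  rewrite (_ : series _ = (fun n => x ^+ p * series (fun n => zt n * expR (- (n%:R * a * x))) n / (1 + expR (b * x)))).
    apply: cvgM; last exact: cvg_cst.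
    by apply: cvgM; [exact: cvg_cst|exact: rpolylog_expR_series].
  by apply/funext => n; rewrite /series /= mulr_sumr mulr_suml; apply: eq_bigr => i _; rewrite mulrA mulrCA.
- exact: is_cvg_fermi_series.
Qed.

End PolylogIntegrals.

(** * Gauss's product for the Gamma function *)

Section DerivativeOfLimit.
Variable R : realType.

(* The uniform Lipschitz bound on the derivatives replaces the usual locally
   uniform convergence. *)
Lemma derive_of_limit (L D : nat -> R -> R) (l : R -> R) (x d r C : R) : 0 < r ->
  (forall n y, `|y - x| < r -> is_derive y 1 (L n) (D n y)) ->
  (forall n y, `|y - x| < r -> `|D n y - D n x| <= C * `|y - x|) ->
  (forall y, `|y - x| < r -> L n y @[n --> \oo] --> l y) ->
  D n x @[n --> \oo] --> d -> is_derive x 1 l d.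
Proof.
move=> r0 dL lipD Ll Dd.
have C0 : 0 <= C.
  have y0 : `|(x + r / 2) - x| < r by rewrite addrAC subrr add0r ger0_norm; lra.
  have := le_trans (normr_ge0 _) (lipD 0%N _ y0).
  by rewrite addrAC subrr add0r ger0_norm; [rewrite pmulr_lge0; lra|lra].
(* First-order Taylor estimate with a constant independent of n, by the mean value theorem for z ->
   L n z - z D n x; it then survives the limit in n. *)
have T n y : `|y - x| < r -> `|L n y - L n x - (y - x) * D n x| <= C * `|y - x| ^+ 2.
  move=> yr; pose f z := L n z - z * D n x.
  have df z : `|z - x| < r -> is_derive z 1 f (D n z - D n x).
    move=> zr; have := is_deriveB_fun (dL n z zr) (is_deriveM_fun (is_derive_id z (1 : R)) (is_derive_cst (D n x) z (1 : R))).
    by rewrite mul1r mulr0 addr0.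
  have E : L n y - L n x - (y - x) * D n x = f y - f x by rewrite /f; ring.
  have key a b : a <= b -> `|a - x| < r -> `|b - x| < r -> (a = x \/ b = x) ->
      `|f b - f a| <= C * `|b - a| ^+ 2.
    move=> ab ar br abx.
    have zr z : a <= z <= b -> `|z - x| < r /\ `|z - x| <= `|b - a|.
      move=> /andP[az zb]; rewrite [`|b - a|]ger0_norm ?subr_ge0//.
      move: ar br; rewrite !ltr_norml => /andP[a1 a2] /andP[b1 b2].
      split; [by apply/andP; split; lra|rewrite ler_norml].
      by case: abx => e; rewrite -e; apply/andP; split; lra.
    have [c] := @MVT_segment R f (fun z => D n z - D n x) a b ab
      (fun z zab => df z (proj1 (zr z (introT andP (conj (ltW (proj1 (andP zab))) (ltW (proj2 (andP zab))))))))
      (continuous_in_subspaceT (fun z zab => is_derive_continuous (df z (proj1 (zr z (set_mem zab)))))).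
    rewrite in_itv /= => cab ->; have [cr1 cr2] := zr c cab.
    rewrite normrM expr2 mulrA ler_wpM2r// (le_trans (lipD n c cr1))// ler_wpM2l//.
  rewrite E; have xr : `|x - x| < r by rewrite subrr normr0.
  have [xy|/ltW yx] := leP x y; first by apply: key => //; left.
  by rewrite distrC [`|y - x|]distrC; apply: key => //; right.
have Tl y : `|y - x| < r -> `|l y - l x - (y - x) * d| <= C * `|y - x| ^+ 2.
  move=> yr; have xr : `|x - x| < r by rewrite subrr normr0.
  have H : `|L n y - L n x - (y - x) * D n x| @[n --> \oo] --> `|l y - l x - (y - x) * d|.
    apply: cvg_norm; apply: cvgB; first by apply: cvgB; exact: Ll.
    by apply: cvgM; [exact: cvg_cst|exact: Dd].
  rewrite -(cvg_lim _ H)//; apply: limr_le; first by apply/cvg_ex; eexists; exact: H.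
  by apply: nearW => n; exact: T.
have H : h^-1 *: (l (h *: 1 + x) - l x) @[h --> 0^'] --> d.
  apply/cvgrPdist_le => e e0.
  have C1 : 0 < C + 1 by rewrite ltr_wpDl.
  near=> h.
  have h0 : h != 0 by near: h; exact: nbhs_dnbhs_neq.
  have hr : `|h| < r by near: h; apply: dnbhs0_lt.
  have he : `|h| < e / (C + 1) by near: h; apply: dnbhs0_lt; rewrite divr_gt0.
  rewrite /GRing.scale /= mulr1 distrC.
  have hx : h + x - x = h by rewrite addrK.
  have := Tl (h + x); rewrite hx => /(_ hr) B.
  rewrite -(ler_pM2l (_ : 0 < `|h|)) ?normr_gt0// -normrM mulrBr mulVKf//.
  apply: le_trans B _; rewrite expr2 mulrCA ler_wpM2l//.
  apply: le_trans (_ : (C + 1) * `|h| <= _); first by rewrite ler_wpM2r// lerDl.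
  by rewrite mulrC -ler_pdivlMr// ltW.
apply: DeriveDef; first by apply/cvg_ex; exists d; exact: H.
exact: cvg_lim H.
Unshelve. all: by end_near. Qed.

Lemma ler_distX (u v : R) k : 0 <= u <= 1 -> 0 <= v <= 1 -> `|u ^+ k - v ^+ k| <= k%:R * `|u - v|.
Proof.
move=> /andP[u0 u1] /andP[v0 v1]; elim: k => [|k IH]; first by rewrite subrr normr0 mul0r.
rewrite !exprS (_ : _ - _ = u * (u ^+ k - v ^+ k) + (u - v) * v ^+ k); last by ring.
rewrite (le_trans (ler_normD _ _))// !normrM -natr1 mulrDl mul1r lerD//.
  by rewrite (ger0_norm u0) (le_trans _ IH)// ler_piMl.
by rewrite ler_piMr// normrX (ger0_norm v0) exprn_ile1.
Qed.

End DerivativeOfLimit.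

Lemma cvgX_fun (R : realType) (T : Type) (F : set_system T) {FF : Filter F} (f : T -> R) (l : R) k :
  f @ F --> l -> f x ^+ k @[x --> F] --> l ^+ k.
Proof.
move=> fl; elim: k => [|k IH]; first exact: cvg_cst.
rewrite exprS (_ : (fun x => _) = (fun x => f x * f x ^+ k)); first exact: cvgM.
by apply/funext => x; rewrite exprS.
Qed.

Section GaussLimit.
Variable R : realType.
Notation mu := (@lebesgue_measure R).
Let I : set (measurableTypeR R) := `]0, +oo[%classic.
Let mI : measurable I. Proof. exact: measurable_itv. Qed.

(* Repeated integration by parts of u^(s-1) (1 - u/N)^k. *)
Fixpoint beta_primitive (N : R) k s u : R :=
  if k is k'.+1 then
    u `^ s * (1 - u / N) ^+ k / s + k%:R / (N * s) * beta_primitive N k' (s + 1) u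
  else u `^ s / s.

Lemma is_derive_beta_primitive (N : R) k (s u : R) : 0 < N -> 0 < s -> 0 < u ->
  is_derive u 1 (beta_primitive N k s) (u `^ (s - 1) * (1 - u / N) ^+ k).
Proof.
move=> N0; elim: k s => [|k IH] s s0 u0 /=.
  have := is_deriveM_fun (is_derive1_powR s u0) (is_derive_cst s^-1 u (1 : R)).
  by move=> H; apply: (is_derive_congr H); rewrite /cst expr0; field; rewrite gt_eqF.
have s1 : 0 < s + 1 by rewrite addr_gt0.
have D1 : is_derive u 1 (fun y => 1 - y / N) (- N^-1).
  have := is_deriveB_fun (is_derive_cst (1 : R) u (1 : R)) (is_deriveM_fun (is_derive_id u (1 : R)) (is_derive_cst N^-1 u (1 : R))).
  by rewrite mul1r mulr0 addr0 sub0r.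
have D2 := is_deriveM_fun (is_deriveM_fun (is_derive1_powR s u0) (is_deriveX_fun k.+1 D1)) (is_derive_cst s^-1 u (1 : R)).
apply: (is_derive_congr (is_deriveD_fun D2 (is_deriveZ_fun (k.+1%:R / (N * s)) (IH _ s1 u0)))).
rewrite addrK /cst /= mulr0 addr0 exprS; field.
by rewrite !gt_eqF.
Qed.

Lemma beta_primitive_at0 (N : R) k s : 0 < s ->
  beta_primitive N k s 0 = 0 /\ beta_primitive N k s u @[u --> 0^'+] --> (0 : R).
Proof.
elim: k s => [|k IH] s s0 /=.
  split; first by rewrite powR0 ?gt_eqF// mul0r.
  rewrite -[X in _ --> X](mul0r s^-1); apply: cvgM; [exact: powR_cvg0|exact: cvg_cst].
have s1 : 0 < s + 1 by rewrite addr_gt0.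
have [E C] := IH _ s1; split; first by rewrite E powR0 ?gt_eqF// !mul0r mulr0 addr0.
have H : u `^ s * (1 - u / N) ^+ k.+1 / s + k.+1%:R / (N * s) * beta_primitive N k (s + 1) u @[u --> 0^'+]
  --> (0 : R) * (1 - 0 / N) ^+ k.+1 / s + k.+1%:R / (N * s) * 0.
  apply: cvgD; last by apply: cvgM => //; exact: cvg_cst.
  apply: cvgM; last exact: cvg_cst; apply: cvgM; first exact: powR_cvg0.
  apply: cvgX_fun.
  apply: cvgB; first exact: cvg_cst.
  by apply: cvg_at_right_filter; apply: cvgM; [exact: cvg_id|exact: cvg_cst].
by rewrite !mul0r mulr0 addr0 in H.
Qed.

Lemma beta_primitive_end (N : R) k s : 0 < N -> 0 < s ->
  beta_primitive N k s N = N `^ s * k`!%:R / \prod_(0 <= j < k.+1) (s + j%:R).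
Proof.
move=> N0; elim: k s => [|k IH] s s0 /=.
  by rewrite big_nat1 addr0 mulr1.
have s1 : 0 < s + 1 by rewrite addr_gt0.
rewrite divff ?gt_eqF// subrr expr0n mulr0 mul0r add0r IH//.
rewrite [in RHS]big_nat_recl// addr0.
rewrite (eq_bigr (fun j => s + j.+1%:R)); last by move=> j _; rewrite -natr1; ring.
rewrite powRD; last by rewrite gt_eqF ?implybT// gt_eqF.
rewrite powRr1 ?ltW// factS natrM; field.
rewrite !gt_eqF//; rewrite big_mkord; apply: prodr_gt0 => j _.
by rewrite addr_gt0.
Qed.

(** The condition 1 < s makes the integrand continuous at 0, as the fundamental theorem on a closed
    interval requires; digamma is only met at x + 1 with x > 0. *)
Lemma integral_beta (N : R) k s : 0 < N -> 1 < s ->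
  (\int[mu]_(u in `[0%R, N]) (u `^ (s - 1) * (1 - u / N) ^+ k)%:E =
   (N `^ s * k`!%:R / \prod_(0 <= j < k.+1) (s + j%:R))%:E)%E.
Proof.
move=> N0 s1; have s0 : 0 < s by rewrite (lt_trans ltr01).
have s10 : 0 < s - 1 by rewrite subr_gt0.
have D u (u0 : 0 < u) := is_derive_beta_primitive k N0 s0 u0.
have pc : continuous (fun u : R => (1 - u / N) ^+ k).
  move=> u; apply: cvgX_fun.
  apply: cvgB; first exact: cvg_cst.
  by apply: cvgM; [exact: cvg_id|exact: cvg_cst].
have cp (u : R) : 0 < u -> (fun u => u `^ (s - 1) * (1 - u / N) ^+ k) @ u --> u `^ (s - 1) * (1 - u / N) ^+ k.
  move=> u0; apply: cvgM; last exact: pc.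
  exact: (is_derive_continuous (is_derive1_powR (s - 1) u0)).
have [E0 C0] := beta_primitive_at0 N k s0.
rewrite (@continuous_FTC2 _ _ (beta_primitive N k s))//.
- by rewrite E0 sube0 beta_primitive_end.
- apply/continuous_within_itvP => //; split.
  + by move=> u; rewrite in_itv /= => /andP[u0 _]; exact: cp.
  + rewrite powR0 ?gt_eqF// mul0r -[X in _ --> X](mul0r ((1 - 0 / N) ^+ k)).
    by apply: cvgM; [exact: powR_cvg0|apply: cvg_at_right_filter; exact: pc].
  + by apply: cvg_at_left_filter; exact: cp.
- split.
  + by move=> u; rewrite in_itv /= => /andP[u0 _]; have [] := D u u0.
  + by rewrite E0.
  + by apply: cvg_at_left_filter; exact: (is_derive_continuous (D N N0)).
- by move=> u; rewrite in_itv /= => /andP[u0 _]; exact: is_derive1E (D u u0).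
Qed.

(** Two uses of 1 + v <= e^v squeeze the power, with N = n + 1, between exp(- u / (1 - u/N)) and
    exp(- u). *)
Lemma cvg_one_sub_div_pow (u : R) : 0 < u -> (1 - u / n.+1%:R) ^+ n.+1 @[n --> \oo] --> expR (- u).
Proof.
move=> u0.
have H0 : 1 - u * harmonic n @[n --> \oo] --> 1 - u * (0 : R).
  by apply: cvgB; [exact: cvg_cst|apply: cvgM; [exact: cvg_cst|exact: cvg_harmonic]].
rewrite mulr0 subr0 in H0.
have H : expR (- (u / (1 - u * harmonic n))) @[n --> \oo] --> expR (- u).
  apply: continuous_cvg; first exact: continuous_expR.
  apply: cvgN; rewrite -[X in _ --> X]divr1; apply: cvgM; first exact: cvg_cst.
  by apply: cvgV => //; exact: oner_neq0.
apply: (@squeeze_cvgr _ _ _ _ (fun n => expR (- (u / (1 - u * harmonic n)))) (fun=> expR (- u))) => //; last exact: cvg_cst.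
near=> n.
have N0 : 0 < n.+1%:R :> R by [].
have d0 : 0 < 1 - u / n.+1%:R by near: n; exact: (cvgr_gt (1 : R) H0 _ ltr01).
apply/andP; split.
  have -> : - (u / (1 - u * harmonic n)) = n.+1%:R * - (u / n.+1%:R / (1 - u / n.+1%:R)).
    by rewrite /harmonic /=; field; rewrite !gt_eqF// ; rewrite -(pmulr_lgt0 _ N0) mulrBl divfK ?gt_eqF// mul1r in d0; lra.
  rewrite expRM_natl lerXn2r ?nnegrE ?expR_ge0 ?(ltW d0)// expRN.
  rewrite -[leRHS]invrK lef_pV2 ?posrE ?invr_gt0 ?expR_gt0//.
  apply: le_trans (expR_ge1Dx _); rewrite le_eqVlt; apply/orP; left; apply/eqP.
  by field; rewrite !gt_eqF// ; rewrite -(pmulr_lgt0 _ N0) mulrBl divfK ?gt_eqF// mul1r in d0; lra.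
have -> : - u = n.+1%:R * - (u / n.+1%:R) by field; rewrite gt_eqF.
by rewrite expRM_natl lerXn2r ?nnegrE ?expR_ge0 ?(ltW d0)// expR_ge1Dx.
Unshelve. all: by end_near. Qed.

Definition gauss_product (s : R) n : R :=
  n.+1%:R `^ s * n.+1`!%:R / \prod_(0 <= j < n.+2) (s + j%:R).

(** Trades the real exponent for an integer one, so that the dominating function is a sum of
    monomials times e^{-u}, whose integrals are known. *)
Lemma powR_le_1D (r : R) : 0 <= r -> exists M : nat, forall v : R, 0 < v -> v `^ r <= 1 + v ^+ M.
Proof.
move=> r0; have rM : r <= (Num.bound r)%:R by apply/ltW/archi_boundP.
exists (Num.bound r) => v v0; have [v1|/ltW v1] := leP 1 v.
  rewrite -(powR_mulrn _ (ltW v0)); apply: (le_trans (ler_powR v1 rM)).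
  by rewrite lerDr.
apply: (@le_trans _ _ 1); last by rewrite lerDl exprn_ge0// ltW.
by rewrite -(powRr0 v); apply: ger_powR => //; rewrite v0.
Qed.

(** With N = n + 1, the functions u^(s-1) (1 - u/N)^N on [0, N], extended by 0, are dominated by
    u^(s-1) e^{-u} and converge to it; their integrals are the products. The integrability of
    Euler's integrand is obtained on the way. *)
Lemma cvg_gauss_product (s : R) : 1 < s ->
  has_integral I (fun u => u `^ (s - 1) * expR (- u)) (Gamma s) /\
  gauss_product s n @[n --> \oo] --> Gamma s.
Proof.
move=> s1; have s0 : 0 <= s - 1 by rewrite subr_ge0 ltW.
have [M HM] := powR_le_1D s0.
pose h n u : R := u `^ (s - 1) * (1 - u / n.+1%:R) ^+ n.+1.
pose f_ n : measurableTypeR R -> \bar R := (EFin \o h n) \_ `[0, n.+1%:R]%classic.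
pose f : measurableTypeR R -> \bar R := fun u => (u `^ (s - 1) * expR (- u))%:E.
pose g : measurableTypeR R -> \bar R := fun u => (u ^+ 0 * expR (- (1 * u)) + u ^+ M * expR (- (1 * u)))%:E.
have mh n : measurable_fun [set: measurableTypeR R] (h n).
  apply: measurable_funM; first exact: measurable_powR.
  apply: continuous_measurable_fun => u; apply: cvgX_fun.
  by apply: cvgB; [exact: cvg_cst|apply: cvgM; [exact: cvg_id|exact: cvg_cst]].
have mitv n : measurable (`[0, n.+1%:R]%classic : set (measurableTypeR R)) by exact: measurable_itv.
have mf_ n : measurable_fun I (f_ n).
  apply: measurable_funTS; apply/(measurable_restrictT _ (mitv n)); apply: measurable_funTS.
  exact/measurable_EFinP.
have mf : measurable_fun I f.
  apply: measurable_funTS; apply/measurable_EFinP; apply: measurable_funM; first exact: measurable_powR.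
  by apply: continuous_measurable_fun => u; apply: continuous_cvg; [exact: continuous_expR|apply: cvgN; exact: cvg_id].
have ig : mu.-integrable I g.
  by have [] := has_integralD mI (has_integral_monomial_expR 0 ltr01) (has_integral_monomial_expR M ltr01).
have ff u : I u -> f_ ^~ u @ \oo --> f u.
  rewrite /I /= in_itv /= andbT => u0.
  have H : (h n u)%:E @[n --> \oo] --> f u.
    apply: cvg_EFin; first exact: nearW.
    by apply: cvgM; [exact: cvg_cst|exact: cvg_one_sub_div_pow].
  apply: cvg_trans H; apply: near_eq_cvg; near=> n.
  rewrite /f_ patchE ifT// inE /= in_itv /= ltW//= ltW//.
  near: n; have [k uk] : exists k : nat, u < k%:R by exists (Num.bound u); apply/archi_boundP/ltW.
  by exists k => // n /= kn; rewrite (lt_le_trans uk)// ler_nat (leq_trans kn).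
have fg u n : I u -> (`|f_ n u| <= g u)%E.
  rewrite /I /= in_itv /= andbT => u0.
  have e0 := expR_ge0 (- u).
  rewrite /f_ patchE; case: ifPn => [|_]; last first.
    by rewrite abse0 lee_fin mul1r addr_ge0// mulr_ge0// exprn_ge0// ltW.
  rewrite inE /= in_itv /= => /andP[_ un]; rewrite lee_fin /h mul1r -mulrDl expr0.
  have d0 : 0 <= 1 - u / n.+1%:R by rewrite subr_ge0 ler_pdivrMr// mul1r.
  rewrite ger0_norm ?mulr_ge0 ?powR_ge0 ?exprn_ge0//.
  apply: ler_pM; rewrite ?powR_ge0 ?exprn_ge0 ?HM//.
  have -> : - u = n.+1%:R * - (u / n.+1%:R) by field.
  by rewrite expRM_natl lerXn2r ?nnegrE ?expR_ge0// expR_ge1Dx.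
have [fi _ H] := dominated_convergence mI mf_ mf (aeW _ ff) ig (aeW _ fg).
have Hf : has_integral I (fun u => u `^ (s - 1) * expR (- u)) (Gamma s) by split.
split => //.
have E n : (\int[mu]_(x in I) f_ n x)%E = (gauss_product s n)%:E.
  rewrite /f_ -integral_mkcondr /gauss_product -integral_beta//.
  have -> : I `&` `[0, n.+1%:R]%classic = `]0, n.+1%:R]%classic.
    apply/seteqP; split => u; rewrite /I /= !in_itv /= ?andbT.
      by move=> [-> /andP[_ ->]].
    by move=> /andP[u0 un]; rewrite u0 ltW.
  apply: integral_itv_obnd_cbnd; apply: measurable_funTS; apply/measurable_EFinP; exact: mh.
move: H; rewrite /= (has_integral_EFin mI Hf).
by under [X in X @ _]eq_fun do rewrite E; move=> /fine_cvg.
Unshelve. all: by end_near. Qed.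

(** On [1, 2] the integrand is at least e^{-2}. *)
Lemma Gamma_gt0 (s : R) : 1 < s -> 0 < Gamma s.
Proof.
move=> s1; have [Hf _] := cvg_gauss_product s1.
have m12 : measurable (`[1, 2]%classic : set (measurableTypeR R)) by exact: measurable_itv.
have S12 : `[1, 2]%classic `<=` I.
  by move=> u; rewrite /I /= !in_itv /= andbT => /andP[u1 _]; exact: lt_le_trans u1.
have H2 : has_integral `[1, 2]%classic (fun u => u `^ (s - 1) * expR (- u)) (\int[mu]_(u in `[1, 2]) (u `^ (s - 1) * expR (- u))).
  by split => //; apply: integrableS Hf.1.
apply: (@lt_le_trans _ _ (\int[mu]_(u in `[1, 2]) (u `^ (s - 1) * expR (- u)))); last first.
  rewrite -lee_fin -(has_integral_EFin m12 H2) -(has_integral_EFin mI Hf).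
  apply: ge0_subset_integral => //; first by case: Hf => /measurable_int.
  by move=> u _; rewrite lee_fin mulr_ge0 ?powR_ge0 ?expR_ge0.
apply: (@lt_le_trans _ _ (expR (-2))); first exact: expR_gt0.
rewrite -lee_fin -(has_integral_EFin m12 H2).
have -> : (expR (-2))%:E = (\int[mu]_(u in `[1%R, 2%R]) (cst (expR (-2))%:E u))%E.
  transitivity ((expR (-2))%:E * mu `[1%R, 2%R])%E; last by rewrite integral_cst.
  rewrite lebesgue_measure_itv /= lte_fin ltr1n -EFinD (_ : 2 - 1 = 1 :> R) ?mule1//.
  by lra.
apply: ge0_le_integral => //.
- by move=> u _; rewrite lee_fin expR_ge0.
- by case: H2 => /measurable_int.
- move=> u; rewrite /= in_itv /= => /andP[u1 u2]; rewrite lee_fin -[leLHS]mul1r.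
  apply: ler_pM; rewrite ?expR_ge0 ?ler_expR ?lerN2//.
  by rewrite -[leLHS](powRr0 u) ler_powR// subr_ge0 ltW.
Qed.

End GaussLimit.

(** * Extended harmonic numbers *)

Section Digamma.
Variable R : realType.
Implicit Types (x y : R) (k n m : nat).

(** The derivative of order k + 1 of [ln_gauss n]; the logarithm is a constant that only the first
    derivative retains. *)
Definition psi_partial k n y : R :=
  (if k == 0%N then ln n.+1%:R else 0) +
  (-1) ^+ k.+1 * k`!%:R * \sum_(0 <= j < n.+2) (y + j%:R)^-1 ^+ k.+1.

Definition psi_limit k y : R := limn (psi_partial k ^~ y).

Definition ln_gauss n y : R :=
  y * ln n.+1%:R + ln n.+1`!%:R - \sum_(0 <= j < n.+2) ln (y + j%:R).

Lemma is_derive_shift_add y (j : nat) : is_derive y 1 (fun z => z + j%:R : R) 1.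
Proof.
by have := is_deriveD_fun (is_derive_id y (1 : R)) (is_derive_cst (j%:R : R) y (1 : R)); rewrite addr0.
Qed.

Lemma is_derive_ln_gauss n y : 0 < y -> is_derive y 1 (ln_gauss n) (psi_partial 0 n y).
Proof.
move=> y0.
have D1 := is_deriveM_fun (is_derive_id y (1 : R)) (is_derive_cst (ln n.+1%:R : R) y (1 : R)).
have D2 : is_derive y 1 (fun z => \sum_(0 <= j < n.+2) ln (z + j%:R)) (\sum_(0 <= j < n.+2) (y + j%:R)^-1).
  apply: is_derive_sum_fun => j _.
  have yj : 0 < y + j%:R by rewrite ltr_wpDr.
  by have := is_derive_comp (is_derive_shift_add y j) (is_derive1_ln yj); rewrite mulr1.
have := is_deriveB_fun (is_deriveD_fun D1 (is_derive_cst (ln n.+1`!%:R : R) y (1 : R))) D2.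
move=> H; apply: (is_derive_congr H); rewrite /psi_partial /= fact0 /cst mulr1 mulN1r.
by rewrite mul1r mulr0 !addr0.
Qed.

Lemma is_derive_psi_partial k n y : 0 < y ->
  is_derive y 1 (psi_partial k n) (psi_partial k.+1 n y).
Proof.
move=> y0.
have D : is_derive y 1 (fun z => \sum_(0 <= j < n.+2) (z + j%:R)^-1 ^+ k.+1)
    (\sum_(0 <= j < n.+2) (- (k.+1%:R) * (y + j%:R)^-1 ^+ k.+2)).
  apply: is_derive_sum_fun => j _.
  have yj : y + j%:R != 0 by rewrite gt_eqF// ltr_wpDr.
  have := is_deriveX_fun k.+1 (is_deriveV_fun (f := fun z => z + j%:R) yj (is_derive_shift_add y j)).
  move=> H; apply: (is_derive_congr H); rewrite /= !exprS exprVn; field.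
  by rewrite yj ?expf_neq0.
have := is_deriveD_fun (is_derive_cst (if k == 0%N then ln n.+1%:R else 0 : R) y (1 : R))
  (is_deriveZ_fun ((-1) ^+ k.+1 * k`!%:R) D).
move=> H; apply: (is_derive_congr H).
rewrite /psi_partial /= -mulr_sumr factS natrM [(-1) ^+ k.+2]exprS; set S := \sum_(_ <= _ < _) _.
by move: ((-1) ^+ k.+1) (k`!%:R) (k.+1%:R) S => u v w S; ring.
Qed.

(** Supplies the uniform bound for [derive_of_limit]: powers of numbers in [0, 1] differ by at most
    k + 1 times their distance, the reciprocals of y + j and x + j differ by at most |y - x| /
    (j+1)^2, and these bounds sum to zeta(2) whatever n is. *)
Lemma psi_partial_lipschitz k n x y : 1 < x -> 1 <= y ->
  `|psi_partial k n y - psi_partial k n x| <= k`!%:R * k.+1%:R * zeta R 2 * `|y - x|.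
Proof.
move=> x1 y1; rewrite /psi_partial opprD addrACA subrr add0r -mulrBr normrM.
rewrite normrM normrX normrN1 expr1n mul1r normr_nat -!mulrA ler_wpM2l//.
rewrite -sumrB (le_trans (ler_norm_sum _ _ _))//.
apply: (@le_trans _ _ (k.+1%:R * `|y - x| * \sum_(0 <= j < n.+2) j.+1%:R^-1 ^+ 2)).
  rewrite mulr_sumr; apply: ler_sum => j _.
  have j0 : 0 < j.+1%:R :> R by [].
  have yj : j.+1%:R <= y + j%:R by rewrite -natr1 addrC lerD2r.
  have xj : j.+1%:R <= x + j%:R by rewrite -natr1 addrC lerD2r ltW.
  have y0 := lt_le_trans j0 yj; have x0 := lt_le_trans j0 xj.
  have inv1 (z : R) : j.+1%:R <= z -> 0 <= z^-1 <= 1.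
    move=> jz; have z0 := lt_le_trans j0 jz; rewrite invr_ge0 ltW//= invf_le1//.
    by rewrite (le_trans _ jz)// ler1n.
  apply: (le_trans (ler_distX _ (inv1 _ yj) (inv1 _ xj))).
  rewrite -mulrA ler_wpM2l//.
  rewrite (_ : _ - _ = (x - y) * ((y + j%:R)^-1 * (x + j%:R)^-1)); last by field; rewrite !gt_eqF.
  have p0 : 0 <= (y + j%:R)^-1 * (x + j%:R)^-1.
    by rewrite mulr_ge0 ?invr_ge0 ?(ltW y0) ?(ltW x0).
  rewrite normrM distrC ler_wpM2l// (ger0_norm p0) expr2.
  by apply: ler_pM; rewrite ?invr_ge0 ?(ltW y0) ?(ltW x0)// lef_pV2 ?posrE.
rewrite -mulrA ler_wpM2l// mulrC ler_wpM2r//.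
have H := @is_cvg_inv_powers R 2 isT.
rewrite zetaE//; have := nondecreasing_cvgn_le _ H n.+3; rewrite /series /= big_nat_recl//.
rewrite invr0 expr0n /= add0r; apply.
by apply: nondecreasing_series => i _ _; rewrite exprn_ge0.
Qed.

Lemma expR_ln_gauss n y : 0 < y -> expR (ln_gauss n y) = gauss_product y n.
Proof.
move=> y0; rewrite /ln_gauss /gauss_product expRB expRD expR_sum.
have n0 : 0 < n.+1%:R :> R by [].
rewrite /powR (gt_eqF n0); congr (_ * _ / _); first by rewrite lnK// posrE ltr0n fact_gt0.
by apply: eq_bigr => j _; rewrite lnK// posrE ltr_wpDr.
Qed.

Lemma cvg_ln_gauss y : 1 < y -> ln_gauss n y @[n --> \oo] --> ln (Gamma y).
Proof.
move=> y1; have [_ H] := cvg_gauss_product y1.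
have H2 : ln (gauss_product y n) @[n --> \oo] --> ln (Gamma y).
  by apply: continuous_cvg => //; apply: continuous_ln; exact: Gamma_gt0.
apply: cvg_trans H2; apply: near_eq_cvg; apply: nearW => n.
by rewrite -expR_ln_gauss ?expRK// (lt_trans ltr01).
Qed.

(** Of the two consequences of ln(1 + v) <= v in [step], one makes the sequence decrease and the
    other bounds it below by 0. *)
Lemma cvg_euler_gamma :
  (\sum_(1 <= k < n.+2) k%:R^-1) - ln n.+1%:R @[n --> \oo] --> euler_gamma R.
Proof.
set a := fun n => _; suff /cvg_ex[l al] : cvgn a.
  have bl : (fun n => (\sum_(1 <= k < n.+1) k%:R^-1) - ln n%:R : R) @ \oo --> l by rewrite -cvg_shiftS.
  by rewrite /euler_gamma (cvg_lim _ bl).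
have step n : ln n.+1%:R - ln n.+2%:R <= - (n.+2%:R^-1 : R) /\ ln n.+2%:R - ln n.+1%:R <= (n.+1%:R^-1 : R).
  have n1 : 0 < n.+1%:R :> R by []. have n2 : 0 < n.+2%:R :> R by [].
  rewrite -!ln_div ?posrE//; split.
    have -> : n.+1%:R / n.+2%:R = 1 + - (n.+2%:R^-1) :> R.
      by rewrite -(natr1 n.+1) in n2 *; field; rewrite gt_eqF.
    by apply: le_ln1Dx; rewrite ltrN2 invf_lt1// ltr1n.
  have -> : n.+2%:R / n.+1%:R = 1 + n.+1%:R^-1 :> R.
    by rewrite -(natr1 n.+1); field; rewrite gt_eqF.
  by apply: le_ln1Dx; rewrite (@lt_trans _ _ 0) ?invr_gt0// oppr_lt0.
apply: nonincreasing_is_cvgn.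
  apply/nonincreasing_seqP => n; rewrite /a (big_nat_recr n.+2)//= -addrA lerD2l.
  have [+ _] := step n.
  by move: (ln n.+2%:R) (ln n.+1%:R) (n.+2%:R^-1) => u v w ?; lra.
exists 0 => _ [n _ <-]; rewrite /a subr_ge0.
apply: (@le_trans _ _ (ln n.+2%:R)); first by rewrite ler_ln ?posrE// ler_nat.
elim: n => [|n IH].
  by rewrite big_nat1 invr1; have [_] := step 0%N; rewrite ln1 subr0 invr1.
rewrite (big_nat_recr n.+2)//=; move: IH; have [_] := step n.+1.
by move: (ln n.+2%:R) (ln n.+3%:R) (n.+2%:R^-1) (\sum_(_ <= _ < _) _) => u v w S ? ?; lra.
Qed.

Definition harmonic_diff m x N : R :=
  \sum_(1 <= k < N) (k%:R^-1 ^+ m - (x + k%:R)^-1 ^+ m).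

Lemma harmonic_diff_term m x k : 0 < x -> (0 < k)%N ->
  0 <= k%:R^-1 ^+ m - (x + k%:R)^-1 ^+ m <= m%:R * x * k%:R^-1 ^+ 2.
Proof.
move=> x0 k0; have kp : 0 < k%:R :> R by rewrite ltr0n.
have xk : 0 < x + k%:R by rewrite addr_gt0.
have le1 : (x + k%:R)^-1 <= k%:R^-1 by rewrite lef_pV2 ?posrE// lerDr ltW.
have i1 : k%:R^-1 <= 1 :> R by rewrite invf_le1// ler1n.
have p0 : 0 <= m%:R * x * k%:R^-1 ^+ 2 by rewrite !mulr_ge0 ?exprn_ge0// ltW.
have H0 : 0 <= k%:R^-1 ^+ m - (x + k%:R)^-1 ^+ m.
  by rewrite subr_ge0 lerXn2r ?nnegrE ?invr_ge0 ?(ltW kp) ?(ltW xk).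
have Bk : 0 <= (k%:R^-1 : R) <= 1 by rewrite invr_ge0 (ltW kp).
have Bx : 0 <= (x + k%:R)^-1 <= 1 by rewrite invr_ge0 (ltW xk) (le_trans le1).
rewrite H0 /= -[leLHS]ger0_norm//; apply: (le_trans (ler_distX m Bk Bx)).
rewrite -mulrA ler_wpM2l// ger0_norm ?subr_ge0//.
rewrite (_ : _ - _ = x * (k%:R^-1 * (x + k%:R)^-1)); last by field; rewrite !gt_eqF.
by rewrite ler_pM2l// expr2 ler_wpM2l// invr_ge0 ltW.
Qed.

Lemma is_cvg_harmonic_diff m x : 0 < x -> cvgn (harmonic_diff m x).
Proof.
move=> x0; apply: nondecreasing_is_cvgn.
  apply/nondecreasing_seqP => n; rewrite /harmonic_diff.
  case: n => [|n]; first by rewrite !big_geq.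
  rewrite [leRHS]big_nat_recr//= lerDl.
  by have /andP[] := @harmonic_diff_term m x _ x0 (ltn0Sn n).
have C := @is_cvg_inv_powers R 2 isT.
exists (m%:R * x * limn (series (fun n => n%:R^-1 ^+ 2 : R))) => _ [n _ <-].
apply: (@le_trans _ _ (m%:R * x * series (fun n => n%:R^-1 ^+ 2 : R) n)); last first.
  rewrite ler_wpM2l ?mulr_ge0 ?(ltW x0)//; apply: nondecreasing_cvgn_le => //.
  by apply: nondecreasing_series => i _ _; rewrite exprn_ge0.
rewrite /harmonic_diff /series /=; case: n => [|n]; first by rewrite !big_geq// mulr0.
rewrite [X in _ <= _ * X]big_ltn// invr0 expr0n add0r mulr_sumr.
rewrite big_nat_cond [leRHS]big_nat_cond; apply: ler_sum => k /andP[/andP[k0 _] _].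
by have /andP[] := @harmonic_diff_term m x _ x0 k0.
Qed.

Lemma psi_partial_harmonic_diff k n x : psi_partial k n (x + 1) =
  (if k == 0%N then ln n.+1%:R else 0) + (-1) ^+ k.+1 * k`!%:R *
   (\sum_(1 <= i < n.+3) i%:R^-1 ^+ k.+1 - harmonic_diff k.+1 x n.+3).
Proof.
rewrite /psi_partial; congr (_ + _ * _); rewrite /harmonic_diff -sumrB.
rewrite big_add1 /=; apply: eq_bigr => j _.
by rewrite subKr -natr1; congr (_^-1 ^+ _); ring.
Qed.

Lemma cvg_psi_partial_add1 k x : 0 < x -> psi_partial k n (x + 1) @[n --> \oo] -->
  if k == 0%N then limn (harmonic_diff 1 x) - euler_gamma R
  else (-1) ^+ k.+1 * k`!%:R * (zeta R k.+1 - limn (harmonic_diff k.+1 x)).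
Proof.
move=> x0; have C := @is_cvg_harmonic_diff k.+1 x x0.
have C3 : harmonic_diff k.+1 x n.+3 @[n --> \oo] --> limn (harmonic_diff k.+1 x).
  have : harmonic_diff k.+1 x (n + 3)%N @[n --> \oo] --> limn (harmonic_diff k.+1 x) by rewrite cvg_shiftn.
  by under eq_fun do rewrite addn3.
under eq_fun do rewrite psi_partial_harmonic_diff.
case: k C C3 => [|k] C C3 /=.
  (* The reciprocals run up to n + 2, one index further than in the sequence for Euler's constant;
     [harmonic n.+1] is this extra term and tends to 0. *)
  have H : harmonic_diff 1 x n.+3 - ((\sum_(1 <= k < n.+2) k%:R^-1) - ln n.+1%:R) - harmonic n.+1
      @[n --> \oo] --> limn (harmonic_diff 1 x) - euler_gamma R - 0.
    apply: cvgB; first by apply: cvgB => //; exact: cvg_euler_gamma.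
    have : [sequence @harmonic R n.+1]_n @ \oo --> (0 : R) by rewrite cvg_shiftS; exact: cvg_harmonic.
    exact.
  rewrite subr0 in H; apply: cvg_trans H; apply: near_eq_cvg; apply: nearW => n.
  rewrite fact0 mulr1 mulN1r (big_nat_recr n.+2)//= /harmonic /=.
  by under [in RHS]eq_bigr do rewrite expr1; ring.
have Z : \sum_(1 <= i < n.+3) i%:R^-1 ^+ k.+2 @[n --> \oo] --> zeta R k.+2.
  rewrite zetaE//; have H := @is_cvg_inv_powers R k.+2 isT.
  have : series (fun n => n%:R^-1 ^+ k.+2 : R) (n + 3)%N @[n --> \oo] --> limn (series (fun n => n%:R^-1 ^+ k.+2 : R)).
    by rewrite (cvg_shiftn 3 (series (fun n => n%:R^-1 ^+ k.+2 : R))).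
  apply: cvg_trans; apply: near_eq_cvg; apply: nearW => n.
  by rewrite addn3 /series /= [LHS]big_ltn// invr0 expr0n add0r.
under eq_fun do rewrite add0r.
by apply: cvgM; [exact: cvg_cst|exact: cvgB].
Qed.

Lemma cvg_psi_partial k y : 1 < y -> psi_partial k n y @[n --> \oo] --> psi_limit k y.
Proof.
move=> y1; have x0 : 0 < y - 1 by rewrite subr_gt0.
have := cvg_psi_partial_add1 (k := k) x0; rewrite subrK => H.
by apply/cvg_ex; eexists; exact: H.
Qed.

Lemma is_derive_psi_limit k y : 1 < y -> is_derive y 1 (psi_limit k) (psi_limit k.+1 y).
Proof.
move=> y1; have r0 : 0 < y - 1 by rewrite subr_gt0.
have rz z : `|z - y| < y - 1 -> 1 < z by rewrite ltr_norml => /andP[]; lra.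
apply: (@derive_of_limit R (psi_partial k) (psi_partial k.+1) _ y _ _ (k.+1`!%:R * k.+2%:R * zeta R 2) r0).
- by move=> n z /rz z1; apply: is_derive_psi_partial; rewrite (lt_trans ltr01).
- by move=> n z /rz z1; apply: psi_partial_lipschitz => //; exact: ltW.
- by move=> z /rz z1; exact: cvg_psi_partial.
- exact: cvg_psi_partial.
Qed.

(** The limit of derivatives is taken for ln Gamma, and Gamma itself is recovered by exponentiation;
    positivity of Gamma is used both ways. *)
Lemma digamma_psi_limit y : 1 < y -> digamma y = psi_limit 0 y.
Proof.
move=> y1; have r0 : 0 < y - 1 by rewrite subr_gt0.
have rz z : `|z - y| < y - 1 -> 1 < z by rewrite ltr_norml => /andP[]; lra.
have D : is_derive y 1 (fun z => ln (Gamma z)) (psi_limit 0 y).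
  apply: (@derive_of_limit R ln_gauss (psi_partial 0) _ y _ _ (0`!%:R * 1%:R * zeta R 2) r0).
  - by move=> n z /rz z1; apply: is_derive_ln_gauss; rewrite (lt_trans ltr01).
  - by move=> n z /rz z1; apply: psi_partial_lipschitz => //; exact: ltW.
  - by move=> z /rz z1; exact: cvg_ln_gauss.
  - exact: cvg_psi_partial.
have G0 := Gamma_gt0 y1.
have DG : is_derive y 1 (@Gamma R) (Gamma y * psi_limit 0 y).
  have := is_derive_comp D (is_derive_expR _); rewrite lnK ?posrE//.
  apply: near_eq_is_derive; near=> z; rewrite lnK// posrE; apply: Gamma_gt0.
  by near: z; exact: (cvgr_gt y cvg_id _ y1).
by rewrite /digamma (is_derive1E DG) mulrAC divff ?mul1r// gt_eqF.
Unshelve. all: by end_near. Qed.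

Lemma derive1n_digamma k y : 1 < y -> derive1n k (@digamma R) y = psi_limit k y.
Proof.
elim: k y => [|k IH] y y1; first exact: digamma_psi_limit.
rewrite derive1nS; apply: is_derive1E.
apply: near_eq_is_derive (is_derive_psi_limit k y1).
near=> z; apply/esym/IH; near: z; exact: (cvgr_gt y cvg_id _ y1).
Unshelve. all: by end_near. Qed.

(** The sign and factorial in the definition cancel those of the derivatives of digamma, leaving
    zeta - (zeta - h) = h; for m = 1 Euler's constant cancels instead. *)
Lemma cvg_harmonic_ext m x : (0 < m)%N -> 0 < x ->
  harmonic_diff m x @ \oo --> harmonic_ext m x.
Proof.
case: m => // k _ x0; have x1 : 1 < x + 1 by rewrite ltrDr.
suff -> : harmonic_ext k.+1 x = limn (harmonic_diff k.+1 x) by exact: is_cvg_harmonic_diff.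
have := cvg_psi_partial_add1 (k := k) x0; move=> /(cvg_lim (@Rhausdorff R)) V.
rewrite -/(psi_limit k (x + 1)) in V.
case: k V => [|k] V.
  by rewrite /harmonic_ext /= digamma_psi_limit// V addrCA subrr addr0.
rewrite -[LHS]/(zeta R k.+2 + (-1) ^+ k.+1 / k.+1`!%:R * derive1n k.+1 (@digamma R) (x + 1)).
rewrite derive1n_digamma// V /=.
have f0 : k.+1`!%:R != 0 :> R by rewrite pnatr_eq0 -lt0n fact_gt0.
have s2 : (-1) ^+ k.+1 * (-1) ^+ k.+1 = 1 :> R by rewrite -exprMn mulrNN mulr1 expr1n.
have key (u f z h : R) : f != 0 -> u * u = 1 -> z + u / f * (-1 * u * f * (z - h)) = h.
  move=> g0 u2; rewrite (_ : _ * (_ * _) = (u * u) * (h - z)); last by field.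
  by rewrite u2 mul1r addrCA subrr addr0.
by rewrite [(-1) ^+ k.+2]exprS; exact: key.
Qed.

End Digamma.

(** * Euler sums *)

Section EulerSums.
Variable R : realType.
Implicit Types (x r : R) (m n t p : nat).

(* Growth of the harmonic numbers of order sqrt x is all that is needed for
   their Euler sums to converge when t = 2. *)
Lemma inv_mul_sqrt_sum n :
  \sum_(1 <= k < n.+2) (k%:R * Num.sqrt k%:R)^-1 <= 3 - 2 / Num.sqrt n.+1%:R :> R.
Proof.
elim: n => [|n IH]; first by rewrite big_nat1 sqrtr1 mulr1 invr1; lra.
rewrite big_nat_recr//=; apply: le_trans (lerD IH (lexx _)) _.
have a0 : 0 < Num.sqrt n.+1%:R :> R by rewrite sqrtr_gt0.
have b0 : 0 < Num.sqrt n.+2%:R :> R by rewrite sqrtr_gt0.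
have ab : Num.sqrt n.+1%:R <= Num.sqrt n.+2%:R :> R by rewrite ler_sqrt ?ler_nat.
have a2 : Num.sqrt n.+1%:R ^+ 2 = n.+1%:R :> R by rewrite sqr_sqrtr.
have b2 : Num.sqrt n.+2%:R ^+ 2 = n.+2%:R :> R by rewrite sqr_sqrtr.
have b2a2 : Num.sqrt n.+2%:R ^+ 2 = Num.sqrt n.+1%:R ^+ 2 + 1 :> R by rewrite a2 b2 natr1.
rewrite (_ : (n.+2%:R * _)^-1 = (Num.sqrt n.+2%:R ^+ 2 * Num.sqrt n.+2%:R)^-1); last by rewrite b2.
 move: (Num.sqrt n.+1%:R : R) (Num.sqrt n.+2%:R : R) a0 b0 ab b2a2 => a b a0 b0 ab E.
(* The telescoping step: b^-3 <= 2/a - 2/b for consecutive square roots a <= b, using b^2 - a^2 =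
   1. *)
clear a2 b2; have key : (b ^+ 2 * b)^-1 <= 2 / a - 2 / b.
  rewrite (_ : 2 / a - 2 / b = 2 * (b ^+ 2 - a ^+ 2) / (a * b * (a + b))); last first.
    by field; rewrite !gt_eqF// addr_gt0.
  rewrite (_ : b ^+ 2 - a ^+ 2 = 1); last by rewrite E; ring.
  rewrite mulr1 ler_pdivlMr ?mulr_gt0 ?addr_gt0// mulrC ler_pdivrMr ?mulr_gt0 ?exprn_gt0//.
  have h1 : a * a <= b * b by rewrite ler_pM ?(ltW a0).
  have h2 : b * (a * a) <= b * (b * b) by rewrite ler_pM2l.
  have h3 : b * b * a <= b * b * b by rewrite ler_pM2l ?mulr_gt0.
  by rewrite expr2; lra.
by lra.
Qed.

(** After clearing denominators this is sqrt(x k) <= x + k. *)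
Lemma sqrt_amgm x (k : R) : 0 < x -> 0 < k -> x / (k * (x + k)) <= Num.sqrt x / (k * Num.sqrt k).
Proof.
move=> x0 k0; have a0 : 0 < Num.sqrt x by rewrite sqrtr_gt0.
have b0 : 0 < Num.sqrt k by rewrite sqrtr_gt0.
have a2 : Num.sqrt x ^+ 2 = x by rewrite sqr_sqrtr// ltW.
have b2 : Num.sqrt k ^+ 2 = k by rewrite sqr_sqrtr// ltW.
rewrite -{1 2}a2 -{1 2 3}b2; move: (Num.sqrt x) (Num.sqrt k) a0 b0 => a b a0 b0.
have ab0 : 0 < b ^+ 2 * (a ^+ 2 + b ^+ 2) by rewrite mulr_gt0 ?addr_gt0 ?exprn_gt0.
rewrite ler_pdivrMr// mulrAC ler_pdivlMr ?mulr_gt0 ?exprn_gt0//.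
rewrite -subr_ge0 (_ : _ - _ = a * b ^+ 2 * (a ^+ 2 - a * b + b ^+ 2)); last by ring.
rewrite mulr_ge0 ?mulr_ge0 ?exprn_ge0 ?(ltW a0) ?(ltW b0)//.
have := sqr_ge0 (a - b); have := mulr_gt0 a0 b0; rewrite !expr2; nra.
Qed.

(** Each term is at most m (1/k - 1/(x+k)) = m x / (k (x+k)), to which [sqrt_amgm] applies; 3 bounds
    the sum of k^(-3/2). *)
Lemma harmonic_diff_le m x N : 0 < x -> harmonic_diff m x N <= 3 * m%:R * Num.sqrt x.
Proof.
move=> x0; case: N => [|[|N]].
- by rewrite /harmonic_diff big_geq// !mulr_ge0 ?sqrtr_ge0.
- by rewrite /harmonic_diff big_geq// !mulr_ge0 ?sqrtr_ge0.
apply: (@le_trans _ _ (m%:R * Num.sqrt x * \sum_(1 <= k < N.+2) (k%:R * Num.sqrt k%:R)^-1)); last first.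
  rewrite -[3 * _ * _]mulrA [3 * _]mulrC ler_wpM2l ?mulr_ge0 ?sqrtr_ge0//.
  by apply: le_trans (inv_mul_sqrt_sum N) _; rewrite gerBl divr_ge0// sqrtr_ge0.
rewrite /harmonic_diff mulr_sumr big_nat_cond [leRHS]big_nat_cond.
apply: ler_sum => k /andP[/andP[k1 _] _].
have k0 : 0 < k%:R :> R by rewrite ltr0n.
have xk : 0 < x + k%:R by rewrite addr_gt0.
have le1 : (x + k%:R)^-1 <= k%:R^-1 by rewrite lef_pV2 ?posrE// lerDr ltW.
have i1 : k%:R^-1 <= 1 :> R by rewrite invf_le1// ler1n.
have Bk : 0 <= (k%:R^-1 : R) <= 1 by rewrite invr_ge0 (ltW k0).
have Bx : 0 <= (x + k%:R)^-1 <= 1 by rewrite invr_ge0 (ltW xk) (le_trans le1).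
apply: le_trans (ler_norm _) _; apply: (le_trans (ler_distX m Bk Bx)).
rewrite -mulrA ler_wpM2l// ger0_norm ?subr_ge0//.
apply: le_trans (sqrt_amgm x0 k0); rewrite le_eqVlt; apply/orP; left; apply/eqP.
by field; rewrite !gt_eqF.
Qed.

Lemma harmonic_ext_bounds m x : (0 < m)%N -> 0 < x ->
  0 <= harmonic_ext m x <= 3 * m%:R * Num.sqrt x.
Proof.
move=> m0 x0; have H := cvg_harmonic_ext m0 x0.
have C : cvgn (harmonic_diff m x) by apply/cvg_ex; eexists; exact: H.
rewrite -(cvg_lim (@Rhausdorff R) H); apply/andP; split.
  apply: limr_ge => //; apply: nearW => N; rewrite /harmonic_diff big_nat_cond.
  apply: sumr_ge0 => k /andP[/andP[k0 _] _].
  by have /andP[] := @harmonic_diff_term R m x k x0 k0.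
by apply: limr_le => //; apply: nearW => N; exact: harmonic_diff_le.
Qed.

Lemma rsummable_euler_sum m t r : (0 < m)%N -> (1 < t)%N -> 0 < r ->
  rsummable (fun n => harmonic_ext m (r * n%:R) / n%:R ^+ t).
Proof.
move=> m0 t1 r0; have rn n : 0 < r * n.+1%:R by rewrite mulr_gt0.
have term0 n : 0 <= harmonic_ext m (r * n.+1%:R) / n.+1%:R ^+ t.
  by have /andP[h0 _] := harmonic_ext_bounds m0 (rn n); rewrite divr_ge0// exprn_ge0.
apply: nondecreasing_is_cvgn.
  apply/nondecreasing_seqP => -[|n]; first by rewrite !big_geq.
  by rewrite [leRHS]big_nat_recr//= lerDl.
(* The first factors bound the harmonic number at r n up to sqrt n; the last 3 bounds the remaining
   sum of n^(-3/2). *)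
exists (3 * m%:R * Num.sqrt r * 3) => _ [N _ <-].
have c0 : 0 <= 3 * m%:R * Num.sqrt r by rewrite !mulr_ge0 ?sqrtr_ge0.
case: N => [|[|N]]; first by rewrite big_geq ?mulr_ge0.
  by rewrite big_geq ?mulr_ge0.
apply: (@le_trans _ _ (3 * m%:R * Num.sqrt r * \sum_(1 <= k < N.+2) (k%:R * Num.sqrt k%:R)^-1)); last first.
  rewrite ler_wpM2l//.
  by apply: le_trans (inv_mul_sqrt_sum N) _; rewrite gerBl divr_ge0// sqrtr_ge0.
rewrite mulr_sumr big_nat_cond [leRHS]big_nat_cond.
apply: ler_sum => -[|k] /andP[/andP[k1 _] _] //.
have k0 : 0 < k.+1%:R :> R by [].
have /andP[_ h1] := harmonic_ext_bounds m0 (rn k).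
rewrite ler_pdivrMr ?exprn_gt0//; apply: le_trans h1 _.
rewrite sqrtrM ?(ltW r0)// -[leRHS]mulrA mulrA ler_wpM2l//.
have s0 : 0 < Num.sqrt k.+1%:R :> R by rewrite sqrtr_gt0.
have s2 : Num.sqrt k.+1%:R ^+ 2 = k.+1%:R :> R by rewrite sqr_sqrtr.
rewrite mulrC ler_pdivlMr ?mulr_gt0// mulrCA -expr2 s2 -expr2.
by rewrite ler_weXn2l// ler1n.
Qed.

(** Subtracting the even terms twice makes a sum alternate, and 2^-p (x/2 + j)^-(p+1) = 2 (x +
    2j)^-(p+1) writes twice the even terms as a sum at the halved argument. *)
Lemma harmonic_diff_alternating p x N :
  harmonic_diff p.+1 x N.*2.+1 - 2 ^- p * harmonic_diff p.+1 (x / 2) N.+1 =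
  \sum_(1 <= k < N.*2.+1) (-1) ^+ k.+1 * k%:R^-1 ^+ p.+1
  - \sum_(1 <= k < N.*2.+1) (-1) ^+ k.+1 * (x + k%:R)^-1 ^+ p.+1.
Proof.
rewrite -sumrB /harmonic_diff; elim: N => [|N IH]; first by rewrite !big_geq// mulr0 subr0.
rewrite doubleS !(big_nat_recr N.*2.+2)//= !(big_nat_recr N.*2.+1)//= (big_nat_recr N.+1)//=.
rewrite mulrDr -!exprVn in IH *.
have E (u : R) : 2^-1 ^+ p * (u / 2)^-1 ^+ p.+1 = 2 * u^-1 ^+ p.+1.
  rewrite invfM invrK exprMn [2 ^+ p.+1]exprS exprVn.
  by move: (u^-1 ^+ p.+1) => U; field; rewrite expf_neq0.
have EN : 2^-1 ^+ p * N.+1%:R^-1 ^+ p.+1 = 2 * (N.*2.+2%:R : R)^-1 ^+ p.+1.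
  by rewrite -E; congr (_ * _^-1 ^+ _); rewrite -doubleS -muln2 natrM mulfK.
have EX : 2^-1 ^+ p * (x / 2 + N.+1%:R)^-1 ^+ p.+1 = 2 * (x + N.*2.+2%:R)^-1 ^+ p.+1.
  by rewrite -E; congr (_ * _^-1 ^+ _); rewrite -doubleS -muln2 natrM; field.
rewrite mulrBr EN EX.
have s1 : (-1) ^+ N.*2.+2 = 1 :> R by rewrite -doubleS -signr_odd odd_double.
have s2 : (-1) ^+ N.*2.+3 = -1 :> R by rewrite exprS s1 mulr1.
rewrite s1 s2.
have := IH; move: (\sum_(_ <= _ < _) _) (_ * \sum_(_ <= _ < _) _) (\sum_(_ <= _ < _) _) => u v w {}IH.
lra.
Qed.

Lemma cvg_alternating p x : 0 <= x ->
  \sum_(1 <= k < N) (-1) ^+ k.+1 * (x + k%:R)^-1 ^+ p.+1 @[N --> \oo] --> fermi p x 1 / p`!%:R.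
Proof.
move=> x0; have H := @cvg_fermi R p x 1 x0 ltr01.
have H2 : \sum_(1 <= k < N) (-1) ^+ k.+1 * (p`!%:R / (x + k%:R * 1) ^+ p.+1) / p`!%:R @[N --> \oo] --> fermi p x 1 / p`!%:R.
  have : (\sum_(1 <= k < N) (-1) ^+ k.+1 * (p`!%:R / (x + k%:R * 1) ^+ p.+1)) / p`!%:R @[N --> \oo] --> fermi p x 1 / p`!%:R.
    by apply: cvgM; [exact: H|exact: cvg_cst].
  by under eq_fun do rewrite mulr_suml.
apply: cvg_trans H2; apply: near_eq_cvg; apply: nearW => N; apply: eq_bigr => k _.
have f0 : p`!%:R != 0 :> R by rewrite pnatr_eq0 -lt0n fact_gt0.
rewrite mulr1 exprVn; move: ((x + k%:R) ^- p.+1) => Y.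
by field.
Qed.

Lemma etaE p : eta R p.+1 = fermi p 0 1 / p`!%:R.
Proof.
rewrite /eta /rsum; apply: cvg_lim => //; have H := @cvg_alternating p 0 (lexx 0).
apply: cvg_trans H; apply: near_eq_cvg; apply: nearW => N; apply: eq_bigr => k _.
by rewrite add0r exprVn.
Qed.

(** The limit of [harmonic_diff_alternating]; this is the origin of the argument q/2 and the factor
    2^-p in the Euler sums. *)
Lemma harmonic_ext_alternating p x : 0 < x ->
  harmonic_ext p.+1 x - 2 ^- p * harmonic_ext p.+1 (x / 2) = eta R p.+1 - fermi p x 1 / p`!%:R.
Proof.
move=> x0; have x20 : 0 < x / 2 by rewrite divr_gt0.
have sub (u : nat -> R) (phi : nat -> nat) (l : R) : (forall n, (n <= phi n)%N) -> u @ \oo --> l -> u (phi n) @[n --> \oo] --> l.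
  move=> Hp; apply: cvg_comp => P [N _ NP]; exists N => // n /= Nn; apply: NP => /=.
  exact: leq_trans Nn (Hp n).
have H1 := cvg_harmonic_ext (ltn0Sn p) x0; have H2 := cvg_harmonic_ext (ltn0Sn p) x20.
have dbl n : (n <= n.*2.+1)%N by rewrite -addnn -addnS leq_addr.
have L : harmonic_diff p.+1 x N.*2.+1 - 2 ^- p * harmonic_diff p.+1 (x / 2) N.+1 @[N --> \oo] -->
   harmonic_ext p.+1 x - 2 ^- p * harmonic_ext p.+1 (x / 2).
  apply: cvgB; first exact: (sub _ (fun n => n.*2.+1)).
  by apply: cvgM; [exact: cvg_cst|exact: (sub _ S)].
have EQ : (fun N => harmonic_diff p.+1 x N.*2.+1 - 2 ^- p * harmonic_diff p.+1 (x / 2) N.+1) =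
    (fun N => \sum_(1 <= k < N.*2.+1) (-1) ^+ k.+1 * k%:R^-1 ^+ p.+1
     - \sum_(1 <= k < N.*2.+1) (-1) ^+ k.+1 * (x + k%:R)^-1 ^+ p.+1).
  by apply/funext => N; exact: harmonic_diff_alternating.
rewrite EQ in L; apply: (cvg_unique _ L) => //.
have A1 := @cvg_alternating p 0 (lexx 0); have A2 := @cvg_alternating p x (ltW x0).
rewrite etaE; apply: cvgB; last by have := sub _ (fun n => n.*2.+1) _ dbl A2.
have := sub _ (fun n => n.*2.+1) _ dbl A1; apply: cvg_trans; apply: near_eq_cvg; apply: nearW => N.
by apply: eq_bigr => k _; rewrite add0r.
Qed.

End EulerSums.

(** * The two half-line integrals *)

Section HalfLineIntegrals.
Variables (R : realType) (t p : nat) (Li : R[i] -> R[i]) (a b : R).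
Hypotheses (t_gt0 : (0 < t)%N) (Li_polylog : is_polylog t Li).
Hypotheses (a_gt0 : 0 < a) (b_gt0 : 0 < b).
Let I : set (measurableTypeR R) := `]0, +oo[%classic.
Let mI : measurable I. Proof. exact: measurable_itv. Qed.
Local Open Scope complex_scope.
Let f := Iplus_integrand Li a b p.

Lemma Iplus_integrandE (c d : R) x : Iplus_integrand Li c d p x =
  Li (expR (c * x))%:C * (x ^+ p / (1 + expR (d * x)))%:C.
Proof. by rewrite /Iplus_integrand mulrAC -fmorphV mulrC -rmorphM. Qed.

Let coef k : R := (1 + (-1) ^+ (t + k)) * zeta R (t - k) * a ^+ k / k`!%:R.

(** The integral of x^p Li_t(e^{-ax}) / (1 + e^{bx}) over x > 0, common to both half-lines. *)
Definition polylog_fermi : R :=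
  limn (series (fun n => n%:R^-1 ^+ t * fermi p (n%:R * a) b)).

Lemma has_integral_power_fermi m :
  has_integral I (fun x => x ^+ m / (1 + expR (b * x))) (fermi m 0 b).
Proof.
apply: has_integral_eq mI _ (has_integral_fermi m (lexx 0) b_gt0) => x _.
by rewrite mul0r oppr0 expR0 mulr1.
Qed.

Lemma has_integral_Re_pos : has_integral I (fun x => complex.Re (f x))
  (\sum_(0 <= k < t.+1) coef k * fermi (p + k) 0 b - (-1) ^+ t * polylog_fermi).
Proof.
have H1 : has_integral I (fun x => \sum_(0 <= k < t.+1) coef k * (x ^+ (p + k) / (1 + expR (b * x))))
   (\sum_(0 <= k < t.+1) coef k * fermi (p + k) 0 b).
  by apply: has_integral_sum => // k _; apply: has_integralZ => //; exact: has_integral_power_fermi.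
have H2 := has_integralZ ((-1) ^+ t) mI (has_integral_rpolylog_fermi p t_gt0 a_gt0 b_gt0).
apply: has_integral_eq mI _ (has_integralB mI H1 H2) => x.
rewrite /I /= in_itv /= andbT => x0; have ax : 0 < a * x by rewrite mulr_gt0.
rewrite /f Iplus_integrandE ReM_real.
have -> := canRL (addrK _) (polylog_cut_Re t_gt0 Li_polylog ax).
rewrite mulrBl; congr (_ - _); last first.
  move: (rpolylog _ _) (x ^+ p) ((1 + expR (b * x))^-1) ((-1) ^+ t) => S X y s; by ring.
rewrite mulr_suml; apply: eq_bigr => k _; rewrite /coef exprMn [x ^+ (p + k)]exprD.
move: (x ^+ p) (x ^+ k) (a ^+ k) ((1 + expR (b * x))^-1) (k`!%:R^-1) (1 + _) (zeta R _).
by move=> u v w y z c s; ring.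
Qed.

Lemma has_integral_Im_pos : has_integral I (fun x => complex.Im (f x))
  (- pi * a ^+ t.-1 / (t.-1)`!%:R * fermi (p + t.-1) 0 b).
Proof.
have H := has_integralZ (- pi * a ^+ t.-1 / (t.-1)`!%:R) mI (has_integral_power_fermi (p + t.-1)).
apply: has_integral_eq mI _ H => x.
rewrite /I /= in_itv /= andbT => x0; have ax : 0 < a * x by rewrite mulr_gt0.
rewrite /f Iplus_integrandE ImM_real (polylog_cut_Im t_gt0 Li_polylog ax) exprMn exprD.
move: (x ^+ p) (x ^+ t.-1) (a ^+ t.-1) ((1 + expR (b * x))^-1) ((t.-1)`!%:R^-1) => u v w y z.
by ring.
Qed.

(** From 1 / (1 + e^{-bx}) = 1 - 1 / (1 + e^{bx}): the 1 gives the zeta term, the rest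
    [polylog_fermi]. *)
Lemma has_integral_Re_neg : has_integral I (fun x => complex.Re (f (- x)))
  ((-1) ^+ p * (p`!%:R / a ^+ p.+1 * zeta R (p + t + 1) - polylog_fermi)).
Proof.
have H := has_integralZ ((-1) ^+ p) mI (has_integralB mI (has_integral_rpolylog p t_gt0 a_gt0)
  (has_integral_rpolylog_fermi p t_gt0 a_gt0 b_gt0)).
apply: has_integral_eq mI _ H => x.
rewrite /I /= in_itv /= andbT => x0; have ax : 0 < a * x by rewrite mulr_gt0.
have e1 : `|expR (- (a * x))| < 1 by rewrite ger0_norm ?expR_ge0// expR_lt1 oppr_lt0.
rewrite /f Iplus_integrandE ReM_real !mulrN (polylog_disc t_gt0 Li_polylog e1) /=.
rewrite [(- x) ^+ p]exprNn [expR (- (b * x))]expRN.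
have := expR_gt0 (b * x); have := fermi_den_gt0 b x; move: (expR (b * x)) => E D E0.
move: (rpolylog t _) (x ^+ p) ((-1) ^+ p) => S X s.
by field; rewrite !gt_eqF// addrC.
Qed.

Lemma has_integral_Im_neg : has_integral I (fun x => complex.Im (f (- x))) 0.
Proof.
apply: has_integral_eq mI _ (has_integral0 mI) => x.
rewrite /I /= in_itv /= andbT => x0; have ax : 0 < a * x by rewrite mulr_gt0.
have e1 : `|expR (- (a * x))| < 1 by rewrite ger0_norm ?expR_ge0// expR_lt1 oppr_lt0.
by rewrite /f Iplus_integrandE ImM_real mulrN (polylog_disc t_gt0 Li_polylog e1) /= mul0r.
Qed.

Definition Re_total : R :=
  \sum_(0 <= k < t.+1) coef k * fermi (p + k) 0 b - (-1) ^+ t * polylog_fermi +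
  (-1) ^+ p * (p`!%:R / a ^+ p.+1 * zeta R (p + t + 1) - polylog_fermi).

Definition Im_total : R := - pi * a ^+ t.-1 / (t.-1)`!%:R * fermi (p + t.-1) 0 b.

Lemma Iplus_pos : cintegrable f /\ Iplus Li a b p = Re_total +i* Im_total.
Proof.
have [r1 r2] := has_integral_line has_integral_Re_pos has_integral_Re_neg.
have [i1 i2] := has_integral_line has_integral_Im_pos has_integral_Im_neg.
by split; [split|rewrite /Iplus /cintegral -/f r2 i2 addr0].
Qed.

(** Changing both signs amounts to x -> -x, which swaps the half-lines and produces (-1)^p. *)
Lemma Iplus_neg : cintegrable (Iplus_integrand Li (- a) (- b) p) /\
  Iplus Li (- a) (- b) p = ((-1) ^+ p)%:C * (Re_total +i* Im_total).
Proof.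
have E x : Iplus_integrand Li (- a) (- b) p x = ((-1) ^+ p)%:C * f (- x).
  rewrite /f !Iplus_integrandE !mulrN !mulNr [(- x) ^+ p]exprNn mulrCA -rmorphM; congr (_ * _%:C).
  by rewrite mulrA mulrA -exprMn mulrNN mulr1 expr1n mul1r.
have ERe x : complex.Re (Iplus_integrand Li (- a) (- b) p x) = (-1) ^+ p * complex.Re (f (- x)).
  by rewrite E mulrC ReM_real mulrC.
have EIm x : complex.Im (Iplus_integrand Li (- a) (- b) p x) = (-1) ^+ p * complex.Im (f (- x)).
  by rewrite E mulrC ImM_real mulrC.
have Rp : has_integral I (fun x => complex.Re (Iplus_integrand Li (- a) (- b) p x))
    ((-1) ^+ p * ((-1) ^+ p * (p`!%:R / a ^+ p.+1 * zeta R (p + t + 1) - polylog_fermi))).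
  by apply: has_integral_eq mI _ (has_integralZ ((-1) ^+ p) mI has_integral_Re_neg) => x _; rewrite ERe.
have Rn : has_integral I (fun x => complex.Re (Iplus_integrand Li (- a) (- b) p (- x)))
    ((-1) ^+ p * (\sum_(0 <= k < t.+1) coef k * fermi (p + k) 0 b - (-1) ^+ t * polylog_fermi)).
  by apply: has_integral_eq mI _ (has_integralZ ((-1) ^+ p) mI has_integral_Re_pos) => x _; rewrite ERe opprK.
have Ip : has_integral I (fun x => complex.Im (Iplus_integrand Li (- a) (- b) p x))
    ((-1) ^+ p * 0).
  by apply: has_integral_eq mI _ (has_integralZ ((-1) ^+ p) mI has_integral_Im_neg) => x _; rewrite EIm.
have In : has_integral I (fun x => complex.Im (Iplus_integrand Li (- a) (- b) p (- x)))
    ((-1) ^+ p * Im_total).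
  by apply: has_integral_eq mI _ (has_integralZ ((-1) ^+ p) mI has_integral_Im_pos) => x _; rewrite EIm opprK.
have [r1 r2] := has_integral_line Rp Rn; have [i1 i2] := has_integral_line Ip In.
split; first by split.
rewrite /Iplus /cintegral r2 i2 mulr0 add0r -mulrDr addrC -/Re_total -/Im_total.
by apply/eqP; rewrite eq_complex /= !mul0r subr0 addr0 !eqxx.
Qed.

Lemma sum_even_double (H : nat -> R) n :
  \sum_(0 <= r < n.+1) (1 + (-1) ^+ r) * H r = 2 * \sum_(0 <= j < n./2.+1) H (2 * j)%N.
Proof.
elim: n => [|n IH]; first by rewrite !big_nat1 expr0 muln0.
rewrite big_nat_recr//= {}IH uphalf_half -signr_odd /=.
case: (boolP (odd n)) => on /=.
  rewrite expr0 add1n [in RHS]big_nat_recr//= mulrDr; congr (_ + 2 * H _).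
  by rewrite mul2n doubleS -[in LHS](odd_double_half n) on add1n.
by rewrite expr1 subrr mul0r addr0 add0n.
Qed.

Let q := a / b.
Let scale : R := b ^+ p.+1 / p`!%:R.

Lemma Im_total_scaled : scale * Im_total =
  - (q ^+ t.-1 * 'C((p + t).-1, p)%:R * eta R (p + t) * pi).
Proof.
have pt : (p + t = (p + t.-1).+1)%N by rewrite -addnS prednK.
rewrite /Im_total /scale eta_fermi// pt /= /q expr_div_n.
have f0 k : k`!%:R != 0 :> R by rewrite pnatr_eq0 -lt0n fact_gt0.
have B : ('C(p + t.-1, p)%:R * p`!%:R * (t.-1)`!%:R = (p + t.-1)`!%:R :> R).
  by rewrite -!natrM -mulnA; have := bin_fact (leq_addr t.-1 p); rewrite addKn => ->.
rewrite -B -addnS exprD; have b0 : b != 0 by rewrite gt_eqF.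
rewrite prednK// -(prednK t_gt0) /= !exprS.
move: (b ^+ p) (b ^+ t.-1) (expf_neq0 p b0) (expf_neq0 t.-1 b0) => u v u0 v0.
by field; rewrite u0 v0 b0 !f0.
Qed.

Lemma Re_sum_scaled : scale * \sum_(0 <= k < t.+1) coef k * fermi (p + k) 0 b =
  2 * \sum_(0 <= j < t./2.+1)
            q ^+ (t - 2 * j) * 'C(p + t - 2 * j, p)%:R
              * eta R (p + t + 1 - 2 * j) * zeta R (2 * j).
Proof.
(* The sum is reversed by r = t - k, so that r becomes the argument of zeta; t + k has the parity of
   r, and [sum_even_double] keeps the even r only. *)
pose H r := q ^+ (t - r) * 'C(p + t - r, p)%:R * eta R (p + t + 1 - r) * zeta R r.
rewrite -(sum_even_double H) mulr_sumr big_nat_rev /= add0n.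
rewrite big_nat_cond [RHS]big_nat_cond; apply: eq_bigr => r /andP[/andP[_ rt] _].
rewrite ltnS in rt; rewrite subSS /H /coef subKn//.
have -> : (-1) ^+ (t + (t - r)) = (-1) ^+ r :> R.
  rewrite -[in LHS](signr_odd R (t + (t - r))) -(signr_odd R r); congr (_ ^+ _).
  by rewrite oddD oddB// addbA addbb addFb.
have -> : (p + t - r = p + (t - r))%N by rewrite addnBA.
have -> : (p + t + 1 - r = (p + (t - r)).+1)%N by rewrite addn1 subSn ?(leq_trans rt (leq_addl _ _))// addnBA.
move: (t - r)%N => k; rewrite eta_fermi// /scale /q expr_div_n.
have f0 j : j`!%:R != 0 :> R by rewrite pnatr_eq0 -lt0n fact_gt0.
have B : ('C(p + k, p)%:R * p`!%:R * k`!%:R = (p + k)`!%:R :> R).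
  by rewrite -!natrM -mulnA; have := bin_fact (leq_addr k p); rewrite addKn => ->.
rewrite -B -addnS exprD; have b0 : b != 0 by rewrite gt_eqF.
rewrite !exprS; move: (b ^+ p) (b ^+ k) (expf_neq0 p b0) (expf_neq0 k b0) => u v u0 v0.
by field; rewrite u0 v0 b0 !f0.
Qed.

Let term (n k : nat) : R := (-1) ^+ k / (n%:R ^+ t * (q * n%:R + k%:R) ^+ p.+1).

Lemma cvg_term n : (0 < n)%N ->
  \sum_(1 <= k < N) term n k @[N --> \oo] --> - scale * (n%:R^-1 ^+ t * fermi p (n%:R * a) b).
Proof.
move=> n0; have na : 0 <= n%:R * a by rewrite mulr_ge0// ltW.
have H := @cvg_fermi R p _ b na b_gt0.
have H2 : - scale * n%:R^-1 ^+ t * (\sum_(1 <= k < N) (-1) ^+ k.+1 * (p`!%:R / (n%:R * a + k%:R * b) ^+ p.+1)) @[N --> \oo]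
   --> - scale * n%:R^-1 ^+ t * fermi p (n%:R * a) b by apply: cvgM; [exact: cvg_cst|exact: H].
rewrite mulrA; apply: cvg_trans H2; apply: near_eq_cvg; apply: nearW => N.
rewrite mulr_sumr; apply: eq_bigr => k _; rewrite /term /scale.
have b0 : b != 0 by rewrite gt_eqF.
have -> : q * n%:R + k%:R = (n%:R * a + k%:R * b) / b by rewrite /q; field.
have f0 : p`!%:R != 0 :> R by rewrite pnatr_eq0 -lt0n fact_gt0.
rewrite expr_div_n invfM invf_div exprVn [(-1) ^+ k.+1]exprS.
move: ((n%:R * a + k%:R * b) ^+ p.+1)^-1 => Y.
move: (b ^+ p.+1) (n%:R ^- t) => X Z.
by field.
Qed.

(** By [cvg_term] the inner sums are multiples of the terms of [polylog_fermi], so the outer sum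
    inherits the convergence of that series. *)
Lemma cvg_rsum_term : rsummable (fun n => rsum (term n)) /\
  rsum (fun n => rsum (term n)) = - scale * polylog_fermi.
Proof.
have C := @is_cvg_fermi_series R p t a t_gt0 a_gt0 b b_gt0.
have H : \sum_(1 <= n < N) rsum (term n) @[N --> \oo] --> - scale * polylog_fermi.
  have : - scale * series (fun n => n%:R^-1 ^+ t * fermi p (n%:R * a) b) N @[N --> \oo] --> - scale * polylog_fermi.
    by apply: cvgM; [exact: cvg_cst|exact: C].
  apply: cvg_trans; apply: near_eq_cvg; apply: nearW => -[|N].
    by rewrite /series /= !big_geq// mulr0.
  rewrite /series /= [X in _ * X]big_ltn// invr0 expr0n (gtn_eqF t_gt0) mul0r add0r mulr_sumr.
  apply: eq_big_nat => n /andP[n0 _]; apply/esym/cvg_lim => //; exact: cvg_term.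
by split; [apply/cvg_ex; eexists; exact: H|exact: cvg_lim H].
Qed.

(** The inner alternating sum at n is rewritten by [harmonic_ext_alternating] at x = q n; for t > 1
    the three resulting series converge separately. *)
Lemma polylog_fermi_euler_sum : (1 < t)%N ->
  - scale * polylog_fermi =
  euler_sum p.+1 t q - 2 ^- p * euler_sum p.+1 t (q / 2) - eta R p.+1 * zeta R t.
Proof.
move=> t1; have q0 : 0 < q by rewrite divr_gt0.
have q20 : 0 < q / 2 by rewrite divr_gt0.
have S1 := rsummable_euler_sum (ltn0Sn p) t1 q0.
have S2 := rsummable_euler_sum (ltn0Sn p) t1 q20.
have [_ <-] := cvg_rsum_term; apply: cvg_lim => //.
have zt : \sum_(1 <= n < N) n%:R^-1 ^+ t @[N --> \oo] --> zeta R t.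
  have z0 : (0%:R : R)^-1 ^+ t = 0 by rewrite invr0 expr0n gtn_eqF.
  rewrite zetaE// -(rsum_series z0); rewrite /rsum.
  by have := @is_cvg_inv_powers R _ t1; rewrite -(rsummable_series z0).
have L : (\sum_(1 <= n < N) harmonic_ext p.+1 (q * n%:R) / n%:R ^+ t)
   - 2 ^- p * (\sum_(1 <= n < N) harmonic_ext p.+1 (q / 2 * n%:R) / n%:R ^+ t)
   - eta R p.+1 * (\sum_(1 <= n < N) n%:R^-1 ^+ t) @[N --> \oo] -->
  euler_sum p.+1 t q - 2 ^- p * euler_sum p.+1 t (q / 2) - eta R p.+1 * zeta R t.
  apply: cvgB; last by apply: cvgM; [exact: cvg_cst|exact: zt].
  by apply: cvgB; [exact: S1|apply: cvgM; [exact: cvg_cst|exact: S2]].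
apply: cvg_trans L; apply: near_eq_cvg; apply: nearW => N.
rewrite !mulr_sumr -!sumrB; apply: eq_big_nat => n /andP[n0 _].
have np : 0 < n%:R :> R by rewrite ltr0n.
have qn : 0 < q * n%:R by rewrite mulr_gt0.
have E := harmonic_ext_alternating p qn.
have -> : q / 2 * n%:R = q * n%:R / 2 by rewrite mulrAC.
have -> : harmonic_ext p.+1 (q * n%:R) = eta R p.+1 - fermi p (q * n%:R) 1 / p`!%:R + 2 ^- p * harmonic_ext p.+1 (q * n%:R / 2).
  by rewrite -E subrK.
have -> : rsum (term n) = - (n%:R ^- t * (fermi p (q * n%:R) 1 / p`!%:R)).
  rewrite /rsum; apply: cvg_lim => //.
  have H : - (n%:R ^- t * (\sum_(1 <= k < N) (-1) ^+ k.+1 * (q * n%:R + k%:R)^-1 ^+ p.+1)) @[N --> \oo] -->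
     - (n%:R ^- t * (fermi p (q * n%:R) 1 / p`!%:R)).
    by apply: cvgN; apply: cvgM; [exact: cvg_cst|exact: cvg_alternating (ltW qn)].
  apply: cvg_trans H; apply: near_eq_cvg; apply: nearW => M.
  rewrite mulr_sumr -sumrN; apply: eq_bigr => k _; rewrite /term exprVn [(-1) ^+ k.+1]exprS invfM.
  by ring.
rewrite exprVn; move: (fermi _ _ _ / _) (harmonic_ext _ _) (2 ^- p) (n%:R ^- t) => F h c d.
by ring.
Qed.

(** [polylog_fermi] enters with - (-1)^t from x > 0, by Jonquière's relation, and with - (-1)^p from
    x < 0. *)
Lemma Re_total_scaled : scale * Re_total =
  (-1) ^+ p / q ^+ p.+1 * zeta R (p + t + 1)
  + 2 * \sum_(0 <= j < t./2.+1)
            q ^+ (t - 2 * j) * 'C(p + t - 2 * j, p)%:R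
              * eta R (p + t + 1 - 2 * j) * zeta R (2 * j)
  + ((-1) ^+ t + (-1) ^+ p) * (- scale * polylog_fermi).
Proof.
rewrite -Re_sum_scaled /Re_total.
have -> : (-1) ^+ p / q ^+ p.+1 * zeta R (p + t + 1) = scale * ((-1) ^+ p * (p`!%:R / a ^+ p.+1 * zeta R (p + t + 1))).
  have f0 : p`!%:R != 0 :> R by rewrite pnatr_eq0 -lt0n fact_gt0.
  have a0 : a ^+ p.+1 != 0 by rewrite expf_neq0 ?gt_eqF.
  have b0 : b ^+ p.+1 != 0 by rewrite expf_neq0 ?gt_eqF.
  rewrite /scale /q expr_div_n; move: (a ^+ p.+1) (b ^+ p.+1) a0 b0 => u v u0 v0.
  by field; rewrite u0 v0 f0.
move: (\sum_(_ <= _ < _) _) polylog_fermi => S F; by ring.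
Qed.

End HalfLineIntegrals.

(** * Reduction to positive parameters and assembly *)

Local Open Scope complex_scope.

(** Integrability and summability are asserted along with the values, because an integral or an
    [rsum] by itself may be a default value. *)
Theorem theorem3p1 (R : realType) (t p : nat) (a b : R) (Li : R[i] -> R[i])
    (t_gt0 : (0 < t)%N) (ab_gt0 : 0 < a * b) (Li_polylog : is_polylog t Li) :
  let q := a / b in
  let lhs := (Num.sg b / p`!%:R * b ^+ p.+1)%:C * Iplus Li a b p in
  let main := (-1) ^+ p / q ^+ p.+1 * zeta R (p + t + 1)
    + 2 * \sum_(0 <= j < t./2.+1)
            q ^+ (t - 2 * j) * 'C(p + t - 2 * j, p)%:R
              * eta R (p + t + 1 - 2 * j) * zeta R (2 * j) in
  let last := q ^+ t.-1 * 'C((p + t).-1, p)%:R * eta R (p + t) * pi in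
  let term (n k : nat) : R :=
    (-1) ^+ k / (n%:R ^+ t * (q * n%:R + k%:R) ^+ p.+1) in
  [/\ cintegrable (Iplus_integrand Li a b p),
      odd (p + t) -> lhs = main -i* last,
      ~~ odd (p + t) ->
        [/\ forall n, (1 <= n)%N -> rsummable (term n),
            rsummable (fun n => rsum (term n))
          & lhs = (main + 2 * (-1) ^+ p * rsum (fun n => rsum (term n)))
                  -i* last]
    & ~~ odd (p + t) -> (1 < t)%N ->
        lhs = (main + 2 * (-1) ^+ p
                 * (euler_sum p.+1 t q - 2 ^- p * euler_sum p.+1 t (q / 2)
                    - eta R p.+1 * zeta R t))
              -i* last].
Proof.
(* [A] and [B] are the absolute values of a and b, with the same quotient. For b < 0 the factor
   (-1)^p of [Iplus_neg] combines with the sign of b to turn b^(p+1) into (-b)^(p+1). *)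
have [A [B [A0 B0 qE [Ci lhsE]]]] : exists A B : R, [/\ 0 < A, 0 < B, a / b = A / B &
    cintegrable (Iplus_integrand Li a b p) /\
    (Num.sg b / p`!%:R * b ^+ p.+1)%:C * Iplus Li a b p =
      (B ^+ p.+1 / p`!%:R)%:C * (Re_total t p A B +i* Im_total t p A B)].
  case: (ltrgtP b 0) => [b0|b0|b0]; last by move: ab_gt0; rewrite b0 mulr0 ltxx.
    have a0 : a < 0 by rewrite -(nmulr_lgt0 _ b0).
    have [Na Nb] : 0 < - a /\ 0 < - b by rewrite !oppr_gt0.
    exists (- a), (- b); have [] := Iplus_neg p t_gt0 Li_polylog Na Nb.
    rewrite !opprK => Ci ->; split=> //; first by rewrite invrN mulrNN.
    split=> //; rewrite mulrA -rmorphM; congr (_%:C * _).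
    rewrite ltr0_sg// [(- b) ^+ p.+1]exprNn [(-1) ^+ p.+1]exprS.
    by move: (b ^+ p.+1) (p`!%:R^-1) ((-1) ^+ p) => u v s; ring.
  have a0 : 0 < a by rewrite -(pmulr_lgt0 _ b0).
  exists a, b; have [Ci ->] := Iplus_pos p t_gt0 Li_polylog a0 b0.
  by split=> //; split=> //; rewrite gtr0_sg// mul1r [_^-1 * _]mulrC.
move=> q lhs main last term.
have rE : B ^+ p.+1 / p`!%:R * Re_total t p A B =
    main + ((-1) ^+ t + (-1) ^+ p) * (- (B ^+ p.+1 / p`!%:R) * polylog_fermi t p A B).
  by rewrite (Re_total_scaled t p A0 B0)// /main /q qE.
have iE : B ^+ p.+1 / p`!%:R * Im_total t p A B = - last.
  by rewrite (Im_total_scaled p A t_gt0)// /last /q qE.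
have lE : lhs = (main + ((-1) ^+ t + (-1) ^+ p) * (- (B ^+ p.+1 / p`!%:R) * polylog_fermi t p A B)) -i* last.
  rewrite /lhs lhsE -rE -iE; apply/eqP; rewrite eq_complex /= !mul0r subr0 addr0 ?opprK.
  by rewrite !eqxx.
(* The only place where the parity of p + t separates the cases. *)
have signs : (-1) ^+ t + (-1) ^+ p = (if odd (p + t) then 0 else 2 * (-1) ^+ p) :> R.
  rewrite -[(-1) ^+ t]signr_odd -[(-1) ^+ p]signr_odd oddD.
  by case: (odd t) (odd p) => -[] /=; rewrite ?expr0 ?expr1; ring.
split=> //.
- by move=> o; rewrite lE signs o mul0r addr0.
- move=> /negbTE e; have [s v] := cvg_rsum_term p t_gt0 A0 B0.
  have -> : term = (fun n k => (-1) ^+ k / (n%:R ^+ t * (A / B * n%:R + k%:R) ^+ p.+1)).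
    by rewrite /term /q qE.
  split=> //; last by rewrite lE signs e v.
  by move=> n n0; apply/cvg_ex; eexists; exact: (cvg_term A0 B0 n0).
- by move=> /negbTE e t1; rewrite lE signs e (polylog_fermi_euler_sum p t_gt0 A0 B0 t1) /q qE.
Qed.
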